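(* Let $d,s\in\mathbb{N}$, $r\in\{1,\dots,s\}$, $D\ge 1$, and let $\Phi\colon[0,\infty)\to[0,\infty)$ be one of the two functions specified in (i), (ii) below. Then there is a constant $C<\infty$ depending only on $d,s,\Phi,D$ such that the following holds. Let $\kappa\in(0,1)$ and let $P$ be a Markov kernel on $\mathbb{R}^d$ with $P^n(x,\cdot)\in\mathcal{P}_1(\mathbb{R}^d)$ and $W_1(P^n(x,\cdot),P^n(y,\cdot))\le D\kappa^n|x-y|$ for all $n\in\mathbb{N}$ and $x,y\in\mathbb{R}^d$. Let $(X_n)_{n\ge 0}$ be a time-homogeneous Markov chain with kernel $P$ such that $\sup_{n\in\mathbb{N}_0}\mathbb{E}[\Phi(|X_n|)]\le 1$, let $\mu\in\mathcal{P}_1(\mathbb{R}^d)$ be its unique invariant probability measure, $\mu_n=\frac1n\sum_{i=1}^n\delta_{X_i}$, and $n'=(1-\kappa)n$. (i) If $\Phi(x)=x^q$ for some $q>1$, then for all large enough $n$, $$\mathbb{E}\big[d_{C^s_1(\mathbb{R}^d)}(\mu,\mu_n)\big]\le C\,\big(\Gamma_{d,r}(n')\big)^{\frac{q-1}{q+r-1}}.$$ (ii) If $\Phi(x)=e^{\beta x}-1$ for some $\beta>0$, then for all large enough $n$, $$\mathbb{E}\big[d_{C^s_1(\mathbb{R}^d)}(\mu,\mu_n)\big]\le C\,(\log n')^{r}\,\Gamma_{d,r}(n').$$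
   Context: $\mathbb{N}=\{1,2,\dots\}$, $\mathbb{N}_0=\mathbb{N}\cup\{0\}$, $|\cdot|$ is the Euclidean norm. $\mathcal{P}_1(\mathbb{R}^d)$ is the set of Borel probability measures on $\mathbb{R}^d$ with finite first moment, $W_1$ the $1$-Wasserstein distance, $P^n$ the $n$-fold iterate of the kernel $P$. The contraction hypothesis implies that $P$ has a unique invariant probability measure $\mu\in\mathcal{P}_1(\mathbb{R}^d)$ ($\mu P=\mu$). $C^s(\mathbb{R}^d)$ is the set of $(s-1)$-times continuously differentiable functions $f\colon\mathbb{R}^d\to\mathbb{R}$ with Lipschitz continuous $(s-1)$-th derivative, with $$\|f\|_{C^s}=\max_{k\in\{1,\dots,s-1\}}\max_{\alpha\in\{1,\dots,d\}^k}\Big\|\frac{\partial^kf}{\partial x_{\alpha_1}\cdots\partial x_{\alpha_k}}\Big\|_\infty+\max_{\alpha\in\{1,\dots,d\}^{s-1}}\operatorname{Lip}\Big(\frac{\partial^{s-1}f}{\partial x_{\alpha_1}\cdots\partial x_{\alpha_{s-1}}}\Big),$$ where $\operatorname{Lip}$ is the Lipschitz constant (for $s=1$ the first term is absent, so $\|f\|_{C^1}=\operatorname{Lip}(f)$). $C^s_1(\mathbb{R}^d)=\{f\in C^s(\mathbb{R}^d):\|f\|_{C^s}\le1\}$, and $d_{C^s_1(\mathbb{R}^d)}(\mu,\nu)=\sup_{f\in C^s_1(\mathbb{R}^d)}|\mu(f)-\nu(f)|$ for $\mu,\nu\in\mathcal{P}_1(\mathbb{R}^d)$, where $\mu(f)=\int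 f\,d\mu$. For $t>1$, $$\Gamma_{d,r}(t)=\begin{cases}(\log t)^{d-2r+r/d}\,t^{-r/d},& d>2r,\\ (\log t)\,t^{-1/2},& d=2r,\\ (\log t)^{d/(2r+1)}\,t^{-1/2},& d<2r.\end{cases}$$ *)

(* Defs.v *)
From HB Require Import structures.
From mathcomp Require Import all_boot all_order all_algebra.
From mathcomp Require Import all_classical all_reals all_analysis.

Set Implicit Arguments.
Unset Strict Implicit.
Unset Printing Implicit Defensive.

Import Order.TTheory GRing.Theory Num.Theory.
Import numFieldNormedType.Exports.

Local Open Scope classical_set_scope.
Local Open Scope ring_scope.

(* The Borel sigma-algebra: the library's topology on matrices is the product
   topology (its norm is the max norm), hence the Euclidean topology. *)
HB.instance Definition _ (R : realType) (m n : nat) :=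
  Measurable.copy 'M[R]_(m, n) (g_sigma_algebraType (@open 'M[R]_(m, n))).

Section composition_of_probability_kernels.
Context d0 d1 d2 (T0 : measurableType d0) (T1 : measurableType d1)
  (T2 : measurableType d2) (R : realType).
Variables (k1 : R.-pker T0 ~> T1) (k2 : R.-pker T1 ~> T2).

Let mkcomp_noparam_prob x : mkcomp_noparam k1 k2 x [set: T2] = 1%E.
Proof.
rewrite /mkcomp_noparam /= /kcomp_noparam.
under eq_integral do rewrite prob_kernel.
by rewrite integral_cst// mul1e prob_kernel.
Qed.

HB.instance Definition _ := @Kernel_isProbability.Build _ _ _ _ _
  (mkcomp_noparam k1 k2) mkcomp_noparam_prob.

End composition_of_probability_kernels.

Fixpoint kiter d (T : measurableType d) (R : realType) (P : R.-pker T ~> T)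
    (n : nat) : R.-pker T ~> T :=
  if n is m.+1 then mkcomp_noparam (kiter P m) P
  else kdirac (@measurable_id _ T setT).

Section euclidean_space.
Context {R : realType} {d : nat}.
Implicit Types (x y : 'rV[R]_d) (f g : 'rV[R]_d -> R).
Implicit Types mu nu : {measure set 'rV[R]_d -> \bar R}.

(* The norm `|x| of the library on 'rV[R]_d is the max norm. *)
Definition enorm x : R := Num.sqrt (\sum_(i < d) x ord0 i ^+ 2).

Definition in_P1 mu : Prop :=
  mu setT = 1%E /\ (\int[mu]_x (enorm x)%:E < +oo)%E.

Definition coupling mu nu
    (pi : probability ('rV[R]_d * 'rV[R]_d)%type R) : Prop :=
  forall A, measurable A ->
    pi (A `*` setT) = mu A /\ pi (setT `*` A) = nu A.

Definition W1 mu nu : \bar R :=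
  ereal_inf [set (\int[pi]_z (enorm (z.1 - z.2))%:E)%E
            | pi in coupling mu nu].

Definition invariant_measure (P : R.-pker 'rV[R]_d ~> 'rV[R]_d) mu : Prop :=
  forall A, measurable A -> (\int[mu]_x P x A)%E = mu A.

(* partial f [:: a1; ...; ak] is d^k f / (dx_a1 ... dx_ak). *)
Definition partial f (a : seq 'I_d) : 'rV[R]_d -> R :=
  foldr (fun i g x => 'D_(delta_mx ord0 i) g x) f a.

Definition supnorm g : \bar R := ereal_sup [set `|g x|%:E | x in setT].

Definition Lip g : \bar R :=
  ereal_sup [set (`|g z.1 - g z.2| / enorm (z.1 - z.2))%:E
            | z in [set z : 'rV[R]_d * 'rV[R]_d | z.1 <> z.2]].

(* (s - 1)-times continuously differentiable: all partial derivatives of order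
   at most s - 1 exist and are continuous. *)
Definition in_Cs (s : nat) f : Prop :=
  [/\ forall (a : seq 'I_d) (i : 'I_d) x, ((size a).+1 < s)%N ->
        derivable (partial f a) x (delta_mx ord0 i),
      forall a : seq 'I_d, (size a < s)%N -> continuous (partial f a)
    & forall a : seq 'I_d, size a = s.-1 -> (Lip (partial f a) < +oo)%E].

Definition Cs_norm (s : nat) f : \bar R :=
  (\big[maxe/0]_(1 <= k < s) \big[maxe/0]_(a : k.-tuple 'I_d)
     supnorm (partial f a)
   + \big[maxe/0]_(a : s.-1.-tuple 'I_d) Lip (partial f a))%E.

Definition in_Cs1 (s : nat) f : Prop := in_Cs s f /\ (Cs_norm s f <= 1)%E.

Definition d_Cs1 (s : nat) mu nu : \bar R :=
  ereal_sup [set `|\int[mu]_x (f x)%:E - \int[nu]_x (f x)%:E|%E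
            | f in in_Cs1 s].

End euclidean_space.

Section markov_chain.
Context {R : realType} {d : nat} {disp : measure_display}
  {Omega : measurableType disp} {Pr : probability Omega R}.
Implicit Types X : {RV Pr >-> 'rV[R]_d}^nat.

(* sigma(X_0, ..., X_n) *)
Definition history X (n : nat) : set (set Omega) :=
  <<s [set X i @^-1` A | i in [set i | (i <= n)%N] & A in measurable] >>.

(* The second condition says that P (X_n, A) is a version of the conditional
   probability of {X_(n+1) \in A} given sigma(X_0, ..., X_n). *)
Definition markov_chain (P : R.-pker 'rV[R]_d ~> 'rV[R]_d) X : Prop :=
  forall n A B, measurable A -> history X n B ->
    Pr (B `&` X n.+1 @^-1` A) = (\int[Pr]_(w in B) P (X n w) A)%E.

Definition empirical X (n : nat) (w : Omega) :
    {measure set 'rV[R]_d -> \bar R} :=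
  mscale (n%:R^-1)%:nng (msum (fun i => \d_(X i.+1 w)) n).

End markov_chain.

Definition power_moment {R : realType} (q : R) (Phi : R -> R) : Prop :=
  forall x, 0 <= x -> Phi x = x `^ q.

Definition exp_moment {R : realType} (beta : R) (Phi : R -> R) : Prop :=
  forall x, 0 <= x -> Phi x = expR (beta * x) - 1.

Definition Gamma {R : realType} (d r : nat) (t : R) : R :=
  if (2 * r < d)%N then
    ln t `^ (d%:R - 2 * r%:R + r%:R / d%:R) * t `^ (- (r%:R / d%:R))
  else if d == (2 * r)%N then ln t * t `^ (- 2^-1)
  else ln t `^ (d%:R / (2 * r%:R + 1)) * t `^ (- 2^-1).

(* Main.v *)
Require Import Defs.
From HB Require Import structures.
From mathcomp Require Import all_boot all_order all_algebra.
From mathcomp Require Import all_classical all_reals all_analysis.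
From mathcomp Require Import measurable_realfun qpoly ring lra zify.

Set Implicit Arguments.
Unset Strict Implicit.
Unset Printing Implicit Defensive.

Import Order.TTheory GRing.Theory Num.Theory.
Import numFieldNormedType.Exports.

Local Open Scope classical_set_scope.
Local Open Scope ring_scope.

(** The class of test functions is replaced by finitely many explicit functions,
    by a multiscale decomposition, and each of them is controlled by a variance
    estimate for the chain.

    A function [f] with [Cs_norm s f <= 1] is, along every coordinate line and
    on every interval of radius [h], within [h ^+ r] of a polynomial of degree
    less than [r] ([Cs1_coord_approx]). Interpolating it at the nodes of dyadic
    grids of mesh [rad / 2 ^+ l] covering the cube of radius [rad], and gluing the
    local interpolants by products of hat functions, writes [f - f 0] as a sum
    over the scales [l <= L] of combinations of fixed test functions with
    coefficients of order [(rad / 2 ^+ l) ^+ r], up to the error of the finest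
    scale and a truncation error outside the ball of radius [rad / 2]
    ([multiscale_decomposition]). The discrepancy over the whole class is
    thereby bounded, for each trajectory, by a weighted sum of the fluctuations
    of the test functions ([pathwise_bound]).

    For one test function [g], contraction in the Wasserstein distance makes the
    conditional mean [kmean P k g] converge geometrically to the invariant mean
    ([kmean_ergodic]). The covariance at lag [k] is bounded through this mean, so
    the variance of the time average has order one over [(1 - kappa) * n]
    ([average_variance]). The Lipschitz constant of [g], of order [2 ^+ l],
    would spoil the sum over the lags; a power [eta / l.+1] of the geometric
    bound reduces its effect to a factor [l.+1] ([sum_kmean_centered]).

    Summing over the cells of one scale uses Cauchy-Schwarz with weights growing
    away from the origin: the moments of the chain pay for the weights, and the
    inverse weights reduce the effective number of cells ([level_deviation]).
    Summing over the scales, and choosing the finest one, gives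
    [rad ^+ r * Gamma d r t] with [t = (1 - kappa) * n] as soon as [rad] is at
    least [ln t] ([rate_bound]), plus the mean excess of the chain over
    [rad / 2]. Balancing the two terms through [rad] yields the two rates
    ([power_rate], [exponential_rate]). *)

(** * Lagrange interpolation *)

Section lagrange_interpolation.
Context {R : realType}.

Definition lag (r : nat) (k : 'I_r) : {poly R} :=
  tnth (@lagrange R r (fun j => j%:R)) k.

(** Interpolating at the nodes [y + h * k] amounts to composing with an affine
    change of variable, which preserves the degree. *)
Lemma lag_affine r (p : {poly R}) (y h x : R) : (0 < r)%N -> h != 0 ->
  (size p <= r)%N ->
  \sum_(k < r) p.[y + h * k%:R] * (lag k).[(x - y) / h] = p.[x].
Proof.
move=> r0 h0 sp; set q := p \Po (h%:P * 'X + y%:P).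
have natinj : injective (fun j : nat => j%:R : R).
  by move=> a b /eqP; rewrite eqr_nat => /eqP.
have hq u : q.[u] = p.[y + h * u].
  by rewrite /q horner_comp !hornerE addrC.
have sq : (size q <= r)%N.
  by rewrite size_comp_poly2// size_MXaddC polyC_eq0 (negPf h0)/= size_polyC h0.
have -> : p.[x] = q.[(x - y) / h] by rewrite hq; congr (_.[_]); field.
rewrite (lagrange_gen r0 natinj sq) horner_sum.
by apply: eq_bigr => k _; rewrite hornerM hornerC hq.
Qed.

Lemma lag_sum1 r (u : R) : (0 < r)%N -> \sum_(k < r) (lag k).[u] = 1.
Proof.
move=> r0; have := @lag_affine r 1 0 1 u r0 (oner_neq0 _).
rewrite size_poly1 subr0 divr1 hornerE => /(_ r0) <-.
by apply: eq_bigr => k _; rewrite hornerE mul1r.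
Qed.

Lemma horner_bounded (p : {poly R}) (rho : R) :
  exists2 B, 0 <= B & forall u, `|u| <= rho -> `|p.[u]| <= B.
Proof.
exists (\sum_(i < size p) `|p`_i| * `|rho| ^+ i).
  by apply: sumr_ge0 => i _; rewrite mulr_ge0// exprn_ge0.
move=> u urho; rewrite horner_coef; apply: (le_trans (ler_norm_sum _ _ _)).
apply: ler_sum => i _; rewrite normrM normrX ler_wpM2l//.
by rewrite lerXn2r ?nnegrE// (le_trans urho)// ler_norm.
Qed.

Lemma lag_bounded r (rho : R) :
  exists2 B, 1 <= B & forall u, `|u| <= rho ->
    \sum_(k < r) `|(lag k).[u]| <= B.
Proof.
have /choice[B hB] : forall k : 'I_r, exists b : R, 0 <= b /\
    forall u, `|u| <= rho -> `|(lag k).[u]| <= b.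
  by move=> k; have [b b0 hb] := horner_bounded (lag k) rho; exists b.
exists (1 + \sum_(k < r) B k).
  by rewrite lerDl sumr_ge0// => k _; case: (hB k).
move=> u hu; apply: ler_wpDl => //; apply: ler_sum => k _.
by case: (hB k) => _; apply.
Qed.

(** Interpolation reproduces polynomials, so its error is that of the best
    polynomial approximation times one plus the Lebesgue constant. *)
Lemma lag_error r (g : R -> R) (p : {poly R}) (h rho e B t : R) :
  (0 < r)%N -> 0 < h -> r%:R <= rho -> (size p <= r)%N ->
  (forall t, `|t| <= rho * h -> `|g t - p.[t]| <= e) ->
  (forall u, `|u| <= rho -> \sum_(k < r) `|(lag k).[u]| <= B) ->
  `|t| <= rho * h ->
  `|g t - \sum_(k < r) (lag k).[t / h] * g (h * k%:R)| <= (1 + B) * e.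
Proof.
move=> r0 h0 rrho sp gp lB ht.
have e0 : 0 <= e by apply: le_trans (gp t ht).
have := @lag_affine r p 0 h t r0 (lt0r_neq0 h0) sp.
rewrite subr0 => pt.
have -> : g t - \sum_(k < r) (lag k).[t / h] * g (h * k%:R) =
  (g t - p.[t]) -
  \sum_(k < r) (lag k).[t / h] * (g (h * k%:R) - p.[h * k%:R]).
  rewrite (eq_bigr (fun k : 'I_r => (lag k).[t / h] * (g (h * k%:R) -
    p.[h * k%:R]) + p.[0 + h * k%:R] * (lag k).[t / h])); last first.
    by move=> k _; rewrite add0r mulrBr [p.[_] * _]mulrC subrK.
  by rewrite big_split/= pt opprD addrA addrAC.
rewrite mulrDl mul1r (le_trans (ler_normB _ _))// lerD ?gp//.
apply: (le_trans (ler_norm_sum _ _ _)).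
apply: (@le_trans _ _ (\sum_(k < r) `|(lag k).[t / h]| * e)).
  apply: ler_sum => k _; rewrite normrM ler_wpM2l// gp//.
  rewrite normrM (gtr0_norm h0) normr_nat mulrC ler_pM2r//.
  by apply: le_trans rrho; rewrite ler_nat ltnW.
rewrite -mulr_suml ler_wpM2r// lB//.
by rewrite normrM normfV (gtr0_norm h0) ler_pdivrMr.
Qed.

End lagrange_interpolation.

Section product_sums.
Context {R : comNzRingType} {I T : finType}.
Implicit Types (j : {ffun I -> T}) (q : I -> T -> R).

Definition upd j m k : {ffun I -> T} := [ffun i => if i == m then k else j i].

Lemma upd_same j m k : upd j m k m = k.
Proof. by rewrite ffunE eqxx. Qed.

Lemma upd_other j m k i : i != m -> upd j m k i = j i.
Proof. by rewrite ffunE => /negPf ->. Qed.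

Lemma updK j m k : upd (upd j m k) m (j m) = j.
Proof. by apply/ffunP => i; rewrite !ffunE; case: eqP => // ->. Qed.

(** Averaging over one coordinate of a product of signed measures, that
    coordinate having total mass one. The map exchanging [j m] with [k] is an
    involution that preserves the product weights. *)
Lemma sum_prod_upd q m (A : {ffun I -> T} -> R) : \sum_k q m k = 1 ->
  \sum_(j : {ffun I -> T}) (\prod_i q i (j i)) * A j =
  \sum_(j : {ffun I -> T})
    (\prod_i q i (j i)) * \sum_k q m k * A (upd j m k).
Proof.
move=> q1.
under [RHS]eq_bigr do rewrite mulr_sumr.
rewrite pair_bigA/=.
pose sw (p : {ffun I -> T} * T) := (upd p.1 m p.2, p.1 m).
have swK : involutive sw.
  by move=> [j k]; rewrite /sw/= upd_same updK.
rewrite (reindex_inj (inv_inj swK))/=.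
rewrite -(pair_bigA _ (fun j k => (\prod_i q i (upd j m k i)) *
   (q m (j m) * A (upd (upd j m k) m (j m)))))/=.
apply: eq_bigr => j _.
have swP k : (\prod_i q i (upd j m k i)) * q m (j m) =
    q m k * \prod_i q i (j i).
  rewrite (bigD1 m)//= upd_same (eq_bigr (fun i => q i (j i))); last first.
    by move=> i im; rewrite upd_other.
  by rewrite [in RHS](bigD1 m)//= -mulrA [X in _ * X]mulrC.
under [RHS]eq_bigr do rewrite updK mulrA swP -mulrA.
by rewrite -mulr_suml q1 mul1r.
Qed.

End product_sums.

(** Integrates out the second components of a product weight; the components
    are later a node of a tree and the choice of one of its children. *)
Lemma sum_prod_fst (R : comNzRingType) (I S T : finType)
  (q : I -> S * T -> R) (A : {ffun I -> S} -> R) :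
  \sum_(j : {ffun I -> S * T}) (\prod_i q i (j i)) * A [ffun i => (j i).1] =
  \sum_(j : {ffun I -> S}) (\prod_i \sum_t q i (j i, t)) * A j.
Proof.
pose f (p : {ffun I -> S} * {ffun I -> T}) : {ffun I -> S * T} :=
  [ffun i => (p.1 i, p.2 i)].
rewrite (reindex f) /=; last first.
  exists (fun j => ([ffun i => (j i).1], [ffun i => (j i).2])).
    by move=> [j k] _; congr pair; apply/ffunP => i; rewrite !ffunE.
  by move=> j _; apply/ffunP => i; rewrite !ffunE; case: (j i).
rewrite -(pair_bigA _ (fun j k => (\prod_i q i (f (j, k) i)) *
   A [ffun i => (f (j, k) i).1]))/=.
apply: eq_bigr => j _; rewrite bigA_distr_bigA mulr_suml.
apply: eq_bigr => k _; congr (_ * A _).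
  by apply: eq_bigr => i _; rewrite ffunE.
by apply/ffunP => i; rewrite !ffunE.
Qed.

(** * Tensor-product interpolation *)

Section tensor_interpolation.
Context {R : realType} {d r : nat}.
Hypothesis r_gt0 : (0 < r)%N.
Implicit Types (x y : 'rV[R]_d) (f : 'rV[R]_d -> R) (j : {ffun 'I_d -> 'I_r}).

(** Polynomial approximation is only required along the coordinate lines:
    tensor-product interpolation proceeds one coordinate at a time and
    needs no mixed derivatives. *)
Definition coord_approx f := forall x i h, 0 < h ->
  exists2 p : {poly R}, (size p <= r)%N &
    forall t, `|t| <= h -> `|f (x + t *: delta_mx ord0 i) - p.[t]| <= h ^+ r.

Definition node (h : R) y j : 'rV[R]_d :=
  \row_i (y ord0 i + h * (j i)%:R).

Definition Lag (h : R) y f x : R :=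
  \sum_(j : {ffun 'I_d -> 'I_r})
    (\prod_i (lag (j i)).[(x ord0 i - y ord0 i) / h]) * f (node h y j).

Lemma sum_prod_lag (u : 'I_d -> R) :
  \sum_(j : {ffun 'I_d -> 'I_r}) \prod_i (lag (j i)).[u i] = 1.
Proof.
rewrite -(bigA_distr_bigA (fun i k => (lag k).[u i])) big1// => i _.
exact: lag_sum1.
Qed.

Lemma sum_prod_lag_bounded (rho B : R) (u : 'I_d -> R) :
  (forall u, `|u| <= rho -> \sum_(k < r) `|(lag k).[u]| <= B) ->
  (forall i, `|u i| <= rho) ->
  \sum_(j : {ffun 'I_d -> 'I_r}) `|\prod_i (lag (j i)).[u i]| <= B ^+ d.
Proof.
move=> lB hu; under eq_bigr do rewrite normr_prod.
rewrite -(bigA_distr_bigA (fun i k => `|(lag k).[u i]|)).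
rewrite -[X in _ ^+ X](card_ord d) -prodr_const; apply: ler_prod => i _.
by rewrite lB// andbT sumr_ge0.
Qed.

(** The coordinates are interpolated one at a time, so each step costs the
    error of a one-dimensional interpolation times the Lebesgue constants of
    the other coordinates. *)
Lemma Lag_error (rho : R) : r%:R <= rho -> exists2 C, 0 <= C &
  forall f h x y, coord_approx f -> 0 < h ->
    (forall i, `|x ord0 i - y ord0 i| <= rho * h) ->
    `|f x - Lag h y f x| <= C * h ^+ r.
Proof.
move=> rrho; have [B B1 lB] := lag_bounded r rho.
have rho0 : 0 < rho by apply: lt_le_trans rrho; rewrite ltr0n.
have B0 : 0 <= B by apply: le_trans B1.
exists (d%:R * (B ^+ d * ((1 + B) * rho ^+ r))).
  by do ?[apply: mulr_ge0|apply: addr_ge0|apply: exprn_ge0] => //; exact: ltW.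
move=> f h x y fr h0 xy.
pose u i := (x ord0 i - y ord0 i) / h.
have hu i : `|u i| <= rho.
  by rewrite /u normrM normfV (gtr0_norm h0) ler_pdivrMr.
pose hyb n j : 'rV[R]_d :=
  \row_i (if (i < n)%N then node h y j ord0 i else x ord0 i).
pose Q j := \prod_i (lag (j i)).[u i].
have -> : f x - Lag h y f x =
    \sum_(n < d) \sum_j Q j * (f (hyb n j) - f (hyb n.+1 j)).
  rewrite exchange_big/=.
  transitivity (\sum_j Q j * (f x - f (node h y j))).
    under eq_bigr do rewrite mulrBr.
    by rewrite sumrB -mulr_suml sum_prod_lag mul1r.
  apply: eq_bigr => j _; rewrite -mulr_sumr; congr (_ * _).
  rewrite -(big_mkord xpredT (fun n => f (hyb n j) - f (hyb n.+1 j))).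
  rewrite (telescope_sumr_eq (fun n => - f (hyb n j)))//; last first.
    by move=> k _; rewrite opprK addrC.
  rewrite opprK [RHS]addrC; congr (f _ - f _); apply/rowP => i; rewrite !mxE//.
  by rewrite ltn_ord.
rewrite -!mulrA mulr_natl -[X in _ *+ X]card_ord -sumr_const.
apply: (le_trans (ler_norm_sum _ _ _)); apply: ler_sum => m _.
rewrite (@sum_prod_upd _ _ _ (fun i k => (lag k).[u i]) m) ?lag_sum1//.
apply: (le_trans (ler_norm_sum _ _ _)).
apply: (@le_trans _ _ (\sum_j `|Q j| * ((1 + B) * (rho * h) ^+ r))).
  apply: ler_sum => j _; rewrite normrM ler_wpM2l//.
  pose x0 := hyb m j + (y ord0 m - x ord0 m) *: delta_mx ord0 m.
  have hybx0 : hyb m j = x0 + (x ord0 m - y ord0 m) *: delta_mx ord0 m.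
    by rewrite /x0 -addrA -scalerDl [X in X *: _](_ : _ = 0) ?scale0r ?addr0//; ring.
  have hyb1 k : hyb m (upd j m k) = hyb m j.
    apply/rowP => i; rewrite !mxE; case: ifPn => // im.
    by rewrite upd_other//; apply: contraTneq im => ->; rewrite ltnn.
  have hyb2 k : hyb m.+1 (upd j m k) =
      x0 + (h * k%:R) *: delta_mx ord0 m.
    apply/rowP => i; rewrite !mxE !eqxx ltnS leq_eqVlt val_eqE.
    case: (eqVneq i m) => [->|im]/=.
      by rewrite upd_same ltnn mulr1 addrCA subrr addr0 mulr1 .
    by rewrite upd_other// !mulr0 !addr0.
  have [p sp hp] := fr x0 m _ (mulr_gt0 rho0 h0).
  have := lag_error r_gt0 h0 rrho sp hp lB (xy m).
  rewrite -hybx0; congr (`|_| <= _).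
  under [RHS]eq_bigr do rewrite hyb1 hyb2 mulrBr.
  by rewrite sumrB -mulr_suml lag_sum1// mul1r.
rewrite -mulr_suml exprMn ler_wpM2r//.
  by do ?[apply: mulr_ge0|apply: addr_ge0|apply: exprn_ge0] => //; exact: ltW.
exact: sum_prod_lag_bounded lB hu.
Qed.

(** The interpolant has degree less than [r] in each coordinate, so it is its
    own interpolant on any other grid. This is what expresses the
    difference of two scales through test functions of the finer one. *)
Lemma Lag_reproduces (h h' : R) y y' f x : h != 0 -> h' != 0 ->
  Lag h' y' (Lag h y f) x = Lag h y f x.
Proof.
move=> h0 h'0; rewrite /Lag.
under eq_bigr do rewrite mulr_sumr.
rewrite exchange_big/=; apply: eq_bigr => j _.
under eq_bigr do rewrite mulrA -big_split/=.
rewrite -mulr_suml; congr (_ * _).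
transitivity (\sum_(j' : {ffun 'I_d -> 'I_r}) \prod_i
  ((lag (j' i)).[(x ord0 i - y' ord0 i) / h'] *
   (lag (j i)).[(y' ord0 i + h' * (j' i)%:R - y ord0 i) / h])).
  by apply: eq_bigr => j' _; apply: eq_bigr => i _; rewrite mxE.
rewrite -(bigA_distr_bigA (fun i (k : 'I_r) =>
  (lag k).[(x ord0 i - y' ord0 i) / h'] *
   (lag (j i)).[(y' ord0 i + h' * k%:R - y ord0 i) / h])).
apply: eq_bigr => i _.
pose p : {poly R} := lag (j i) \Po (h^-1%:P * 'X + (- (y ord0 i / h))%:P).
have pE z : p.[z] = (lag (j i)).[(z - y ord0 i) / h].
  by rewrite /p horner_comp !hornerE; congr (_.[_]); field.
rewrite -pE -(@lag_affine _ r p (y' ord0 i) h')//.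
  by apply: eq_bigr => k _; rewrite pE mulrC.
rewrite size_comp_poly2; last first.
  by rewrite size_MXaddC polyC_eq0 invr_eq0 (negPf h0)/= size_polyC invr_eq0 h0.
rewrite /lag size_lagrange_//.
by move=> a b /eqP; rewrite eqr_nat => /eqP.
Qed.

End tensor_interpolation.

Arguments coord_approx {R d} r f.
Arguments Lag {R d} r h y f x.

(** * Hat functions on dyadic trees *)

Section euclidean_norm.
Context {R : realType} {d : nat}.
Implicit Types (x y : 'rV[R]_d) (f : 'rV[R]_d -> R).

Lemma enorm_ge0 x : 0 <= enorm x.
Proof. exact: sqrtr_ge0. Qed.

Lemma coord_le_enorm x i : `|x ord0 i| <= enorm x.
Proof.
rewrite -sqrtr_sqr ler_wsqrtr// (bigD1 i)//= lerDl.
by apply: sumr_ge0 => k _; exact: sqr_ge0.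
Qed.

Lemma sum_coord_le_enorm x : \sum_i `|x ord0 i| <= d%:R * enorm x.
Proof.
rewrite mulr_natl -[X in _ *+ X]card_ord -sumr_const.
by apply: ler_sum => i _; exact: coord_le_enorm.
Qed.

Lemma enorm_le_sum x : enorm x <= \sum_i `|x ord0 i|.
Proof.
have s0 : 0 <= \sum_i `|x ord0 i| by exact: sumr_ge0.
rewrite -[leRHS]ger0_norm// -sqrtr_sqr ler_wsqrtr//.
rewrite expr2 mulr_suml; apply: ler_sum => i _.
rewrite -(real_normK (num_real _)) expr2 ler_wpM2l// (bigD1 i)//= lerDl.
exact: sumr_ge0.
Qed.

Definition coord_lip f :=
  forall x i t, `|f (x + t *: delta_mx ord0 i) - f x| <= `|t|.

Lemma coord_lip_sum f x y : coord_lip f ->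
  `|f x - f y| <= \sum_i `|x ord0 i - y ord0 i|.
Proof.
move=> fl; pose z n : 'rV[R]_d :=
  \row_i (if (i < n)%N then x ord0 i else y ord0 i).
have -> : f x - f y = \sum_(n < d) (f (z n.+1) - f (z n)).
  rewrite -(big_mkord xpredT (fun n => f (z n.+1) - f (z n))).
  rewrite telescope_sumr//; congr (f _ - f _); apply/rowP => i; rewrite !mxE//.
  by rewrite ltn_ord.
apply: (le_trans (ler_norm_sum _ _ _)); apply: ler_sum => m _.
have -> : z m.+1 = z m + (x ord0 m - y ord0 m) *: delta_mx ord0 m.
  apply/rowP => i; rewrite !mxE eqxx ltnS leq_eqVlt val_eqE.
  case: (eqVneq i m) => [->|im]/=; last by rewrite mulr0 addr0.
  by rewrite ltnn mulr1 addrC subrK.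
exact: fl.
Qed.

Lemma coord_lip_enorm f x y : coord_lip f ->
  `|f x - f y| <= d%:R * enorm (x - y).
Proof.
move=> fl; apply: le_trans (coord_lip_sum _ _ fl) _.
apply: le_trans (sum_coord_le_enorm _).
by apply: ler_sum => i _; rewrite !mxE.
Qed.

End euclidean_norm.

Section hat_tree.
Context {R : realType}.

Definition hat (u : R) : R := Num.max 0 (1 - `|u|).

Definition child_wt (e : 'I_3) : R := if e == 1%N :> nat then 1 else 2^-1.

(** The nodes of [tree l] index hats with multiplicity: neighbouring parents
    share children, so distinct nodes may have the same position, and the
    weights [wt] account for this. Keeping the nodes apart gives every
    node a unique parent. *)
Fixpoint tree (l : nat) : finType :=
  if l is l'.+1 then (tree l' * 'I_3)%type else 'I_3.

Fixpoint pos (l : nat) : tree l -> int :=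
  match l with
  | 0%N => fun t => (t : 'I_3)%:Z - 1
  | l'.+1 => fun t => 2 * pos t.1 + (t.2%:Z - 1)
  end.

Fixpoint wt (l : nat) : tree l -> R :=
  match l with
  | 0%N => fun=> 1
  | l'.+1 => fun t => wt t.1 * child_wt t.2
  end.

Lemma hat_ge0 u : 0 <= hat u.
Proof. by rewrite /hat le_max lexx. Qed.

Lemma hat_le1 u : hat u <= 1.
Proof. by rewrite /hat ge_max ler01 gerBl normr_ge0. Qed.

Lemma hat_eq0 u : 1 <= `|u| -> hat u = 0.
Proof. by move=> u1; rewrite /hat max_l// subr_le0. Qed.

Lemma hat_lip u v : `|hat u - hat v| <= `|u - v|.
Proof.
rewrite /hat; have := lerB_dist u v; have := lerB_dist v u.
rewrite distrC; case: (leP 0 (1 - `|u|)); case: (leP 0 (1 - `|v|));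
  have := normr_ge0 (u - v); rewrite ler_norml => *; lra.
Qed.

Lemma hat_right u : 0 <= u -> u <= 1 -> hat u = 1 - u.
Proof. by move=> u0 u1; rewrite /hat ger0_norm// max_r// subr_ge0. Qed.

Lemma hat_left u : -1 <= u -> u <= 0 -> hat u = 1 + u.
Proof. by move=> u1 u0; rewrite /hat ler0_norm// opprK max_r//; lra. Qed.

Lemma hat_ge1 u : 1 <= u -> hat u = 0.
Proof. by move=> u1; rewrite hat_eq0// (le_trans u1)// ler_norm. Qed.

Lemma hat_leN1 u : u <= -1 -> hat u = 0.
Proof. by move=> u1; rewrite hat_eq0// ler_normr; apply/orP; right; lra. Qed.

(** Evaluates the hats on an interval where each of them is affine. *)
Ltac hat_pieces := repeat first [rewrite hat_right; [|lra|lra]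
  | rewrite hat_left; [|lra|lra] | rewrite hat_ge1; [|lra] | rewrite hat_leN1; [|lra]].

Lemma hat_two_scale u :
  \sum_(e < 3) child_wt e * hat (2 * u - (e%:Z - 1)%:~R) = hat u.
Proof.
rewrite !big_ord_recl big_ord0 /child_wt/= /bump/= !rmorphB/=.
have -> : (1%N%:Z)%:~R = 1 :> R by [].
have -> : (0%N%:Z)%:~R = 0 :> R by [].
have -> : ((1 + 1)%N%:Z)%:~R = 2 :> R by [].
case: (leP u (-1)) => [u1|/ltW u1]; first by hat_pieces; lra.
case: (leP u (- 2^-1)) => [u2|/ltW u2]; first by hat_pieces; lra.
case: (leP u 0) => [u3|/ltW u3]; first by hat_pieces; lra.
case: (leP u 2^-1) => [u4|/ltW u4]; first by hat_pieces; lra.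
by case: (leP u 1) => [u5|/ltW u5]; hat_pieces; lra.
Qed.

Lemma wt_ge0 l (t : tree l) : 0 <= wt t.
Proof.
elim: l t => [//|l IH] t /=; rewrite mulr_ge0// /child_wt.
by case: ifP => _; rewrite ?invr_ge0.
Qed.

Lemma sum_wt l : \sum_(t : tree l) wt t = 3 * 2 ^+ l.
Proof.
elim: l => [|l IH]/=.
  by rewrite sumr_const card_ord expr0 mulr1.
rewrite -(pair_bigA _ (fun t e => wt t * child_wt e))/=.
under eq_bigr do rewrite -mulr_sumr.
rewrite -mulr_suml IH !big_ord_recl big_ord0 /child_wt/= exprS.
by field.
Qed.

Definition plateau u : R := \sum_(t : tree 0) hat (u - (pos t)%:~R).

(** Refining the grid does not change the sum of the weighted hats, because the
    hat function is the weighted sum of its three dilated children. *)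
Lemma sum_hat_tree l u :
  \sum_(t : tree l) wt t * hat (2 ^+ l * u - (pos t)%:~R) = plateau u.
Proof.
elim: l => [|l IH] /=.
  by apply: eq_bigr => t _; rewrite !mul1r.
rewrite -IH -(pair_bigA _ (fun t e => wt t * child_wt e *
   hat (2 ^+ l.+1 * u - (2 * pos t + (e%:Z - 1))%:~R)))/=.
apply: eq_bigr => t _; rewrite -[in RHS]hat_two_scale mulr_sumr.
apply: eq_bigr => e _; rewrite -mulrA; congr (_ * (_ * hat _)).
by rewrite exprS rmorphD rmorphM/=; ring.
Qed.

Lemma plateau_ge0 u : 0 <= plateau u.
Proof. by apply: sumr_ge0 => t _; exact: hat_ge0. Qed.

Lemma plateauE u : plateau u = hat (u + 1) + hat u + hat (u - 1).
Proof.
rewrite /plateau !big_ord_recl big_ord0 /= /bump/= addr0 !rmorphB/=.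
have -> : (1%N%:Z)%:~R = 1 :> R by [].
have -> : (0%N%:Z)%:~R = 0 :> R by [].
have -> : ((1 + 1)%N%:Z)%:~R = 2 :> R by [].
rewrite addrA sub0r opprK subrr subr0; congr (_ + _ + hat _); ring.
Qed.

Lemma plateau_le1 u : plateau u <= 1.
Proof.
rewrite plateauE.
case: (leP u (-1)) => [u1|/ltW u1].
  by case: (leP u (- 2)) => [u2|/ltW u2]; hat_pieces; lra.
case: (leP u 0) => [u3|/ltW u3]; first by hat_pieces; lra.
case: (leP u 1) => [u4|/ltW u4]; first by hat_pieces; lra.
by case: (leP u 2) => [u5|/ltW u5]; hat_pieces; lra.
Qed.

Lemma plateau_eq1 u : `|u| <= 1 -> plateau u = 1.
Proof.
rewrite plateauE ler_norml => /andP[? ?].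
by case: (leP u 0) => [u0|/ltW u0]; hat_pieces; lra.
Qed.

(** The grid of level [l] stays within the support of [plateau], an interval
    of radius 2, dilated by [2 ^+ l]. *)
Lemma abs_pos_lt l (t : tree l) : (`|pos t| < 2 ^ l.+1)%N.
Proof.
elim: l t => [|l IH] t /=; first by case: t => [[|[|[|]]]].
have := IH t.1; have := ltn_ord t.2; rewrite (expnS 2 l.+1).
by move: (pos t.1) (nat_of_ord t.2) (2 ^ l.+1)%N => p b a; lia.
Qed.

(** Evaluating the sum of the hats at an integer shows that every grid point
    carries total weight at most one. *)
Lemma sum_wt_pos_le1 l (m : int) : \sum_(t : tree l | pos t == m) wt t <= 1.
Proof.
apply: le_trans (plateau_le1 (m%:~R / 2 ^+ l)).
rewrite -(sum_hat_tree l) big_mkcond/=; apply: ler_sum => t _.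
case: eqP => [->|_]; last by rewrite mulr_ge0 ?wt_ge0 ?hat_ge0.
rewrite [2 ^+ l * _]mulrC divfK ?expf_neq0// subrr /hat normr0 subr0 max_r ?mulr1//.
Qed.

Lemma sum_wt_abs_pos l (F : nat -> R) : (forall k, 0 <= F k) ->
  \sum_(t : tree l) wt t * F `|pos t|%N <= 2 * \sum_(k < 2 ^ l.+1) F k.
Proof.
move=> F0.
rewrite (partition_big (fun t => Ordinal (abs_pos_lt t)) xpredT)//=.
rewrite mulr_sumr; apply: ler_sum => k _.
rewrite (eq_bigr (fun t => wt t * F k)); last by move=> t /eqP <-.
rewrite -mulr_suml ler_wpM2r//.
apply: (@le_trans _ _ (\sum_(t : tree l | pos t == k%:Z) wt t +
                      \sum_(t : tree l | pos t == - k%:Z) wt t)); last first.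
  by rewrite (_ : 2 = 1 + 1)// lerD ?sum_wt_pos_le1.
rewrite big_mkcond [X in _ <= X + _]big_mkcond [X in _ <= _ + X]big_mkcond.
rewrite -big_split; apply: ler_sum => t _ /=.
have w0 := wt_ge0 t; rewrite -val_eqE/=; case: eqP => [tk|_]; last first.
  by rewrite addr_ge0//; case: ifP.
case: (eqVneq (pos t) k%:Z) => [_|p1]; first by rewrite lerDl; case: ifP.
by rewrite ifT ?add0r//; apply/eqP; move/eqP : p1; lia.
Qed.

End hat_tree.

(** * Multiscale decomposition of a function *)

Section multiscale.
Context {R : realType} {d r : nat}.
Hypothesis r_gt0 : (0 < r)%N.
Variable rad : R.
Hypothesis rad1 : 1 <= rad.
Implicit Types (x y : 'rV[R]_d) (F : 'rV[R]_d -> R) (j : {ffun 'I_d -> 'I_r}).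

Definition mesh (l : nat) : R := rad / 2 ^+ l.

Definition local_coord l (s : {ffun 'I_d -> tree l}) x i : R :=
  2 ^+ l * (x ord0 i / rad) - (pos (s i))%:~R.

Definition corner l (s : {ffun 'I_d -> tree l}) : 'rV[R]_d :=
  \row_i (mesh l * (pos (s i))%:~R).

Definition prod_wt l (s : {ffun 'I_d -> tree l}) : R := \prod_i wt (s i).

Definition node_fun (k : 'I_r) (u : R) : R := hat u * (lag k).[u].

Definition testf l (s : {ffun 'I_d -> tree l}) j x : R :=
  \prod_i node_fun (j i) (local_coord s x i).

Definition parent l (s : {ffun 'I_d -> tree l.+1}) : {ffun 'I_d -> tree l} :=
  [ffun i => (s i).1].

(** The coefficients beyond the coarsest level are hierarchical surpluses: the
    error, at a node, of the interpolant attached to the parent cell. *)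
Definition coef F (l : nat) : {ffun 'I_d -> tree l} -> {ffun 'I_d -> 'I_r} -> R :=
  match l with
  | 0%N => fun s j => F (node (mesh 0) (corner s) j)
  | l'.+1 => fun s j => let y := node (mesh l'.+1) (corner s) j in
      F y - Lag r (mesh l') (corner (parent s)) F y
  end.

Definition level F l x : R :=
  \sum_(s : {ffun 'I_d -> tree l})
    (\prod_i (wt (s i) * hat (local_coord s x i))) *
    Lag r (mesh l) (corner s) F x.

Let rad_gt0 : 0 < rad. Proof. exact: lt_le_trans rad1. Qed.

Lemma mesh_gt0 l : 0 < mesh l.
Proof. by rewrite divr_gt0// exprn_gt0. Qed.

Lemma meshS l : mesh l.+1 = mesh l / 2.
Proof. by rewrite /mesh exprSr invfM mulrA. Qed.

Lemma local_coordE l (s : {ffun 'I_d -> tree l}) x i :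
  (x ord0 i - corner s ord0 i) / mesh l = local_coord s x i.
Proof.
rewrite mxE /local_coord /mesh; field.
by rewrite expf_neq0// (lt0r_neq0 rad_gt0).
Qed.

Lemma sum_tests l (A : {ffun 'I_d -> tree l} -> 'rV[R]_d -> R) x :
  \sum_(s : {ffun 'I_d -> tree l})
    (\prod_i (wt (s i) * hat (local_coord s x i))) *
    Lag r (mesh l) (corner s) (A s) x =
  \sum_(s : {ffun 'I_d -> tree l}) prod_wt s *
    \sum_(j : {ffun 'I_d -> 'I_r})
      A s (node (mesh l) (corner s) j) * testf s j x.
Proof.
apply: eq_bigr => s _; rewrite big_split/= -mulrA; congr (_ * _).
rewrite /Lag mulr_sumr; apply: eq_bigr => j _.
rewrite mulrA mulrC; congr (_ * _); rewrite -big_split/=.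
by apply: eq_bigr => i _; rewrite local_coordE.
Qed.

(** The two-scale relation of the hat, applied in every coordinate, hands each
    local interpolant down to the child cells. *)
Lemma level_refine F l x : level F l x =
  \sum_(s : {ffun 'I_d -> tree l.+1})
    (\prod_i (wt (s i) * hat (local_coord s x i))) *
    Lag r (mesh l) (corner (parent s)) F x.
Proof.
pose q (i : 'I_d) (t : tree l.+1) : R :=
  wt t * hat (2 ^+ l.+1 * (x ord0 i / rad) - (pos t)%:~R).
rewrite [RHS](sum_prod_fst q (fun s => Lag r (mesh l) (corner s) F x)).
apply: eq_bigr => s _; congr (_ * _); apply: eq_bigr => i _.
rewrite -hat_two_scale mulr_sumr; apply: eq_bigr => e _.
rewrite /q /= -mulrA; congr (_ * (_ * hat _)).
by rewrite /local_coord exprS [in RHS]rmorphD [in RHS]rmorphM/=; ring.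
Qed.

(** After refinement, two consecutive levels use the same hats, and since
    interpolation reproduces the coarser interpolant, they differ by the
    interpolant of its error. *)
Lemma level_expand F l x : level F l x =
  \sum_(k < l.+1) \sum_(s : {ffun 'I_d -> tree k}) prod_wt s *
    \sum_(j : {ffun 'I_d -> 'I_r}) coef F s j * testf s j x.
Proof.
elim: l => [|l IH].
  by rewrite big_ord1 /level (sum_tests (fun=> F)).
rewrite big_ord_recr/= -IH -(sum_tests
  (fun s y => F y - Lag r (mesh l) (corner (parent s)) F y)).
rewrite [level F l x]level_refine -big_split/=; apply: eq_bigr => s _.
rewrite -mulrDr; congr (_ * _).
pose G y := Lag r (mesh l) (corner (parent s)) F y.
have -> : Lag r (mesh l) (corner (parent s)) F x =
    Lag r (mesh l.+1) (corner s) G x.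
  by rewrite /G Lag_reproduces// lt0r_neq0// mesh_gt0.
rewrite /Lag -big_split/=; apply: eq_bigr => j _.
by rewrite -mulrDr /G addrC subrK.
Qed.

Definition cutoff x : R := \prod_i plateau (x ord0 i / rad).

Lemma sum_hats l x :
  \sum_(s : {ffun 'I_d -> tree l})
    (\prod_i (wt (s i) * hat (local_coord s x i))) = cutoff x.
Proof.
rewrite -(bigA_distr_bigA (fun i (t : tree l) =>
  wt t * hat (2 ^+ l * (x ord0 i / rad) - (pos t)%:~R))).
by apply: eq_bigr => i _; rewrite sum_hat_tree.
Qed.

Lemma prod_hat_ge0 l (s : {ffun 'I_d -> tree l}) x :
  0 <= \prod_i (wt (s i) * hat (local_coord s x i)).
Proof. by apply: prodr_ge0 => i _; rewrite mulr_ge0 ?wt_ge0 ?hat_ge0. Qed.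

Lemma cutoff_ge0 x : 0 <= cutoff x.
Proof. by apply: prodr_ge0 => i _; exact: plateau_ge0. Qed.

Lemma cutoff_le1 x : cutoff x <= 1.
Proof. by apply: prodr_ile1 => i _; rewrite plateau_ge0 plateau_le1. Qed.

Lemma cutoff_eq1 x : (forall i, `|x ord0 i| <= rad) -> cutoff x = 1.
Proof.
move=> xr; rewrite /cutoff big1// => i _; rewrite plateau_eq1//.
by rewrite normrM normfV (gtr0_norm rad_gt0) ler_pdivrMr// mul1r.
Qed.

(** Where the cutoff differs from one, the norm exceeds [rad] and hence is at
    most twice its excess over [rad / 2]. *)
Lemma cutoff_tail F x : coord_lip F -> F 0 = 0 ->
  `|F x - cutoff x * F x| <= 2 * d%:R * Num.max 0 (enorm x - rad / 2).
Proof.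
move=> Fl F0.
have [xr|] := pselect (forall i, `|x ord0 i| <= rad).
  rewrite cutoff_eq1// mul1r subrr normr0 mulr_ge0//.
  by rewrite le_max lexx.
move=> /existsNP[i /negP]; rewrite -ltNge => xi.
have xr : rad < enorm x by apply: (lt_le_trans xi); exact: coord_le_enorm.
have -> : F x - cutoff x * F x = (1 - cutoff x) * F x by ring.
rewrite normrM (@le_trans _ _ (d%:R * enorm x))//.
  rewrite -[leRHS]mul1r ler_pM//.
    by rewrite ler_norml; have := cutoff_ge0 x; have := cutoff_le1 x; lra.
  by have := coord_lip_enorm x 0 Fl; rewrite F0 !subr0.
rewrite [2 * _]mulrC -mulrA ler_wpM2l// mulrC -ler_pdivrMr//.
by rewrite le_max; apply/orP; right; lra.
Qed.

End multiscale.

Section multiscale_error.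
Context {R : realType} {d r : nat}.
Hypothesis r_gt0 : (0 < r)%N.

(** Consecutive levels differ by the local interpolation errors, whence the
    size of the coefficients; the coarsest ones are only bounded by the
    Lipschitz condition, which suffices as the radius is at least one. *)
Lemma multiscale_decomposition : exists2 C : R, 0 <= C &
  forall (F : 'rV[R]_d -> R) rad, coord_approx r F -> coord_lip F ->
    F 0 = 0 -> 1 <= rad ->
  (forall l (s : {ffun 'I_d -> tree l}) (j : {ffun 'I_d -> 'I_r}),
     `|coef rad F s j| <= C * mesh rad l ^+ r) /\
  forall L x,
    `|F x - \sum_(l < L.+1) \sum_(s : {ffun 'I_d -> tree l}) prod_wt s *
        \sum_(j : {ffun 'I_d -> 'I_r}) coef rad F s j * testf rad s j x| <=
    C * (mesh rad L ^+ r + Num.max 0 (enorm x - rad / 2)).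
Proof.
have r0 : 0 <= r%:R :> R by [].
have [C C0 hC] := @Lag_error R d r r_gt0 (r%:R + 1) (ler_wpDr ler01 (lexx _)).
exists (2 ^+ r * C + C + d%:R * (r%:R + 1) + 2 * d%:R).
  by rewrite !addr_ge0// !mulr_ge0 ?exprn_ge0 ?addr_ge0.
move=> F rad Fr Fl F0 rad1.
have rad0 : 0 < rad by apply: lt_le_trans rad1.
have m0 l : 0 < mesh rad l by exact: mesh_gt0.
have mr l : 0 <= mesh rad l ^+ r by rewrite exprn_ge0 ?ltW.
have eC : 0 <= 2 ^+ r * C by rewrite mulr_ge0 ?exprn_ge0.
have ed : 0 <= d%:R * (r%:R + 1) :> R by rewrite mulr_ge0 ?addr_ge0.
have ed2 : 0 <= 2 * d%:R :> R by rewrite mulr_ge0.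
split => [[|l] s j|L x].
- apply: (@le_trans _ _ (d%:R * (r%:R + 1) * mesh rad 0 ^+ r)); last first.
    by rewrite ler_wpM2r//; lra.
  rewrite /coef -[F _]subr0 -F0; apply: le_trans (coord_lip_sum _ _ Fl) _.
  apply: (@le_trans _ _ (d%:R * ((r%:R + 1) * rad))); last first.
    rewrite -mulrA ler_wpM2l// ler_wpM2l ?addr_ge0// /mesh expr0 divr1.
    by case: r r_gt0 => // r' _; rewrite exprS ler_peMr// ?exprn_ege1// ltW.
  rewrite mulr_natl -[X in _ *+ X]card_ord -sumr_const.
  apply: ler_sum => i _; rewrite !mxE subr0 /mesh expr0 divr1 -mulrDr normrM.
  rewrite (gtr0_norm rad0) mulrC ler_pM2r//.
  rewrite addrC (le_trans (ler_normD _ _))// lerD//.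
    by rewrite normr_nat ler_nat ltnW.
  rewrite -intr_norm -[1]/(1%:~R) ler_int; have := abs_pos_lt (s i).
  by rewrite /= -lez_nat; lia.
- apply: (@le_trans _ _ (2 ^+ r * C * mesh rad l.+1 ^+ r)); last first.
    by rewrite ler_wpM2r//; lra.
  have -> : 2 ^+ r * C * mesh rad l.+1 ^+ r = C * mesh rad l ^+ r.
    by rewrite meshS exprMn exprVn; field; rewrite expf_neq0.
  apply: hC => // i; rewrite !mxE ffunE meshS /=.
  set e := ((s i).2 : 'I_3); set p := pos (s i).1; set k := j i.
  have -> : mesh rad l / 2 * (2 * p + (e%:Z - 1))%:~R +
      mesh rad l / 2 * k%:R - mesh rad l * p%:~R =
      mesh rad l * (((e%:Z - 1)%:~R + k%:R) / 2).
    by rewrite [X in _ * X + _]rmorphD rmorphM/=; field.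
  rewrite normrM (gtr0_norm (m0 l)) mulrC ler_pM2r//.
  rewrite normrM normfV normr_nat ler_pdivrMr// (le_trans (ler_normD _ _))//.
  have -> : `|k%:R| = k%:R :> R by rewrite normr_nat.
  have kr : k%:R <= r%:R :> R by rewrite ler_nat ltnW.
  have e1 : `|(e%:Z - 1)%:~R| <= 1 :> R.
    by rewrite -intr_norm -[1]/(1%:~R) ler_int; case: e => [[|[|[|]]]].
  lra.
- rewrite -level_expand//.
  rewrite -[F x](subrK (cutoff rad x * F x)) -addrA.
  apply: le_trans (ler_normD _ _) _.
  have t0 : 0 <= Num.max 0 (enorm x - rad / 2) by rewrite le_max lexx.
  apply: (@le_trans _ _ (2 * d%:R * Num.max 0 (enorm x - rad / 2) +
      C * mesh rad L ^+ r)); last first.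
    by rewrite mulrDr addrC lerD// ler_wpM2r//; lra.
  rewrite lerD//; first exact: cutoff_tail.
  rewrite -(sum_hats rad L) mulr_suml /level -sumrB.
  apply: le_trans (ler_norm_sum _ _ _) _.
  apply: (@le_trans _ _ (\sum_(s : {ffun 'I_d -> tree L})
    (\prod_i (wt (s i) * hat (local_coord rad s x i))) *
      (C * mesh rad L ^+ r))); last first.
    by rewrite -mulr_suml sum_hats ler_piMl ?cutoff_le1// mulr_ge0.
  apply: ler_sum => s _; rewrite -mulrBr normrM ger0_norm ?prod_hat_ge0//.
  have [xs|] := pselect (forall i, `|local_coord rad s x i| <= 1).
    rewrite ler_wpM2l ?prod_hat_ge0// hC// => i.
    have := xs i; rewrite -local_coordE// normrM normfV (gtr0_norm (m0 L)).
    by rewrite ler_pdivrMr// mul1r => /le_trans; apply; rewrite ler_peMl ?lerDr// ltW.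
  move=> /existsNP[i /negP]; rewrite -ltNge => /ltW xi.
  by rewrite (bigD1 i)//= hat_eq0// mulr0 !mul0r.
Qed.

End multiscale_error.

(** * Bounds on the test functions, spatial weights *)

Section local_functions.
Context {R : realType}.

Lemma horner_lip (p : {poly R}) : exists2 K, 0 <= K &
  forall u v, `|u| <= 1 -> `|v| <= 1 -> `|p.[u] - p.[v]| <= K * `|u - v|.
Proof.
exists (\sum_(i < size p) `|p`_i| * i%:R).
  by apply: sumr_ge0 => i _; rewrite mulr_ge0.
move=> u v u1 v1; rewrite !horner_coef -sumrB mulr_suml.
apply: (le_trans (ler_norm_sum _ _ _)); apply: ler_sum => i _.
rewrite -mulrBr subrXX normrM -mulrA ler_wpM2l// normrM mulrC ler_wpM2r//.
rewrite -[X in _ <= X%:R]card_ord -sumr_const.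
apply: (le_trans (ler_norm_sum _ _ _)); apply: ler_sum => k _.
by rewrite normrM !normrX mulr_ile1 ?exprn_ge0// exprn_ile1.
Qed.

(** Clipping the argument makes the basis polynomials bounded and Lipschitz
    without changing their products with the hat, which vanishes where the
    clipping acts. *)
Definition clip (u : R) : R := Num.max (-1) (Num.min 1 u).

Lemma clip_norm u : `|clip u| <= 1.
Proof.
rewrite /clip ler_norml; case: (leP 1 u) => u1;
match goal with |- context [Num.max (-1) ?a] => case: (leP (-1) a) => ? end; lra.
Qed.

Lemma clip_id u : `|u| <= 1 -> clip u = u.
Proof.
rewrite /clip ler_norml => /andP[? ?]; case: (leP 1 u) => u1;
match goal with |- context [Num.max (-1) ?a] => case: (leP (-1) a) => ? end; lra.
Qed.

Lemma clip_lip u v : `|clip u - clip v| <= `|u - v|.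
Proof.
rewrite /clip; case: (ler0P (u - v)) => uv; rewrite ler_norml;
case: (leP 1 u) => u1; case: (leP 1 v) => v1;
repeat match goal with |- context [Num.max (-1) ?a] => case: (leP (-1) a) => ? end;
lra.
Qed.

Lemma node_fun_bounds r : exists2 B : R, 1 <= B &
  forall (k : 'I_r) (u : R), `|node_fun k u| <= B * hat u /\
    forall v, `|node_fun k u - node_fun k v| <= B * `|u - v|.
Proof.
have [B1 B11 hB1] := @lag_bounded R r 1.
have /choice[K hK] : forall k : 'I_r, exists K : R, 0 <= K /\
    forall u v, `|u| <= 1 -> `|v| <= 1 ->
      `|(lag k).[u] - (lag k).[v]| <= K * `|u - v|.
  by move=> k; have [K K0 h] := horner_lip (lag k); exists K.
have lagB (k : 'I_r) u : `|u| <= 1 -> `|(lag k).[u]| <= B1.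
  move=> u1; apply: le_trans (hB1 u u1); rewrite (bigD1 k)//= lerDl.
  exact: sumr_ge0.
have K0 : 0 <= \sum_k K k by apply: sumr_ge0 => k _; case: (hK k).
have node_funE (k : 'I_r) (u : R) : node_fun k u = hat u * (lag k).[clip u].
  rewrite /node_fun; have [u1|/ltW u1] := leP `|u| 1; first by rewrite clip_id.
  by rewrite hat_eq0// !mul0r.
exists (B1 + \sum_k K k); first by rewrite -[leLHS]addr0 lerD.
move=> k u; split.
  rewrite node_funE normrM ger0_norm ?hat_ge0// mulrC ler_wpM2r ?hat_ge0//.
  by rewrite (le_trans (lagB _ _ (clip_norm u)))// lerDl.
move=> v; rewrite !node_funE.
have -> : hat u * (lag k).[clip u] - hat v * (lag k).[clip v] =
  (lag k).[clip u] * (hat u - hat v) +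
  hat v * ((lag k).[clip u] - (lag k).[clip v]) by ring.
rewrite mulrDl (le_trans (ler_normD _ _))// lerD// normrM.
  by rewrite ler_pM ?hat_lip ?lagB ?clip_norm.
rewrite ger0_norm ?hat_ge0// -[leRHS]mul1r ler_pM ?hat_ge0 ?hat_le1//.
apply: (le_trans ((hK k).2 _ _ (clip_norm u) (clip_norm v))).
rewrite ler_pM ?clip_lip//; first by case: (hK k).
rewrite (bigD1 k)//= lerDl; apply: sumr_ge0 => i _; by case: (hK i).
Qed.

Lemma prod_lip (I : Type) (s : seq I) (a b : I -> R) B : 1 <= B ->
  (forall i, `|a i| <= B) -> (forall i, `|b i| <= B) ->
  `|\prod_(i <- s) a i - \prod_(i <- s) b i| <=
    B ^+ size s * \sum_(i <- s) `|a i - b i|.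
Proof.
move=> B1 aB bB; have B0 : 0 <= B by apply: le_trans B1.
elim: s => [|i s IH]; first by rewrite !big_nil subrr normr0 mulr0.
rewrite !big_cons; set A := \prod_(i <- s) a i; set A' := \prod_(i <- s) b i.
have A'B : `|A'| <= B ^+ size s.
  rewrite /A' normr_prod; elim: {IH A A'} s => [|k s IH].
    by rewrite big_nil expr0.
  by rewrite big_cons exprS ler_pM// prodr_ge0.
have -> : a i * A - b i * A' = (a i - b i) * A' + a i * (A - A') by ring.
rewrite [leRHS]mulrDr (le_trans (ler_normD _ _))// lerD// normrM /=.
  rewrite mulrC ler_wpM2r// (le_trans A'B)// exprS ler_peMl// exprn_ge0//.
by rewrite exprS -mulrA ler_pM.
Qed.

(** Each factor is bounded and Lipschitz in the local coordinate, which varies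
    at the rate of the inverse mesh. The hats are kept in the first bound,
    since only their sum over the cells is bounded independently of the
    scale. *)
Lemma testf_bounds d r : exists2 B : R, 1 <= B &
  forall rad l (s : {ffun 'I_d -> tree l}) (j : {ffun 'I_d -> 'I_r}) x,
    1 <= rad ->
    `|testf rad s j x| <= B * \prod_i hat (local_coord rad s x i) /\
    forall y, `|testf rad s j x - testf rad s j y| <=
      B / mesh rad l * enorm (x - y).
Proof.
have [B B1 hB] := node_fun_bounds r; have B0 : 0 <= B by apply: le_trans B1.
have Bd : 1 <= B ^+ d by rewrite exprn_ege1.
have Bd0 : 0 <= B ^+ d by rewrite exprn_ge0.
have BB : 1 <= B ^+ d * (B * d%:R + 1).
  by rewrite -[leLHS]mulr1 ler_pM// lerDr mulr_ge0.
exists (B ^+ d * (B * d%:R + 1)) => // rad l s j x rad1; split.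
  rewrite /testf normr_prod.
  apply: (@le_trans _ _ (\prod_(i < d) (B * hat (local_coord rad s x i)))).
    by apply: ler_prod => i _; rewrite normr_ge0; case: (hB (j i) (local_coord rad s x i)).
  rewrite big_split/= prodr_const card_ord ler_wpM2r//.
    by apply: prodr_ge0 => i _; exact: hat_ge0.
  by rewrite ler_peMr// lerDr mulr_ge0.
move=> y.
have bB i z : `|node_fun (j i) (local_coord rad s z i)| <= B.
  have [h _] := hB (j i) (local_coord rad s z i); apply: (le_trans h).
  by rewrite ler_piMr ?hat_le1.
have m0 := mesh_gt0 rad1 l.
apply: (le_trans (prod_lip _ B1 (bB^~ x) (bB^~ y))).
rewrite -(size_map val) /index_enum -enumT val_enum_ord size_iota.
rewrite -!mulrA ler_wpM2l//.
apply: (@le_trans _ _ (\sum_(i < d) B * (`|(x - y) ord0 i| / mesh rad l))).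
  rewrite enumT; apply: ler_sum => i _.
  have [_ h] := hB (j i) (local_coord rad s x i); apply: (le_trans (h _)).
  rewrite ler_wpM2l// -(gtr0_norm m0) -normfV -normrM !mxE.
  rewrite /local_coord /mesh; set p := (pos _)%:~R.
  rewrite (_ : _ - _ = (x ord0 i - y ord0 i) / (rad / 2 ^+ l))//.
  by field; rewrite expf_neq0//= lt0r_neq0// (lt_le_trans _ rad1).
rewrite -mulr_sumr -mulr_suml mulrDl mul1r -[leLHS]addr0 lerD//; last first.
  by rewrite mulr_ge0 ?enorm_ge0 ?invr_ge0 ?ltW.
rewrite -mulrA ler_wpM2l// mulrCA [leLHS]mulrC ler_wpM2l ?invr_ge0 ?(ltW m0)//.
exact: sum_coord_le_enorm.
Qed.

End local_functions.

Section weights.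
Context {R : realType}.

(** The tangent inequality for the convex function [fun x => x `^ (- b)]. *)
Lemma powR_diff_ge (b x y : R) : 0 < b -> 0 < x -> x <= y ->
  b * (y - x) * y `^ (- (1 + b)) <= x `^ (- b) - y `^ (- b).
Proof.
move=> b0 x0 xy; have y0 : 0 < y by apply: lt_le_trans xy.
have yneq : y != 0 by rewrite gt_eqF.
have -> : y `^ (- (1 + b)) = y^-1 * y `^ (- b).
  by rewrite !powRN powRD ?yneq ?implybT// powRr1 ?ltW// invfM.
have h1 : ln x - ln y <= x / y - 1.
  rewrite -lnV ?posrE// -lnM ?posrE ?invr_gt0// -[X in ln X](subrKC 1).
  by rewrite le_ln1Dx// ltrBrDl subrr divr_gt0.
have h2 : x `^ (- b) = y `^ (- b) * expR (b * (ln y - ln x)).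
  by rewrite /powR !gt_eqF// -expRD; congr expR; ring.
have h3 := expR_ge1Dx (b * (ln y - ln x)).
have p0 : 0 <= y `^ (- b) by exact: powR_ge0.
rewrite h2 -[X in _ <= _ - X]mulr1 -mulrBr mulrA [leLHS]mulrC ler_wpM2l//.
rewrite lerBrDl (le_trans _ h3)// lerD2l -mulrA ler_wpM2l ?(ltW b0)// mulrBl.
by rewrite mulfV//; lra.
Qed.

(** Comparison with the integral of [fun x => x `^ (- (1 + b))], telescoping
    its antiderivative; the first two terms, equal to one, are counted
    separately. *)
Lemma sum_powR_le (b h : R) N : 0 < b -> 0 < h ->
  \sum_(k < N) (1 + h * k.-1%:R) `^ (- (1 + b)) <= 2 + (b * h)^-1.
Proof.
move=> b0 h0; have bh0 : 0 <= (b * h)^-1 by rewrite invr_ge0 mulr_ge0 ?ltW.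
case: N => [|N]; first by rewrite big_ord0 addr_ge0.
rewrite big_ord_recl mulr0 addr0 powR1 -lerBrDl.
case: N => [|N]; first by rewrite big_ord0; lra.
rewrite big_ord_recl /= mulr0 addr0 powR1 -lerBrDl.
have -> : 2 + (b * h)^-1 - 1 - 1 = (b * h)^-1 by ring.
rewrite -[leRHS]mul1r ler_pdivlMr ?mulr_gt0// mulrC mulr_sumr.
pose F (k : nat) : R := (1 + h * k%:R) `^ (- b).
apply: (@le_trans _ _ (\sum_(0 <= k < N) (F k - F k.+1))).
  rewrite big_mkord; apply: ler_sum => k _ /=.
  have x0 : 0 < 1 + h * k%:R by rewrite ltr_pwDl// mulr_ge0// ltW.
  apply: le_trans (powR_diff_ge b0 x0 _); last first.
    by rewrite lerD2l ler_wpM2l ?(ltW h0)// ler_nat.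
  rewrite /bump leq0n add0n add1n.
  have -> : 1 + h * k.+1%:R - (1 + h * k%:R) = h by rewrite -natr1; ring.
  by [].
rewrite (telescope_sumr_eq (fun k => - F k))//; last by move=> k _; rewrite opprK addrC.
rewrite opprK /F mulr0 addr0 powR1 addrC lerBlDr lerDl; exact: powR_ge0.
Qed.

(** A hat extends one mesh on either side of its node; the predecessor absorbs
    this, so that the weight of a node is dominated by its value at every
    point of the support of the hat. *)
Definition node_wt (a rad : R) l (t : tree l) : R :=
  (1 + mesh rad l * (`|pos t|%N.-1)%:R) `^ a.

Lemma node_wt_gt0 a rad l (t : tree l) : 1 <= rad -> 0 < node_wt a rad t.
Proof.
move=> rad1; rewrite powR_gt0// ltr_pwDl// mulr_ge0// ltW//.
exact: mesh_gt0 rad1 l.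
Qed.

(** The grid points of one coordinate are spaced by the mesh, so the inverse
    weights are summable with a sum of the order of the inverse mesh. *)
Lemma sum_inv_node_wt (a : R) : 1 < a -> exists2 C : R, 0 <= C &
  forall rad l, 1 <= rad ->
    \sum_(t : tree l) wt t / node_wt a rad t <= C * (1 + 2 ^+ l / rad).
Proof.
move=> a1; exists (4 + 2 / (a - 1)).
  by rewrite addr_ge0// divr_ge0// subr_ge0 ltW.
move=> rad l rad1; have m0 := mesh_gt0 rad1 l.
have b0 : 0 < a - 1 by rewrite subr_gt0.
have rad0 : 0 < rad by apply: lt_le_trans rad1.
pose F (k : nat) : R := (1 + mesh rad l * k.-1%:R) `^ (- a).
have -> : \sum_(t : tree l) wt t / node_wt a rad t =
    \sum_(t : tree l) wt t * F `|pos t|%N.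
  by apply: eq_bigr => t _; rewrite /F powRN.
apply: (le_trans (sum_wt_abs_pos _ _)); first by move=> k; exact: powR_ge0.
have := sum_powR_le (2 ^ l.+1) b0 m0; rewrite -[1 + (a - 1)]addrCA subrr addr0.
move=> /(ler_wpM2l (ler0n _ 2)) /le_trans; apply.
have -> : ((a - 1) * mesh rad l)^-1 = (a - 1)^-1 * (2 ^+ l / rad).
  by rewrite /mesh !invfM invrK; ring.
have i0 : 0 <= (a - 1)^-1 by rewrite invr_ge0 ltW.
have q0 : 0 <= 2 ^+ l / rad by rewrite divr_ge0 ?exprn_ge0 ?ltW.
set u := (a - 1)^-1 in i0 *; set v := 2 ^+ l / rad in q0 *; nra.
Qed.

Lemma node_wt_le d (a rad : R) l (s : {ffun 'I_d -> tree l}) x i :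
  0 <= a -> 1 <= rad -> `|local_coord rad s x i| <= 1 ->
  node_wt a rad (s i) <= (1 + enorm x) `^ a.
Proof.
move=> a0 rad1 xs; have m0 := mesh_gt0 rad1 l.
have rad0 : 0 < rad by apply: lt_le_trans rad1.
have p0 : 0 <= mesh rad l * (`|pos (s i)|%N.-1)%:R.
  exact: mulr_ge0 (ltW m0) (ler0n _ _).
apply: ge0_ler_powR => //; rewrite ?nnegrE ?lerD2l ?addr_ge0 ?enorm_ge0//.
apply: le_trans (coord_le_enorm x i).
have : `|mesh rad l * local_coord rad s x i| <= mesh rad l.
  by rewrite normrM (gtr0_norm m0) ler_piMr// ltW.
have -> : mesh rad l * local_coord rad s x i =
    x ord0 i - mesh rad l * (pos (s i))%:~R.
  rewrite /local_coord /mesh; field.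
  by rewrite expf_neq0//= lt0r_neq0.
move=> h; have h2 : mesh rad l * `|pos (s i)|%N%:R <= `|x ord0 i| + mesh rad l.
  rewrite -[`|pos (s i)|%N%:R]/(`|pos (s i)|%N%:Z%:~R) abszE intr_norm.
  rewrite -(gtr0_norm m0) -normrM (gtr0_norm m0).
  by have := lerB_dist (mesh rad l * (pos (s i))%:~R) (x ord0 i); rewrite distrC; lra.
case: `|pos (s i)|%N h2 => [|k]/=; first by rewrite mulr0.
by rewrite -natr1 mulrDr mulr1; lra.
Qed.

(** Weighting a single coordinate is enough: the others contribute their total
    weight, of order [2 ^+ l] each. *)
Lemma sum_inv_wt d (i0 : 'I_d) (a : R) : 1 < a -> exists2 C : R, 0 <= C &
  forall rad l, 1 <= rad ->
    \sum_(s : {ffun 'I_d -> tree l}) prod_wt s / node_wt a rad (s i0) <=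
    C * (2 ^+ l) ^+ d.-1 * (1 + 2 ^+ l / rad).
Proof.
move=> a1; have [C C0 hC] := sum_inv_node_wt a1.
exists (3 ^+ d.-1 * C); first by rewrite mulr_ge0 ?exprn_ge0.
move=> rad l rad1.
pose q i (t : tree l) : R := wt t * (if i == i0 then (node_wt a rad t)^-1 else 1).
have -> : \sum_(s : {ffun 'I_d -> tree l}) prod_wt s / node_wt a rad (s i0) =
    \sum_(s : {ffun 'I_d -> tree l}) \prod_i q i (s i).
  apply: eq_bigr => s _; rewrite /q big_split/= -/(prod_wt s); congr (_ * _).
  rewrite (bigD1 i0)//= eqxx big1 ?mulr1// => i /negPf -> //.
rewrite -(bigA_distr_bigA q) (bigD1 i0)//=.
have -> : \prod_(i | i != i0) \sum_(t : tree l) q i t = (3 * 2 ^+ l) ^+ d.-1.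
  have <- : #|predC1 i0| = d.-1 by rewrite cardC1 card_ord.
  rewrite -prodr_const.
  apply: eq_big => // i ii0; rewrite -sum_wt; apply: eq_bigr => t _.
  by rewrite /q (negPf ii0) mulr1.
rewrite exprMn mulrC -!mulrA ler_wpM2l ?exprn_ge0// mulrCA ler_wpM2l ?exprn_ge0//.
rewrite (eq_bigr (fun t : tree l => wt t / node_wt a rad t)); first exact: hC.
by move=> t _; rewrite /q eqxx.
Qed.

End weights.

(** * Local polynomial approximation of smooth functions *)

Section derivatives.
Context {R : realType}.

Lemma mean_value_bound (g g' : R -> R) (h M t : R) :
  (forall u : R, `|u| <= h -> is_derive u 1 g (g' u)) ->
  (forall u, `|u| <= h -> `|g' u| <= M) ->
  `|t| <= h -> `|g t - g 0| <= M * `|t|.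
Proof.
move=> dg g'M th.
have key a b : a <= b -> (forall u, a <= u <= b -> `|u| <= h) ->
    `|g b - g a| <= M * `|b - a|.
  move=> ab abh.
  have dab (u : R) : u \in `]a, b[ -> is_derive u 1 g (g' u).
    rewrite in_itv/= => /andP[/ltW au /ltW ub].
    by apply: dg; apply: abh; rewrite au.
  have cab : {within `[a, b], continuous g}.
    apply: derivable_within_continuous => u; rewrite in_itv/= => uab.
    by have [] := dg u (abh u uab).
  have [c ci ->] := MVT_segment ab dab cab.
  by rewrite normrM ler_wpM2r// g'M// abh//; move: ci; rewrite in_itv.
have [t0|/ltW t0] := leP 0 t.
  rewrite -{2}[t]subr0; apply: key => // u /andP[u0 ut].
  by rewrite ger0_norm// (le_trans ut)// -[t]ger0_norm.
rewrite distrC -[`|t|]normrN -[- t]sub0r; apply: key => // u /andP[u0 ut].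
by rewrite ler0_norm// (le_trans _ th)// ler0_norm// lerN2.
Qed.

Definition antideriv (c : R) (p : {poly R}) : {poly R} :=
  \poly_(k < (size p).+1) (if k is k'.+1 then p`_k' / k'.+1%:R else c).

Lemma size_antideriv c (p : {poly R}) n : (size p <= n)%N -> (size (antideriv c p) <= n.+1)%N.
Proof. by move=> pn; apply: leq_trans (size_poly _ _) _. Qed.

Lemma antideriv0 c (p : {poly R}) : (antideriv c p).[0] = c.
Proof. by rewrite horner_coef0 coef_poly. Qed.

Lemma deriv_antideriv c (p : {poly R}) : (antideriv c p)^`() = p.
Proof.
apply/polyP => k; rewrite coef_deriv coef_poly ltnS.
case: ltnP => kp; last by rewrite mul0rn nth_default.
by rewrite /= -[LHS]mulr_natr divfK// pnatr_eq0.
Qed.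

Lemma is_derive_horner (p : {poly R}) (t : R) : is_derive t 1 (horner p) p^`().[t].
Proof.
apply: DeriveDef; first exact: derivable_horner.
by rewrite -derive1E -derivE.
Qed.

Context {d : nat}.
Implicit Types (x : 'rV[R]_d) (f : 'rV[R]_d -> R).

Lemma is_derive_line f x v (t : R) : derivable f (x + t *: v) v ->
  is_derive t 1 (fun u => f (x + u *: v)) ('D_v f (x + t *: v)).
Proof.
move=> df.
have E : (fun h : R => h^-1 *: (f (x + (h *: (1 : R) + t) *: v) - f (x + t *: v))) =
  (fun h : R => h^-1 *: (f (h *: v + (x + t *: v)) - f (x + t *: v))).
  apply/funext => h; congr (_ *: (f _ - _)).
  by rewrite scalerDl addrCA; congr (_ *: _ + _); rewrite /GRing.scale/= mulr1.
apply: DeriveDef.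
  by rewrite /derivable /= E.
by rewrite /derive /= E.
Qed.

End derivatives.

Section smooth_functions.
Context {R : realType} {d : nat}.
Implicit Types (x : 'rV[R]_d) (f : 'rV[R]_d -> R).

Lemma enorm_delta (t : R) (i : 'I_d) : enorm (t *: delta_mx ord0 i) = `|t|.
Proof.
rewrite /enorm (bigD1 i)//= big1 ?addr0; last first.
  by move=> j ji; rewrite !mxE (negPf ji) andbF mulr0 expr0n.
by rewrite !mxE !eqxx mulr1 sqrtr_sqr.
Qed.

Lemma Cs1_partial_bounded s f (a : seq 'I_d) x : in_Cs1 s f ->
  (0 < size a < s)%N -> `|partial f a x| <= 1.
Proof.
move=> [_ fs] /andP[a0 as_].
rewrite -lee_fin (le_trans _ fs)// /Cs_norm.
rewrite (@le_trans _ _ (\big[maxe/0%E]_(1 <= k < s) \big[maxe/0%E]_(a : k.-tuple 'I_d)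
     supnorm (partial f a)))//; last first.
  by rewrite leeDl// bigmax_ge_id.
apply: (bigmax_sup_seq _ (size a)) => //.
  by rewrite mem_index_iota a0.
apply: (bigmax_sup (in_tuple a)) => //.
by apply: ereal_sup_ubound; exists x.
Qed.

Lemma Cs1_partial_lip s f (a : seq 'I_d) x y : in_Cs1 s f ->
  size a = s.-1 -> `|partial f a x - partial f a y| <= enorm (x - y).
Proof.
move=> [_ fs] sa.
have [->|xy] := pselect (x = y); first by rewrite subrr normr0 enorm_ge0.
have n0 : 0 < enorm (x - y).
  rewrite lt_neqAle enorm_ge0 andbT eq_sym; apply/eqP => n0; apply: xy.
  apply/rowP => i; have := coord_le_enorm (x - y) i.
  by rewrite n0 normr_le0 !mxE subr_eq0 => /eqP.
rewrite -[leRHS]mul1r -ler_pdivrMr// -lee_fin (le_trans _ fs)// /Cs_norm.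
rewrite (@le_trans _ _ (\big[maxe/0%E]_(a : s.-1.-tuple 'I_d) Lip (partial f a)))//;
  last by rewrite leeDr// bigmax_ge_id.
have sa' : size a == s.-1 by apply/eqP.
apply: (bigmax_sup (Tuple sa')) => //.
by apply: ereal_sup_ubound; exists (x, y).
Qed.

Lemma Cs1_derive s f (a : seq 'I_d) i x (t : R) : in_Cs1 s f -> ((size a).+1 < s)%N ->
  is_derive t 1 (fun u => partial f a (x + u *: delta_mx ord0 i))
    (partial f (i :: a) (x + t *: delta_mx ord0 i)).
Proof. by move=> [[df _ _] _] as_; apply: is_derive_line; exact: df. Qed.

(** For [r = s] this is the Lipschitz part of the norm; for [r < s] it follows
    from the bound on the derivative of order [r]. *)
Lemma Cs1_coord_lip s r f i x (t : R) : in_Cs1 s f -> (1 <= r <= s)%N ->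
  `|partial f (nseq r.-1 i) (x + t *: delta_mx ord0 i) -
    partial f (nseq r.-1 i) x| <= `|t|.
Proof.
move=> fs /andP[r1]; rewrite leq_eqVlt => /predU1P[->|rs].
  have := @Cs1_partial_lip _ f (nseq s.-1 i) (x + t *: delta_mx ord0 i) x fs.
  by rewrite size_nseq => /(_ erefl) /le_trans; apply; rewrite addrC addKr enorm_delta.
pose g u := partial f (nseq r.-1 i) (x + u *: delta_mx ord0 i).
have := @mean_value_bound _ g
  (fun u => partial f (nseq r i) (x + u *: delta_mx ord0 i)) `|t| 1 t.
rewrite /g scale0r addr0 mul1r; apply => // u _.
  have -> : nseq r i = i :: nseq r.-1 i by case: (r) r1.
  by apply: Cs1_derive fs _; rewrite size_nseq prednK.
by apply: (Cs1_partial_bounded _ fs); rewrite size_nseq r1.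
Qed.

Lemma Cs1_lip s f : (0 < s)%N -> in_Cs1 s f -> coord_lip f.
Proof. by move=> s0 fs x i t; exact: (@Cs1_coord_lip s 1 f i x t fs). Qed.

(** Descending induction on the order of the derivative, integrating the
    polynomial that approximates the next one. *)
Lemma Cs1_coord_approx s r f : in_Cs1 s f -> (1 <= r <= s)%N -> coord_approx r f.
Proof.
move=> fs rs x i h h0; have /andP[r1 rs'] := rs.
suff : forall k, (k < r)%N -> exists2 p : {poly R}, (size p <= k.+1)%N &
    forall t, `|t| <= h -> `|partial f (nseq (r.-1 - k) i)
      (x + t *: delta_mx ord0 i) - p.[t]| <= h ^+ k.+1.
  by move=> /(_ r.-1); rewrite subnn prednK//; apply.
elim=> [_|k IH kr].
  exists (partial f (nseq r.-1 i) x)%:P; first by rewrite size_polyC leq_b1.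
  move=> t th; rewrite hornerC subn0 expr1 (le_trans _ th)//.
  exact: (Cs1_coord_lip _ _ _ fs).
have [p sp hp] := IH (ltnW kr).
exists (antideriv (partial f (nseq (r.-1 - k.+1) i) x) p).
  exact: size_antideriv.
move=> t th; set q := antideriv _ _.
set g := partial f (nseq (r.-1 - k.+1) i).
have rk : (r.-1 - k)%N = (r.-1 - k.+1).+1 by lia.
have := @mean_value_bound _ (fun u => g (x + u *: delta_mx ord0 i) - q.[u])
  (fun u => partial f (nseq (r.-1 - k) i) (x + u *: delta_mx ord0 i) - p.[u])
  h (h ^+ k.+1) t.
rewrite scale0r addr0 antideriv0 subrr subr0 => H.
rewrite exprSr (le_trans (H _ _ th))//; last first.
- by rewrite ler_wpM2l// exprn_ge0// ltW.
- move=> u _; apply: is_deriveB.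
    rewrite rk /g; apply: Cs1_derive fs _.
    by rewrite size_nseq; lia.
  rewrite -[in X in is_derive _ _ _ X](deriv_antideriv (partial f (nseq (r.-1 - k.+1) i) x) p).
  exact: is_derive_horner.
Qed.

End smooth_functions.

(** * Lipschitz functions and the Wasserstein distance *)

Section measurability.
Context {R : realType} {d : nat}.
Implicit Types (x y : 'rV[R]_d) (g : 'rV[R]_d -> R).

Lemma continuous_measurable_rV g : continuous g -> measurable_fun setT g.
Proof.
move=> /continuousP cg.
apply: (measurability _ (RGenOpens.measurableE R)).
move=> _ [_ [a [b ->] <-]]; rewrite setTI.
by apply: sub_sigma_algebra; apply: cg; exact: interval_open.
Qed.

Lemma measurable_coord i : measurable_fun setT (fun x : 'rV[R]_d => x ord0 i).
Proof. by apply: continuous_measurable_rV; exact: coord_continuous. Qed.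

Definition lip_for (K : R) g := forall x y, `|g x - g y| <= K * enorm (x - y).

(** The balls are those of the maximum norm, which costs a factor [d]. *)
Lemma lip_continuous K g : lip_for K g -> continuous g.
Proof.
move=> gK x.
have FF : Filter (nbhs x) := nbhs_filter x.
apply: (iffRL (@cvgrPdist_lt _ _ _ _ FF g (g x))) => e e0.
pose c := (`|K| + 1) * (d%:R + 1).
have c0 : 0 < c by rewrite mulr_gt0// ltr_wpDl.
have ec0 : 0 < e / c by rewrite divr_gt0.
have nb : \forall y \near x, ball x (e / c) y by exact: nbhsx_ballx.
near=> y; have [_ xy] : ball x (e / c) y by near: y.
apply: (le_lt_trans (gK x y)).
have dK0 : 0 <= `|K| * d%:R by rewrite mulr_ge0.
apply: (@le_lt_trans _ _ (`|K| * (d%:R * (e / c)))).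
  apply: (@le_trans _ _ (`|K| * enorm (x - y))).
    by rewrite ler_wpM2r ?enorm_ge0 ?ler_norm.
  rewrite ler_wpM2l// (le_trans (enorm_le_sum _))//.
  rewrite mulr_natl -[X in _ *+ X]card_ord -sumr_const.
  by apply: ler_sum => i _; rewrite !mxE; exact/ltW/xy.
rewrite [ltLHS](_ : _ = e * (`|K| * d%:R / c)); last by ring.
rewrite gtr_pMr// ltr_pdivrMr// mul1r /c.
by have := normr_ge0 K; have := ler0n R d; nra.
Unshelve. all: by end_near. Qed.

Lemma lip_measurable K g : lip_for K g -> measurable_fun setT g.
Proof. by move=> /lip_continuous/continuous_measurable_rV. Qed.

Lemma enorm_coord_lip : coord_lip (@enorm R d).
Proof.
have key x i t : enorm (x + t *: delta_mx ord0 i) <= enorm x + `|t|.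
  rewrite -[leRHS]ger0_norm ?addr_ge0 ?enorm_ge0// -sqrtr_sqr ler_wsqrtr//.
  rewrite sqrrD sqr_sqrtr; last by apply: sumr_ge0 => k _; exact: sqr_ge0.
  rewrite [leLHS](bigD1 i)//= [X in _ <= X + _ + _](bigD1 i)//=.
  rewrite !mxE !eqxx mulr1.
  rewrite [X in _ + X <= _](eq_bigr (fun k => x ord0 k ^+ 2)); last first.
    by move=> k ki; rewrite !mxE (negPf ki) andbF mulr0 addr0.
  have := coord_le_enorm x i; rewrite real_normK ?num_real//.
  set S := \sum_(_ | _) _; set N := enorm x => hN.
  have : x ord0 i * t <= N * `|t|.
    by apply: le_trans (ler_norm _) _; rewrite normrM ler_wpM2r.
  by rewrite -mulr_natr; lra.
move=> x i t; rewrite ler_norml lerBlDl key andbT.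
have := key (x + t *: delta_mx ord0 i) i (- t).
by rewrite -addrA -scalerDl subrr scale0r addr0 normrN; lra.
Qed.

Lemma enorm_lip : lip_for d%:R (@enorm R d).
Proof. by move=> x y; apply: coord_lip_enorm; exact: enorm_coord_lip. Qed.

Lemma enormB_le x y : enorm (x - y) <= d%:R * (enorm x + enorm y).
Proof.
apply: (le_trans (enorm_le_sum _)).
rewrite mulrDr -[leRHS]addr0 (le_trans _ (lerD (lerD (sum_coord_le_enorm x)
  (sum_coord_le_enorm y)) (lexx 0)))// addr0 -big_split/=.
by apply: ler_sum => i _; rewrite !mxE ler_normB.
Qed.

Lemma measurable_enorm : measurable_fun setT (@enorm R d).
Proof. exact: lip_measurable enorm_lip. Qed.

Lemma measurable_enormB :
  measurable_fun setT (fun z : 'rV[R]_d * 'rV[R]_d => enorm (z.1 - z.2)).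
Proof.
rewrite /enorm; apply: measurableT_comp.
  by apply: continuous_measurable_fun; exact: sqrt_continuous.
apply: measurable_sum => i; apply: measurable_funX.
have m1 := measurableT_comp (measurable_coord i) (@measurable_fst _ _ 'rV[R]_d 'rV[R]_d).
have m2 := measurableT_comp (measurable_coord i) (@measurable_snd _ _ 'rV[R]_d 'rV[R]_d).
by have := measurable_funB m1 m2; apply: eq_measurable_fun => z _; rewrite /= !mxE.
Qed.

End measurability.

Section lipschitz_integrals.
Context {R : realType} {d : nat}.
Implicit Types (m mu nu : {measure set 'rV[R]_d -> \bar R}) (g : 'rV[R]_d -> R).

Lemma integrable_cst1 {disp} {T : measurableType disp}
    (m : {measure set T -> \bar R}) (c : R) :
  m setT = 1%E -> m.-integrable setT (EFin \o cst c).
Proof.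
move=> m1; apply/integrableP; split; first exact/measurable_EFinP.
by under eq_integral do rewrite /=; rewrite integral_cst// m1 mule1 ltry.
Qed.

Lemma in_P1_enorm m : in_P1 m -> m.-integrable setT (EFin \o enorm).
Proof.
move=> [_ m1]; apply/integrableP; split.
  by apply/measurable_EFinP; exact: measurable_enorm.
by under eq_integral do rewrite /= ger0_norm ?enorm_ge0//.
Qed.

Lemma lip_integrable m K g : in_P1 m -> lip_for K g ->
  m.-integrable setT (EFin \o g).
Proof.
move=> mP gK; have [m1 _] := mP.
apply: (@le_integrable _ _ _ m setT measurableT _
  (EFin \o (fun x => `|g 0| + K * enorm x))) => //.
- by apply/measurable_EFinP; exact: lip_measurable gK.
- move=> x _ /=; rewrite lee_fin; apply: le_trans (ler_norm _).
  have := gK x 0; rewrite subr0 => h; rewrite -lerBlDl.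
  by apply: le_trans h; exact: lerB_dist.
- pose c := `|g 0|.
  rewrite [X in _.-integrable _ X](_ : _ =
    (EFin \o cst c) \+ (fun x => K%:E * (EFin \o enorm) x))%E//.
  apply: integrableD => //; first exact: integrable_cst1.
  by apply: integrableZl => //; exact: in_P1_enorm.
Qed.

(** Any coupling bounds the difference of the integrals of a Lipschitz
    function: the easy half of the Kantorovich duality. *)
Lemma W1_lip mu nu (c K : R) g : in_P1 mu -> in_P1 nu -> (W1 mu nu <= c%:E)%E ->
  0 <= K -> lip_for K g ->
  `|\int[mu]_x g x - \int[nu]_x g x| <= K * c.
Proof.
move=> mP nP Wc K0 gK.
suff H : forall e : R, 0 < e ->
  `|\int[mu]_x g x - \int[nu]_x g x| <= K * c + e by exact/ler_addgt0Pr.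
move=> e e0; pose e' := e / (K + 1).
have K10 : 0 < K + 1 by rewrite ltr_wpDl.
have e'0 : 0 < e' by rewrite divr_gt0.
have : (W1 mu nu < (c + e')%:E)%E by rewrite (le_lt_trans Wc)// lte_fin ltrDl.
move=> /ereal_inf_lt[_ [pi cpi <-]] pic.
have gi1 := lip_integrable mP gK; have gi2 := lip_integrable nP gK.
have mg := lip_measurable gK.
have p1 A : measurable A -> pushforward pi fst A = mu A.
  move=> mA; have [<- _] := cpi A mA; rewrite /pushforward; congr (pi _).
  by apply/seteqP; split => [z ?|z []].
have p2 A : measurable A -> pushforward pi snd A = nu A.
  move=> mA; have [_ <-] := cpi A mA; rewrite /pushforward; congr (pi _).
  by apply/seteqP; split => [z ?|z []].
have tr (p : 'rV[R]_d * 'rV[R]_d -> 'rV[R]_d) (m : {measure set 'rV[R]_d -> \bar R}) :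
    measurable_fun setT p -> (forall A, measurable A -> pushforward pi p A = m A) ->
    m.-integrable setT (EFin \o g) ->
    pi.-integrable setT (EFin \o (g \o p)) /\
    \int[m]_x g x = \int[pi]_z g (p z).
  move=> mp pm gi.
  have mgE : measurable_fun setT (EFin \o g) by exact/measurable_EFinP.
  have ip : pi.-integrable setT (EFin \o (g \o p)).
    apply/integrableP; split.
      by apply/measurable_EFinP; exact: measurableT_comp.
    have /integrableP[_] := gi; apply: le_lt_trans.
    have -> : (\int[m]_x `|(EFin \o g) x| = \int[pushforward pi p]_x `|(EFin \o g) x|)%E.
      by apply: eq_measure_integral => A mA _; rewrite -pm.
    by rewrite ge0_integral_pushforward//; exact: measurableT_comp.
  split => //; rewrite /Rintegral; congr fine.
  transitivity (\int[pushforward pi p]_x (EFin \o g) x)%E.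
    by apply: eq_measure_integral => A mA _; rewrite -pm.
  by rewrite integral_pushforward.
have [i1 ->] := tr fst mu measurable_fst p1 gi1.
have [i2 ->] := tr snd nu measurable_snd p2 gi2.
rewrite -RintegralB//.
have ie : pi.-integrable setT (EFin \o (fun z => enorm (z.1 - z.2))).
  apply/integrableP; split.
    by apply/measurable_EFinP; exact: measurable_enormB.
  under eq_integral do rewrite /= ger0_norm ?enorm_ge0//.
  by apply: lt_trans pic _; rewrite ltry.
have ie' : pi.-integrable setT (EFin \o (fun z => K * enorm (z.1 - z.2))).
  rewrite [X in _.-integrable _ X](_ : _ =
    (fun z => K%:E * (EFin \o (fun z => enorm (z.1 - z.2))) z)%E)//.
  exact: integrableZl.
have i12 : pi.-integrable setT (EFin \o (fun z => g z.1 - g z.2)).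
  exact: (integrableB measurableT i1 i2).
apply: (le_trans (le_normr_Rintegral _ i12)) => //.
apply: (@le_trans _ _ (\int[pi]_z (K * enorm (z.1 - z.2)))).
  by apply: le_Rintegral => //; exact: integrable_norm.
rewrite (RintegralZl K measurableT ie).
have -> : K * c + e = K * (c + e') + e' by rewrite /e'; field; rewrite gt_eqF.
rewrite -[leLHS]addr0 lerD ?(ltW e'0)// ler_wpM2l//.
rewrite -lee_fin /Rintegral fineK; first exact: ltW.
exact: integrable_fin_num.
Qed.

End lipschitz_integrals.

(** * Functionals determined by their values on indicators *)

Section nonnegative_functionals.
Local Open Scope ereal_scope.
Context {disp : measure_display} {T : measurableType disp} {R : realType}.
Implicit Types (Phi Psi : (T -> \bar R) -> \bar R) (f g : T -> \bar R).

Definition nnmeas f := (forall x, 0 <= f x) /\ measurable_fun setT f.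

(** The properties of integration that determine it from its values on
    indicators. *)
Record integral_like Phi : Prop := IntegralLike {
  il_add : forall f g, nnmeas f -> nnmeas g ->
    Phi (fun x => f x + g x) = Phi f + Phi g;
  il_scale : forall (c : R) f, (0 <= c)%R -> nnmeas f ->
    Phi (fun x => c%:E * f x) = c%:E * Phi f;
  il_lim : forall (f_ : nat -> T -> \bar R), (forall n, nnmeas (f_ n)) ->
    (forall x, nondecreasing_seq (f_ ^~ x)) ->
    Phi (fun x => limn (f_ ^~ x)) = limn (fun n => Phi (f_ n)) }.

Lemma il_sum Phi (I : Type) (s : seq I) (c : I -> R) (f : I -> T -> \bar R) :
  integral_like Phi -> (forall i, (0 <= c i)%R) -> (forall i, nnmeas (f i)) ->
  Phi (fun x => \sum_(i <- s) (c i)%:E * f i x) =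
    \sum_(i <- s) (c i)%:E * Phi (f i).
Proof.
move=> iP c0 fi; elim: s => [|i s IH].
  under eq_fun do rewrite big_nil.
  rewrite big_nil; have z : nnmeas (cst 0) by split => //; exact: measurable_cst.
  have := il_scale iP (lexx 0%R) z; rewrite mul0e => E.
  by rewrite -[RHS]E; congr Phi; apply/funext => x /=; rewrite mul0e.
under eq_fun do rewrite big_cons.
have nnc j : nnmeas (fun x => (c j)%:E * f j x).
  have [f0 mf] := fi j; split; last exact: measurable_funeM.
  by move=> x; rewrite mule_ge0// lee_fin.
rewrite (il_add iP)// ?big_cons ?IH ?(il_scale iP)//.
split; first by move=> x; apply: sume_ge0 => j _; case: (nnc j).
by apply: emeasurable_sum => j; case: (nnc j).
Qed.

Import HBNNSimple.

(** A nonnegative measurable function is the increasing limit of simple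
    functions. Comparing functionals rather than measures avoids
    constructing the measures behind mixtures and conditional
    expectations. *)
Lemma integral_like_eq Phi Psi f : integral_like Phi -> integral_like Psi ->
  (forall A, measurable A ->
    Phi (fun x => (\1_A x)%:E) = Psi (fun x => (\1_A x)%:E)) ->
  nnmeas f -> Phi f = Psi f.
Proof.
move=> iP iQ PQ [f0 mf].
pose f_ := nnsfun_approx measurableT mf.
have nnf n : nnmeas (fun x => (f_ n x)%:E).
  split; first by move=> x; rewrite lee_fin.
  exact/measurable_EFinP.
have ndf x : nondecreasing_seq (fun n => (f_ n x)%:E).
  by move=> a b ab; rewrite lee_fin; exact/lefP/nd_nnsfun_approx.
have -> : f = (fun x => limn (fun n => (f_ n x)%:E)).
  by apply/funext => x; apply/esym/cvg_lim => //; exact: cvg_nnsfun_approx.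
rewrite (il_lim iP nnf ndf) (il_lim iQ nnf ndf); congr (limn _).
apply/funext => n.
(* The values of a simple function are nonnegative on its range only; the
   maximum makes the coefficients nonnegative for every index. *)
pose s : seq R := finmap.enum_fset (fset_set (range (f_ n))).
have -> : (fun x => (f_ n x)%:E) = (fun x =>
    \sum_(y <- s) (Num.max 0%R y)%:E * (\1_(f_ n @^-1` [set y]) x)%:E).
  apply/funext => x.
  rewrite [in LHS]fimfunE fsbig_finite//= -sumEFin; apply: eq_big_seq => y.
  rewrite in_fset_set// inE => -[z _ <-].
  by rewrite EFinM max_r.
have n1 y : nnmeas (fun x => (\1_(f_ n @^-1` [set y]) x)%:E).
  split; first by move=> x; rewrite lee_fin.
  by apply/measurable_EFinP; exact: measurable_indic.
rewrite (il_sum s iP (fun y => _) n1) ?(il_sum s iQ (fun y => _) n1)//.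
  by apply: eq_bigr => y _; rewrite PQ.
all: by move=> y; rewrite le_max lexx.
Qed.

End nonnegative_functionals.

Section functionals.
Local Open Scope ereal_scope.
Context {d1 d2 : measure_display} {S : measurableType d1} {T : measurableType d2}
  {R : realType}.

Lemma integral_like_comp (m : {measure set S -> \bar R}) (D : set S)
    (p : S -> T) (w : S -> R) :
  measurable D -> measurable_fun setT p ->
  (forall x, (0 <= w x)%R) -> measurable_fun setT w ->
  integral_like (fun f => \int[m]_(x in D) ((w x)%:E * f (p x))).
Proof.
move=> mD mp w0 mw.
have nn f : nnmeas f -> nnmeas (fun x => (w x)%:E * f (p x)).
  move=> [f0 mf]; split; first by move=> x; rewrite mule_ge0// lee_fin.
  apply: emeasurable_funM; last exact: measurableT_comp.
  exact/measurable_EFinP.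
split => [f g nf ng|c f c0 nf|f_ nf ndf].
- rewrite -ge0_integralD//.
  + by apply: eq_integral => x _; rewrite ge0_muleDr//; [case: nf|case: ng].
  + by move=> x _; case: (nn _ nf).
  + by apply: measurable_funTS; case: (nn _ nf).
  + by move=> x _; case: (nn _ ng).
  + by apply: measurable_funTS; case: (nn _ ng).
- rewrite -ge0_integralZl//.
  + by apply: eq_integral => x _; rewrite muleCA.
  + by apply: measurable_funTS; case: (nn _ nf).
  + by move=> x _; case: (nn _ nf).
- rewrite -monotone_convergence//.
  + apply: eq_integral => x _; rewrite limeMl//.
    exact/ereal_nondecreasing_is_cvgn/ndf.
  + by move=> n; apply: measurable_funTS; case: (nn _ (nf n)).
  + by move=> n x _; case: (nn _ (nf n)).
  + move=> x _ a b ab; rewrite lee_wpmul2l ?lee_fin//; exact: (ndf (p x) a b ab).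
Qed.

Lemma integral_like_mix (m : {measure set S -> \bar R}) (D : set S)
    (K : S -> {measure set T -> \bar R}) :
  measurable D ->
  (forall U, measurable U -> measurable_fun setT (K ^~ U)) ->
  integral_like (fun f => \int[m]_(x in D) \int[K x]_y f y).
Proof.
move=> mD mK.
have nn f : nnmeas f -> nnmeas (fun x => \int[K x]_y f y).
  move=> [f0 mf]; split; first by move=> x; exact: integral_ge0.
  exact: measurable_fun_integral_kernel.
split => [f g nf ng|c f c0 nf|f_ nf ndf].
- rewrite -ge0_integralD//.
  + by apply: eq_integral => x _; rewrite ge0_integralD//; case: nf; case: ng.
  + by move=> x _; case: (nn _ nf).
  + by apply: measurable_funTS; case: (nn _ nf).
  + by move=> x _; case: (nn _ ng).
  + by apply: measurable_funTS; case: (nn _ ng).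
- rewrite -ge0_integralZl//.
  + by apply: eq_integral => x _; rewrite ge0_integralZl//; case: nf.
  + by apply: measurable_funTS; case: (nn _ nf).
  + by move=> x _; case: (nn _ nf).
- rewrite -monotone_convergence//.
  + apply: eq_integral => x _; rewrite monotone_convergence//.
    * by move=> n; case: (nf n).
    * by move=> n y _; case: (nf n).
  + by move=> n; apply: measurable_funTS; case: (nn _ (nf n)).
  + by move=> n x _; case: (nn _ (nf n)).
  + move=> x _ a b ab; apply: ge0_le_integral => //.
    * by move=> y _; case: (nf a).
    * by case: (nf a).
    * by case: (nf b).
    * by move=> y _; exact: (ndf y a b ab).
Qed.

End functionals.

(** * Iterated kernels and the Markov property *)

Section kernel_iterates.
Context {R : realType} {d : nat}.
Variable P : R.-pker 'rV[R]_d ~> 'rV[R]_d.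
Implicit Types (x y : 'rV[R]_d) (g : 'rV[R]_d -> R).

Definition kmean (k : nat) g x : R := \int[kiter P k x]_y g y.

Lemma integral_like_integral {d1 d2} {S : measurableType d1}
    {T : measurableType d2} (m : {measure set S -> \bar R}) (D : set S)
    (p : S -> T) : measurable D -> measurable_fun setT p ->
  integral_like (fun f => \int[m]_(x in D) f (p x))%E.
Proof.
move=> mD mp.
have := @integral_like_comp _ _ _ _ _ m D p (cst 1) mD mp
  (fun=> ler01) (measurable_cst _).
rewrite (_ : (fun f => _) = (fun f => \int[m]_(x in D) f (p x))%E)//.
by apply/funext => f; apply: eq_integral => x _; rewrite mul1e.
Qed.

Lemma integral_kiterS k x f : nnmeas f ->
  (\int[kiter P k.+1 x]_y f y = \int[kiter P k x]_y \int[P y]_z f z)%E.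
Proof.
move=> nf; apply: (@integral_like_eq _ _ _ (fun f => \int[kiter P k.+1 x]_y f y)%E
  (fun f => \int[kiter P k x]_y \int[P y]_z f z)%E) => //.
- exact: (@integral_like_integral _ _ _ _ (kiter P k.+1 x) setT id).
- by apply: integral_like_mix => // U mU; exact: measurable_kernel.
- move=> A mA; rewrite integral_indic// setIT.
  rewrite [LHS]/= /mkcomp_noparam /kcomp_noparam.
  by apply: eq_integral => y _; rewrite integral_indic// setIT.
Qed.

Lemma kiter_setT k x : kiter P k x setT = 1%E.
Proof. by rewrite prob_kernel. Qed.

Lemma integral_kiter0 x f : measurable_fun setT f ->
  (\int[kiter P 0 x]_y f y = f x)%E.
Proof. by move=> mf; rewrite /= /kdirac/= integral_dirac// diracT mul1e. Qed.

Lemma invariant_integral (mu : {measure set 'rV[R]_d -> \bar R}) k f :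
  invariant_measure P mu -> nnmeas f ->
  (\int[mu]_x \int[kiter P k x]_y f y = \int[mu]_x f x)%E.
Proof.
move=> inv; elim: k f => [|k IH] f nf; have [f0 mf] := nf.
  by apply: eq_integral => x _; rewrite integral_kiter0.
under eq_integral do rewrite integral_kiterS//.
rewrite (IH (fun y => \int[P y]_z f z))%E; last first.
  split; first by move=> x; exact: integral_ge0.
  by apply: measurable_fun_integral_kernel => // U mU; exact: measurable_kernel.
apply: (@integral_like_eq _ _ _ (fun f => \int[mu]_y \int[P y]_z f z)%E
  (fun f => \int[mu]_y f y)%E) => //.
- by apply: integral_like_mix => // U mU; exact: measurable_kernel.
- exact: (@integral_like_integral _ _ _ _ mu setT id).
- move=> A mA; rewrite integral_indic// setIT -inv//.
  by apply: eq_integral => y _; rewrite integral_indic// setIT.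
Qed.

End kernel_iterates.

Section markov_property.
Context {R : realType} {d : nat} {disp : measure_display}
  {Omega : measurableType disp} {Pr : probability Omega R}.
Variables (P : R.-pker 'rV[R]_d ~> 'rV[R]_d) (X : nat -> {RV Pr >-> 'rV[R]_d}).
Hypothesis hX : markov_chain P X.

Let mX n : measurable_fun setT (X n). Proof. exact: measurable_funPT. Qed.

Lemma history_preimage i n B : (i <= n)%N -> measurable B ->
  history X n (X i @^-1` B).
Proof.
by move=> i_n mB; apply: sub_sigma_algebra; exists i => //; exists B.
Qed.

Lemma mpre i B : measurable B -> measurable (X i @^-1` B).
Proof. by move=> mB; rewrite -[X in measurable X]setTI; exact: mX. Qed.

(** Induction on the lag: the event concerning [X i] belongs to the history of
    every later time, so one more step integrates the kernel once more. *)
Lemma chain_integral i k B f : measurable B -> nnmeas f ->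
  (\int[Pr]_(w in X i @^-1` B) f (X (i + k)%N w) =
   \int[Pr]_(w in X i @^-1` B) \int[kiter P k (X i w)]_y f y)%E.
Proof.
move=> mB; elim: k f => [|k IH] f nf; have [f0 mf] := nf.
  by rewrite addn0; apply: eq_integral => w _; rewrite integral_kiter0.
under [RHS]eq_integral do rewrite integral_kiterS//.
rewrite -(IH (fun y => \int[P y]_z f z))%E; last first.
  split; first by move=> x; exact: integral_ge0.
  by apply: measurable_fun_integral_kernel => // U mU; exact: measurable_kernel.
rewrite addnS.
apply: (@integral_like_eq _ _ _
  (fun f => \int[Pr]_(w in X i @^-1` B) f (X (i + k).+1 w))%E
  (fun f => \int[Pr]_(w in X i @^-1` B) \int[P (X (i + k)%N w)]_z f z)%E) => //.
- by apply: integral_like_integral => //; exact: mpre.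
- apply: (@integral_like_mix _ _ _ _ _ Pr (X i @^-1` B) (fun w => P (X (i + k)%N w))).
    exact: mpre.
  by move=> U mU; exact: measurableT_comp (measurable_kernel P U mU) _.
- move=> A mA.
  transitivity (Pr (X i @^-1` B `&` X (i + k).+1 @^-1` A)).
    rewrite setIC -(integral_indic Pr (mpre i mB) (mpre (i + k).+1 mA)).
    by apply: eq_integral => w _.
  rewrite (hX mA (history_preimage (leq_addr k i) mB)).
  by apply: eq_integral => w _; rewrite integral_indic// setIT.
Qed.

Lemma bounded_integrable {d1} {S : measurableType d1}
    (m : {measure set S -> \bar R}) (c : R) (F : S -> R) : m setT = 1%E ->
  measurable_fun setT F -> (forall x, `|F x| <= c) ->
  m.-integrable setT (EFin \o F).
Proof.
move=> m1 mF Fc; apply: (@le_integrable _ _ _ m setT measurableT _ (EFin \o cst c)).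
- exact/measurable_EFinP.
- by move=> x _; rewrite lee_fin /= (le_trans (Fc x))// ler_norm.
- exact: integrable_cst1.
Qed.

Lemma Rintegral_cst1 {d1} {S : measurableType d1}
    (m : {measure set S -> \bar R}) (c : R) : m setT = 1%E ->
  \int[m]_x c = c.
Proof. by move=> m1; rewrite Rintegral_cst// m1 mulr1. Qed.

Lemma kmean_bounded k (c : R) (v : 'rV[R]_d -> R) x : measurable_fun setT v ->
  (forall x, `|v x| <= c) -> `|kmean P k v x| <= c.
Proof.
move=> mv vc; have p1 := kiter_setT P k x.
have iv := bounded_integrable p1 mv vc.
apply: (le_trans (le_normr_Rintegral measurableT iv)).
rewrite -[leRHS](Rintegral_cst1 c p1); apply: le_Rintegral => //.
- exact: integrable_norm.
- exact: integrable_cst1.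
Qed.

Lemma kmeanE k (c : R) (v : 'rV[R]_d -> R) x : measurable_fun setT v ->
  (forall x, `|v x| <= c) ->
  (kmean P k v x)%:E = (\int[kiter P k x]_y (v y)%:E)%E.
Proof.
move=> mv vc; rewrite /kmean /Rintegral fineK//; apply: integrable_fin_num => //.
exact: bounded_integrable (kiter_setT P k x) mv vc.
Qed.

Lemma kmean_measurable k (c : R) (v : 'rV[R]_d -> R) : measurable_fun setT v ->
  (forall x, 0 <= v x) -> (forall x, `|v x| <= c) ->
  measurable_fun setT (kmean P k v).
Proof.
move=> mv v0 vc; apply/measurable_EFinP.
rewrite (_ : EFin \o _ = (fun x => \int[kiter P k x]_y (v y)%:E)%E); last first.
  by apply/funext => x; exact: kmeanE mv vc.
apply: measurable_fun_integral_kernel.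
- by move=> U mU; exact: measurable_kernel.
- by move=> y; rewrite lee_fin.
- exact/measurable_EFinP.
Qed.

Lemma kmean_shift k (c e : R) (v : 'rV[R]_d -> R) x : measurable_fun setT v ->
  (forall x, `|v x| <= c) ->
  kmean P k (fun y => v y + e) x = kmean P k v x + e.
Proof.
move=> mv vc; have p1 := kiter_setT P k x.
rewrite /kmean RintegralD//.
- by rewrite Rintegral_cst1.
- exact: bounded_integrable p1 mv vc.
- exact: integrable_cst1.
Qed.

Lemma kmean_bounded_measurable k (c : R) (v : 'rV[R]_d -> R) :
  measurable_fun setT v -> (forall x, `|v x| <= c) ->
  measurable_fun setT (kmean P k v).
Proof.
move=> mv vc.
have -> : kmean P k v = (fun x => kmean P k (fun y => v y + c) x - c).
  by apply/funext => x; rewrite (kmean_shift _ _ _ mv vc) addrK.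
apply: measurable_funB => //; apply: (@kmean_measurable _ (c + c)).
- exact: measurable_funD.
- by move=> x; have := vc x; rewrite ler_norml; lra.
- move=> x; rewrite (le_trans (ler_normD _ _))// lerD// ger0_norm//.
  by apply: le_trans (vc x).
Qed.

(** Both sides are functionals of [u] determined by indicators, for which the
    claim is the Markov property on the event that [X i] lies in a set. *)
Lemma chain_pair i k (c : R) (u v : 'rV[R]_d -> R) :
  measurable_fun setT u -> measurable_fun setT v ->
  (forall x, 0 <= u x) -> (forall x, 0 <= v x) -> (forall x, `|v x| <= c) ->
  \int[Pr]_w (v (X (i + k)%N w) * u (X i w)) =
  \int[Pr]_w (kmean P k v (X i w) * u (X i w)).
Proof.
move=> mu mv u0 v0 vc.
have kE x := kmeanE k x mv vc.
have k0 x : 0 <= kmean P k v x by exact: Rintegral_ge0.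
have mk := kmean_measurable k mv v0 vc.
rewrite /Rintegral; congr fine.
under eq_integral do rewrite EFinM.
under [RHS]eq_integral do rewrite EFinM.
apply: (@integral_like_eq _ _ _
  (fun f => \int[Pr]_w ((v (X (i + k)%N w))%:E * f (X i w)))%E
  (fun f => \int[Pr]_w ((kmean P k v (X i w))%:E * f (X i w)))%E
  (EFin \o u)) => //.
- apply: (@integral_like_comp _ _ _ _ _ Pr setT (X i) (fun w => v (X (i + k)%N w))) => //.
  exact: measurableT_comp.
- apply: (@integral_like_comp _ _ _ _ _ Pr setT (X i) (fun w => kmean P k v (X i w))) => //.
  exact: measurableT_comp.
- move=> A mA.
  have E (F : Omega -> R) : (\int[Pr]_w ((F w)%:E * (\1_A (X i w))%:E) =
      \int[Pr]_(w in X i @^-1` A) (F w)%:E)%E.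
    rewrite [RHS]integral_mkcond; apply: eq_integral => w _.
    rewrite patchE indicE; case: ifPn => wA.
      by rewrite (_ : X i w \in A) ?mule1//; rewrite inE in wA *.
    by rewrite (_ : X i w \in A = false) ?mule0//; apply/negbTE; rewrite !notin_setE in wA *.
  have nv : nnmeas (EFin \o v).
    by split; [move=> x; rewrite lee_fin|exact/measurable_EFinP].
  rewrite !E [LHS](@chain_integral i k A (EFin \o v) mA nv).
  by apply: eq_integral => w _; rewrite kE.
- by split; [move=> x; rewrite lee_fin|exact/measurable_EFinP].
Qed.

Lemma RV_bounded_integrable (c : R) (F : Omega -> R) :
  measurable_fun setT F -> (forall x, `|F x| <= c) ->
  Pr.-integrable setT (EFin \o F).
Proof. by move=> mF Fc; apply: bounded_integrable mF Fc; exact: probability_setT. Qed.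

(** Conditioning on the present: the nonnegative case is applied to the
    functions shifted by their bound. *)
Lemma chain_covariance i k (c : R) (h : 'rV[R]_d -> R) :
  measurable_fun setT h -> (forall x, `|h x| <= c) ->
  \int[Pr]_w (h (X i w) * h (X (i + k)%N w)) =
  \int[Pr]_w (h (X i w) * kmean P k h (X i w)).
Proof.
move=> mh hc.
have c0 : 0 <= c by apply: le_trans (hc 0).
pose v x := h x + c.
have v0 x : 0 <= v x by have := hc x; rewrite /v ler_norml; lra.
have mv : measurable_fun setT v by exact: measurable_funD.
have v2 x : `|v x| <= c + c.
  by rewrite (le_trans (ler_normD _ _))// lerD// ger0_norm.
have mk := kmean_bounded_measurable k mh hc.
have kb := kmean_bounded k _ mh hc.
have kvE x : kmean P k v x = kmean P k h x + c by rewrite (kmean_shift _ _ _ mh hc).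
have mhX n : measurable_fun setT (fun w => h (X n w)) by exact: measurableT_comp.
have mkX n : measurable_fun setT (fun w => kmean P k h (X n w)).
  exact: measurableT_comp.
have bprod a b : `|a| <= c -> `|b| <= c -> `|a * b| <= c * c.
  by move=> ac bc; rewrite normrM ler_pM.
have i1 : Pr.-integrable setT (EFin \o (fun w => h (X i w) * h (X (i + k)%N w))).
  by apply: (@RV_bounded_integrable (c * c)); [exact: measurable_funM|move=> w; exact: bprod].
have i2 : Pr.-integrable setT (EFin \o (fun w => h (X i w) * kmean P k h (X i w))).
  by apply: (@RV_bounded_integrable (c * c)); [exact: measurable_funM|move=> w; exact: bprod].
have i3 : Pr.-integrable setT (EFin \o (fun w => c * h (X (i + k)%N w) + c * v (X i w))).
  apply: (@RV_bounded_integrable (c * c + c * (c + c))).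
    apply: measurable_funD; apply: measurable_funM => //; exact: measurableT_comp.
  move=> w; rewrite (le_trans (ler_normD _ _))// lerD// normrM ger0_norm// ler_wpM2l//.
have i4 : Pr.-integrable setT (EFin \o (fun w => c * kmean P k h (X i w) + c * v (X i w))).
  apply: (@RV_bounded_integrable (c * c + c * (c + c))).
    apply: measurable_funD; apply: measurable_funM => //; exact: measurableT_comp.
  move=> w; rewrite (le_trans (ler_normD _ _))// lerD// normrM ger0_norm// ler_wpM2l//.
have e1 := chain_pair i k mv mv v0 v0 v2.
have e2 := @chain_pair i k _ (cst c) v (measurable_cst _) mv (fun=> c0) v0 v2.
have E1 : \int[Pr]_w (v (X (i + k)%N w) * v (X i w)) =
    \int[Pr]_w (h (X i w) * h (X (i + k)%N w)) +
    \int[Pr]_w (c * h (X (i + k)%N w) + c * v (X i w)).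
  by rewrite -RintegralD//; apply: eq_Rintegral => w _; rewrite /v; ring.
have E2 : \int[Pr]_w (kmean P k v (X i w) * v (X i w)) =
    \int[Pr]_w (h (X i w) * kmean P k h (X i w)) +
    \int[Pr]_w (c * kmean P k h (X i w) + c * v (X i w)).
  by rewrite -RintegralD//; apply: eq_Rintegral => w _; rewrite kvE /v; ring.
suff E3 : \int[Pr]_w (c * h (X (i + k)%N w) + c * v (X i w)) =
    \int[Pr]_w (c * kmean P k h (X i w) + c * v (X i w)).
  by apply: (addIr (\int[Pr]_w (c * h (X (i + k)%N w) + c * v (X i w)))); rewrite -E1 e1 E2 E3.
have i5 : Pr.-integrable setT (EFin \o (fun w => c * v (X i w) - c * c)).
  apply: (@RV_bounded_integrable (c * (c + c) + c * c)).
    apply: measurable_funB => //; apply: measurable_funM => //; exact: measurableT_comp.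
  move=> w; rewrite (le_trans (ler_normB _ _))// lerD// normrM (ger0_norm c0)// ler_wpM2l//.
have i6 : Pr.-integrable setT (EFin \o (fun w => v (X (i + k)%N w) * c)).
  apply: (@RV_bounded_integrable ((c + c) * c)).
    apply: measurable_funM => //; exact: measurableT_comp.
  by move=> w; rewrite normrM (ger0_norm c0) ler_wpM2r.
have i7 : Pr.-integrable setT (EFin \o (fun w => kmean P k v (X i w) * c)).
  apply: (@RV_bounded_integrable ((c + c) * c)).
    by apply: measurable_funM => //; under eq_fun do rewrite kvE; exact: measurable_funD.
  move=> w; rewrite kvE normrM (ger0_norm c0) ler_wpM2r//.
  by rewrite (le_trans (ler_normD _ _))// lerD// ger0_norm.
transitivity (\int[Pr]_w (v (X (i + k)%N w) * c) + \int[Pr]_w (c * v (X i w) - c * c)).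
  by rewrite -RintegralD//; apply: eq_Rintegral => w _; rewrite /v; ring.
rewrite e2 -RintegralD//; apply: eq_Rintegral => w _; rewrite kvE /=; ring.
Qed.

End markov_property.

(** * Convergence to the invariant measure *)

Lemma integrable_mulr {d1} {S : measurableType d1} {R : realType}
    (m : {measure set S -> \bar R}) (c : R) (F : S -> R) :
  m.-integrable setT (EFin \o F) ->
  m.-integrable setT (EFin \o (fun x => c * F x)).
Proof. by move=> iF; exact: (integrableZl measurableT c iF). Qed.

Section contraction.
Context {R : realType} {d : nat} {disp : measure_display}
  {Omega : measurableType disp} {Pr : probability Omega R}.
Variables (P : R.-pker 'rV[R]_d ~> 'rV[R]_d) (X : nat -> {RV Pr >-> 'rV[R]_d}).
Variables (D kappa : R) (mu : probability 'rV[R]_d R).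
Hypotheses (hX : markov_chain P X) (hD : 1 <= D) (hkappa : 0 < kappa < 1)
  (hP1 : forall n x, (0 < n)%N -> in_P1 (kiter P n x))
  (hW1 : forall n x y, (0 < n)%N ->
    (W1 (kiter P n x) (kiter P n y) <= (D * kappa ^+ n * enorm (x - y))%:E)%E)
  (hmu1 : in_P1 mu) (hmu : invariant_measure P mu).
Implicit Types (x y : 'rV[R]_d) (g : 'rV[R]_d -> R).

Let D0 : 0 <= D. Proof. exact: le_trans hD. Qed.
Let k0 : 0 <= kappa. Proof. by apply: ltW; case/andP: hkappa. Qed.
Let mX n : measurable_fun setT (X n). Proof. exact: measurable_funPT. Qed.

Lemma kiter_in_P1 k x : in_P1 (kiter P k x).
Proof.
case: k => [|k]; last exact: hP1.
split; first exact: kiter_setT.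
rewrite (integral_kiter0 P x (f := fun y => (enorm y)%:E)) ?ltry//.
by apply/measurable_EFinP; exact: measurable_enorm.
Qed.

Lemma kmean_lip k K g : 0 <= K -> lip_for K g ->
  lip_for (K * (D * kappa ^+ k)) (kmean P k g).
Proof.
move=> K0 gK x y; case: k => [|k].
  have E z : kmean P 0 g z = g z.
    rewrite /kmean /Rintegral (integral_kiter0 P z (f := EFin \o g))//.
    by apply/measurable_EFinP; exact: lip_measurable gK.
  rewrite !E expr0 mulr1 (le_trans (gK x y))// ler_wpM2r ?enorm_ge0//.
  by rewrite ler_peMr.
rewrite -mulrA; apply: W1_lip => //; [exact: kiter_in_P1|exact: kiter_in_P1|].
exact: hW1.
Qed.

Lemma kmean_lipE k K g x : lip_for K g ->
  (kmean P k g x)%:E = (\int[kiter P k x]_y (g y)%:E)%E.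
Proof.
move=> gK; rewrite /kmean /Rintegral fineK//; apply: integrable_fin_num => //.
exact: lip_integrable (kiter_in_P1 k x) gK.
Qed.

Lemma lip_nnmeas K g : lip_for K g -> (forall x, 0 <= g x) -> nnmeas (EFin \o g).
Proof.
move=> gK g0; split; first by move=> x; rewrite lee_fin.
by apply/measurable_EFinP; exact: lip_measurable gK.
Qed.

Lemma mu_kmean k K g : lip_for K g -> (forall x, 0 <= g x) ->
  \int[mu]_x kmean P k g x = \int[mu]_x g x.
Proof.
move=> gK g0; rewrite /Rintegral; congr fine.
rewrite -[RHS](@invariant_integral _ _ P mu k (EFin \o g))//; last exact: lip_nnmeas gK g0.
by apply: eq_integral => x _; rewrite (kmean_lipE _ _ gK).
Qed.

Let M := \int[mu]_x enorm x.

Lemma mu_enorm_ge0 : 0 <= M.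
Proof. by apply: Rintegral_ge0 => x _; exact: enorm_ge0. Qed.

(** By invariance the integral of [g] is that of its conditional mean, which
    is Lipschitz with a constant decaying in [k]; this constant times the
    distance to the other starting point is then averaged under [mu]. *)
Lemma kmean_ergodic k K g x : 0 <= K -> lip_for K g -> (forall x, 0 <= g x) ->
  `|kmean P k g x - \int[mu]_y g y| <=
    K * (D * kappa ^+ k) * (d%:R * (enorm x + M)).
Proof.
move=> K0 gK g0; rewrite -(mu_kmean k gK g0).
have kl := kmean_lip k K0 gK.
have ik := lip_integrable hmu1 kl.
have m1 : mu setT = 1%E by case: hmu1.
have c0 : 0 <= K * (D * kappa ^+ k) by rewrite !mulr_ge0 ?exprn_ge0.
have ic := integrable_cst1 (kmean P k g x) m1.
have ie := in_P1_enorm hmu1.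
rewrite -[X in `|X - _|](Rintegral_cst1 (kmean P k g x) m1) -RintegralB//.
have i1 : mu.-integrable setT (EFin \o (fun y => kmean P k g x - kmean P k g y)).
  exact: (integrableB measurableT ic ik).
have i2 : mu.-integrable setT (EFin \o (fun y => enorm x + enorm y)).
  exact: (integrableD measurableT (integrable_cst1 (enorm x) m1) ie).
pose c : R := K * (D * kappa ^+ k) * d%:R.
have i3 : mu.-integrable setT (EFin \o (fun y => c * (enorm x + enorm y))).
  exact: integrable_mulr.
apply: (le_trans (le_normr_Rintegral _ i1)) => //.
apply: (@le_trans _ _ (\int[mu]_y (c * (enorm x + enorm y)))).
  apply: le_Rintegral => //; first exact: integrable_norm.
  move=> y _; apply: (le_trans (kl x y)); rewrite /c -[leRHS]mulrA ler_wpM2l//.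
  exact: enormB_le.
rewrite (RintegralZl c measurableT i2) RintegralD//; last exact: integrable_cst1.
by rewrite Rintegral_cst1// mulrA.
Qed.

(** The laws of the chain converge to the invariant law, tested on Lipschitz
    functions, so that bounds uniform along the chain hold for the invariant
    law. *)
Lemma stationary_le K g (tau : R) : 0 <= K -> lip_for K g ->
  (forall x, 0 <= g x) -> (\int[Pr]_w (enorm (X 0%N w))%:E < +oo)%E ->
  (forall i, \int[Pr]_w (g (X i w))%:E <= tau%:E)%E ->
  \int[mu]_x g x <= tau.
Proof.
move=> K0 gK g0 X0 gtau; set mg := \int[mu]_x g x.
pose A := K * D * d%:R.
have A0 : 0 <= A by rewrite !mulr_ge0.
have mg0 : 0 <= mg by apply: Rintegral_ge0.
have mgX i : measurable_fun setT (fun w => g (X i w)).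
  exact: measurableT_comp (lip_measurable gK) (mX i).
have meX : measurable_fun setT (fun w => enorm (X 0%N w)).
  exact: measurableT_comp measurable_enorm (mX 0%N).
have X0fin : (\int[Pr]_w (enorm (X 0%N w))%:E)%E \is a fin_num.
  rewrite ge0_fin_numE//; apply: integral_ge0 => w _.
  by rewrite lee_fin enorm_ge0.
pose e0 := fine (\int[Pr]_w (enorm (X 0%N w))%:E)%E.
have mk k : measurable_fun setT (fun w => kmean P k g (X 0%N w)).
  exact: measurableT_comp (lip_measurable (kmean_lip k K0 gK)) (mX 0%N).
(* Conditioning on the starting point, the expectation at time [k] is compared
   with the invariant mean; the error vanishes in the limit. *)
have step k : mg <= tau + kappa ^+ k * (A * (e0 + M)).
  rewrite -lee_fin.
  have -> : mg%:E = (\int[Pr]_w mg%:E)%E.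
    by rewrite integral_cst//= probability_setT mule1.
  apply: (@le_trans _ _ (\int[Pr]_w ((kmean P k g (X 0%N w))%:E +
      (A * kappa ^+ k)%:E * ((enorm (X 0%N w))%:E + M%:E)))%E).
    apply: ge0_le_integral => //.
    - apply/measurable_EFinP; apply: measurable_funD => //.
      by apply: measurable_funM => //; apply: measurable_funD.
    - move=> w _; rewrite -[leRHS]/((kmean P k g (X 0%N w) +
        A * kappa ^+ k * (enorm (X 0%N w) + M))%:E) lee_fin.
      rewrite -lerBlDl (_ : A * _ * _ =
        K * (D * kappa ^+ k) * (d%:R * (enorm (X 0%N w) + M))); last by rewrite /A; ring.
      apply: le_trans (kmean_ergodic k (X 0%N w) K0 gK g0).
      by rewrite distrC ler_norm.
  rewrite ge0_integralD//; last 4 first.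
  - by move=> w _; rewrite lee_fin Rintegral_ge0.
  - exact/measurable_EFinP.
  - by move=> w _; rewrite -[leRHS]/((A * kappa ^+ k * (enorm (X 0%N w) + M))%:E)
      lee_fin !mulr_ge0 ?exprn_ge0// addr_ge0 ?enorm_ge0 ?mu_enorm_ge0.
  - apply/measurable_EFinP; apply: measurable_funM => //; exact: measurable_funD.
  rewrite EFinD leeD//.
    have := chain_integral hX 0 k measurableT (lip_nnmeas gK g0).
    rewrite add0n preimage_setT => E.
    under eq_integral do rewrite (kmean_lipE _ _ gK).
    by rewrite -[X in (X <= _)%E]E; exact: gtau.
  rewrite ge0_integralZl//; last 3 first.
  - by apply/measurable_EFinP; exact: measurable_funD.
  - by move=> w _; rewrite -EFinD lee_fin addr_ge0 ?enorm_ge0 ?mu_enorm_ge0.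
  - by rewrite lee_fin mulr_ge0 ?exprn_ge0.
  rewrite ge0_integralD//; last 3 first.
  - by move=> w _; rewrite lee_fin enorm_ge0.
  - exact/measurable_EFinP.
  - by move=> w _; rewrite lee_fin mu_enorm_ge0.
  rewrite integral_cst//= probability_setT mule1 -[X in (X + _)%E](fineK X0fin) -/e0.
  by rewrite -EFinD -EFinM lee_fin mulrCA mulrA.
have cv : (tau + kappa ^+ k * (A * (e0 + M))) @[k --> \oo] --> tau + 0 * (A * (e0 + M)).
  apply: cvgD; first exact: cvg_cst.
  by apply: cvgMr_tmp; apply: cvg_expr; rewrite ger0_norm//; case/andP: hkappa.
by rewrite mul0r addr0 in cv; apply: (cvgr_to_ge cv); apply: nearW.
Qed.

End contraction.

(** * Variance of time averages *)

Section double_sums.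
Context {R : realType}.

Lemma sum_shift_le n i (F : nat -> R) : (forall k, 0 <= F k) ->
  \sum_(j < n | (i <= j)%N) F (j - i)%N <= \sum_(k < n) F k.
Proof.
move=> F0; rewrite -!(big_mkord (fun j => (i <= j)%N) (fun j => F (j - i)%N)).
rewrite -(big_mkord xpredT F).
have -> : \sum_(0 <= j < n | (i <= j)%N) F (j - i)%N = \sum_(i <= j < n) F (j - i)%N.
  by rewrite [RHS](@big_nat_widenl _ _ _ i 0)//.
rewrite -{1}[i]add0n big_addn.
under eq_bigr do rewrite addnK.
rewrite [leRHS](big_cat_nat (n := (n - i)%N))//= ?leq_subr//.
by rewrite lerDl sumr_ge0.
Qed.

Lemma double_sum_le n (a A : nat -> nat -> R) :
  (forall i k, 0 <= A i k) -> (forall i k, a i (i + k)%N <= A i k) ->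
  (forall i k, a (i + k)%N i <= A i k) ->
  \sum_(i < n) \sum_(j < n) a i j <= 2 * \sum_(i < n) \sum_(k < n) A i k.
Proof.
move=> A0 a1 a2.
apply: (@le_trans _ _ (\sum_(i < n) \sum_(j < n)
  ((if (i <= j)%N then A i (j - i)%N else 0) +
   (if (j <= i)%N then A j (i - j)%N else 0)))).
  apply: ler_sum => i _; apply: ler_sum => j _.
  case: leqP => ij; case: leqP => ji.
  - by rewrite ler_wpDr//; have := a1 i (j - i)%N; rewrite subnKC.
  - by rewrite addr0; have := a1 i (j - i)%N; rewrite subnKC.
  - by rewrite add0r; have := a2 j (i - j)%N; rewrite subnKC.
  - by have := ltn_trans ij ji; rewrite ltnn.
under eq_bigr do rewrite big_split/=.
rewrite big_split/= [X in _ + X <= _]exchange_big/= (_ : 2 = 1 + 1)// mulrDl mul1r.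
by apply: lerD; apply: ler_sum => i _; rewrite -big_mkcond; exact: sum_shift_le.
Qed.

End double_sums.

Lemma Rintegral_sum {disp} {S : measurableType disp} {R : realType}
    (m : {measure set S -> \bar R}) (I : Type) (s : seq I) (F : I -> S -> R) :
  (forall i, m.-integrable setT (EFin \o F i)) ->
  m.-integrable setT (EFin \o (fun x => \sum_(i <- s) F i x)) /\
  \int[m]_x (\sum_(i <- s) F i x) = \sum_(i <- s) \int[m]_x F i x.
Proof.
move=> iF; elim: s => [|i s [iS IH]].
  rewrite big_nil; under [X in m.-integrable _ (_ \o X)]eq_fun do rewrite big_nil.
  split; first exact: integrable0.
  under eq_Rintegral do rewrite big_nil.
  by rewrite /Rintegral integral0.
rewrite big_cons -IH -RintegralD//.
under [X in m.-integrable _ (_ \o X)]eq_fun do rewrite big_cons.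
split; first exact: (integrableD measurableT (iF i) iS).
by apply: eq_Rintegral => x _; rewrite big_cons.
Qed.

Section variance.
Context {R : realType} {d : nat} {disp : measure_display}
  {Omega : measurableType disp} {Pr : probability Omega R}.
Variables (P : R.-pker 'rV[R]_d ~> 'rV[R]_d) (X : nat -> {RV Pr >-> 'rV[R]_d}).
Hypothesis hX : markov_chain P X.

Let mX n : measurable_fun setT (X n). Proof. exact: measurable_funPT. Qed.

(** The covariance at lag [k] is bounded through the conditional mean [k] steps
    ahead, so the variance of the average is governed by the sum of the
    conditional means. *)
Lemma average_variance n (c : R) (h b : 'rV[R]_d -> R) :
  measurable_fun setT h -> (forall x, `|h x| <= c) ->
  measurable_fun setT b -> (forall x, \sum_(k < n) `|kmean P k h x| <= b x) ->
  (\int[Pr]_w (((n%:R)^-1 * \sum_(i < n) h (X i.+1 w)) ^+ 2)%:E <=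
   (2 / n%:R ^+ 2)%:E *
     \sum_(i < n) \int[Pr]_w (`|h (X i.+1 w)| * b (X i.+1 w))%:E)%E.
Proof.
move=> mh hc mb kb.
have c0 : 0 <= c by apply: le_trans (hc 0).
have mhX i : measurable_fun setT (fun w => h (X i w)) by exact: measurableT_comp.
have mkX i k : measurable_fun setT (fun w => kmean P k h (X i w)).
  exact: measurableT_comp (kmean_bounded_measurable P k mh hc) (mX i).
have bprod (u v : R) : `|u| <= c -> `|v| <= c -> `|u * v| <= c * c.
  by move=> ac bc; rewrite normrM ler_pM.
have kc k := kmean_bounded P k _ mh hc.
have ihh i j : Pr.-integrable setT (EFin \o (fun w => h (X i.+1 w) * h (X j.+1 w))).
  by apply: (@RV_bounded_integrable _ _ _ _ (c * c)); [exact: measurable_funM|move=> w; exact: bprod].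
have ihk i k : Pr.-integrable setT (EFin \o (fun w => `|h (X i.+1 w)| * `|kmean P k h (X i.+1 w)|)).
  apply: (@RV_bounded_integrable _ _ _ _ (c * c)).
    by apply: measurable_funM; apply: measurableT_comp.
  by move=> w; apply: bprod; rewrite normr_id.
pose a i j := \int[Pr]_w (h (X i.+1 w) * h (X j.+1 w)).
pose A i k := \int[Pr]_w (`|h (X i.+1 w)| * `|kmean P k h (X i.+1 w)|).
have A0 i k : 0 <= A i k by apply: Rintegral_ge0 => w _; rewrite mulr_ge0.
have a1 i k : a i (i + k)%N <= A i k.
  rewrite /a -addSn (chain_covariance hX _ _ mh hc).
  have ihk' : Pr.-integrable setT (EFin \o (fun w => h (X i.+1 w) * kmean P k h (X i.+1 w))).
    by apply: (@RV_bounded_integrable _ _ _ _ (c * c)); [exact: measurable_funM|move=> w; exact: bprod].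
  apply: le_trans (ler_norm _) _; apply: (le_trans (le_normr_Rintegral _ ihk')) => //.
  rewrite le_eqVlt; apply/orP; left; apply/eqP.
  by apply: eq_Rintegral => w _; rewrite normrM.
have a2 i k : a (i + k)%N i <= A i k.
  by rewrite /a; under eq_Rintegral do rewrite mulrC; exact: a1.
have E : ((n%:R : R)^-1) ^+ 2 * \sum_(i < n) \sum_(j < n) a i j =
    \int[Pr]_w (((n%:R)^-1 * \sum_(i < n) h (X i.+1 w)) ^+ 2).
  have [iS ES] := Rintegral_sum (index_enum 'I_n)
    (fun i : 'I_n => (Rintegral_sum (index_enum 'I_n) (fun j : 'I_n => ihh i j)).1).
  transitivity (\int[Pr]_w ((n%:R : R)^-1 ^+ 2 * \sum_(i < n) \sum_(j < n)
      (h (X i.+1 w) * h (X j.+1 w)))).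
    rewrite RintegralZl// ES; congr (_ * _); apply: eq_bigr => i _.
    by rewrite (Rintegral_sum _ (fun j : 'I_n => ihh i j)).2.
  apply: eq_Rintegral => w _; rewrite exprMn; congr (_ * _).
  by rewrite expr2 mulr_suml; apply: eq_bigr => i _; rewrite mulr_sumr.
have iY : Pr.-integrable setT (EFin \o
    (fun w => ((n%:R)^-1 * \sum_(i < n) h (X i.+1 w)) ^+ 2)).
  apply: (@RV_bounded_integrable _ _ _ _ ((n%:R^-1 * (n%:R * c)) ^+ 2)).
    apply: measurable_funX; apply: measurable_funM => //.
    exact: measurable_sum.
  move=> w; rewrite normrX lerXn2r ?nnegrE ?mulr_ge0 ?invr_ge0//.
  rewrite normrM ger0_norm ?invr_ge0// ler_wpM2l ?invr_ge0//.
  rewrite (le_trans (ler_norm_sum _ _ _))// mulr_natl -[X in _ *+ X]card_ord -sumr_const.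
  by apply: ler_sum => i _; exact: hc.
rewrite -[leLHS]fineK; last by apply: integrable_fin_num.
rewrite -[fine _]/(\int[Pr]_w (((n%:R)^-1 * \sum_(i < n) h (X i.+1 w)) ^+ 2)) -E.
apply: (@le_trans _ _ ((2 / n%:R ^+ 2 * \sum_(i < n) \sum_(k < n) A i k)%:E)).
  rewrite lee_fin exprVn [2 / _]mulrC -mulrA ler_wpM2l ?invr_ge0 ?exprn_ge0//.
  exact: double_sum_le.
rewrite EFinM lee_wpmul2l ?lee_fin ?divr_ge0 ?exprn_ge0//.
rewrite -sumEFin; apply: lee_sum => i _.
have [iS ES] := Rintegral_sum (index_enum 'I_n) (fun k : 'I_n => ihk i k).
rewrite -ES /Rintegral fineK; last exact: integrable_fin_num.
apply: ge0_le_integral => //.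
- by move=> w _; rewrite lee_fin sumr_ge0// => k _; rewrite mulr_ge0.
- by case/integrableP: iS.
- apply/measurable_EFinP; apply: measurable_funM.
    exact: measurableT_comp.
  exact: measurableT_comp.
- by move=> w _; rewrite lee_fin -mulr_sumr ler_wpM2l.
Qed.

End variance.

(** * Decay of correlations under a moment condition *)

Section geometric.
Context {R : realType}.

(** The tangent at one of a concave power. *)
Lemma powR_le_chord (k t : R) : 0 < k < 1 -> 0 < t <= 1 ->
  k `^ t <= 1 - t * (1 - k).
Proof.
move=> /andP[k0 k1] /andP[t0 t1].
rewrite /powR gt_eqF//; set u := ln k.
have ku : k = expR u by rewrite lnK.
have h1 := expR_ge1Dx ((1 - t) * u); have h2 := expR_ge1Dx (- (t * u)).
have e0 := expR_gt0 (t * u).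
have E1 : expR (t * u) * expR ((1 - t) * u) = k.
  by rewrite -expRD ku; congr expR; ring.
have E2 : expR (t * u) * expR (- (t * u)) = 1.
  by rewrite -expRD subrr expR0.
have : expR (t * u) * 1 <= expR (t * u) *
    (t * expR ((1 - t) * u) + (1 - t) * expR (- (t * u))).
  rewrite ler_pM2l//.
  have : t * (1 + (1 - t) * u) <= t * expR ((1 - t) * u) by rewrite ler_wpM2l// ltW.
  have : (1 - t) * (1 - t * u) <= (1 - t) * expR (- (t * u)).
    by rewrite ler_wpM2l// subr_ge0.
  by nra.
rewrite mulr1 mulrDr [X in _ <= X + _]mulrCA [X in _ <= _ + X]mulrCA E1 E2.
by lra.
Qed.

Lemma sum_geometric_le (z : R) n : 0 <= z < 1 -> \sum_(k < n) z ^+ k <= (1 - z)^-1.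
Proof.
move=> /andP[z0 z1]; have s0 : 0 < 1 - z by rewrite subr_gt0.
rewrite -[leRHS]mul1r ler_pdivlMr// mulrC.
have := subrX1 z n; have zn : 0 <= z ^+ n by rewrite exprn_ge0.
lra.
Qed.

(** Interpolates between the trivial bound and a small one. *)
Lemma min1_le_powR (y t : R) : 0 <= y -> 0 < t <= 1 -> Num.min 1 y <= y `^ t.
Proof.
move=> y0 /andP[t0 t1]; case: (leP 1 y) => [y1|/ltW y1].
  by rewrite -[leLHS](powRr0 y) ler_powR// ltW.
have [->|yn0] := eqVneq y 0; first exact: powR_ge0.
rewrite -[leLHS]powRr1//; apply: ger_powR => //.
by rewrite lt_neqAle eq_sym yn0 y0.
Qed.

End geometric.

(** The standing assumptions, for both moment conditions of the theorem at
    once: exponential moments enter here only through second moments. *)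
Record moment_chain {R : realType} {d : nat} {disp : measure_display}
    {Omega : measurableType disp} {Pr : probability Omega R}
    (D kappa q M : R) (P : R.-pker 'rV[R]_d ~> 'rV[R]_d)
    (X : nat -> {RV Pr >-> 'rV[R]_d}) (mu : probability 'rV[R]_d R) : Prop := {
  mc_markov : markov_chain P X;
  mc_kappa : 0 < kappa < 1;
  mc_P1 : forall n x, (0 < n)%N -> in_P1 (kiter P n x);
  mc_W1 : forall n x y, (0 < n)%N ->
    (W1 (kiter P n x) (kiter P n y) <= (D * kappa ^+ n * enorm (x - y))%:E)%E;
  mc_mu1 : in_P1 mu;
  mc_mu : invariant_measure P mu;
  mc_moment : forall n,
    (\int[Pr]_w ((1 + enorm (X n w)) `^ q)%:E <= M%:E)%E }.

Section level_estimate.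
Context {R : realType} {d : nat} {disp : measure_display}
  {Omega : measurableType disp} {Pr : probability Omega R}.
Variables (D kappa q M : R) (P : R.-pker 'rV[R]_d ~> 'rV[R]_d)
  (X : nat -> {RV Pr >-> 'rV[R]_d}) (mu : probability 'rV[R]_d R).
Hypotheses (mc : moment_chain D kappa q M P X mu) (hD : 1 <= D) (d_gt0 : (0 < d)%N)
  (hq : 1 < q <= 2) (M1 : 1 <= M).

Implicit Types (x y : 'rV[R]_d) (g : 'rV[R]_d -> R).

Let mX n : measurable_fun setT (X n). Proof. exact: measurable_funPT. Qed.
Let q1 : 1 < q. Proof. by case/andP: hq. Qed.
Let k01 : 0 < kappa < 1. Proof. exact: mc_kappa mc. Qed.

Lemma measurable_enorm_powR (a : R) :
  measurable_fun setT (fun x : 'rV[R]_d => (1 + enorm x) `^ a).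
Proof.
apply: (measurableT_comp (measurable_powR a)).
by apply: measurable_funD => //; exact: measurable_enorm.
Qed.

Lemma enorm_le_powR (a : R) (x : 'rV[R]_d) : 1 <= a -> enorm x <= (1 + enorm x) `^ a.
Proof.
move=> a1; have e1 : 1 <= 1 + enorm x by rewrite lerDl enorm_ge0.
rewrite (@le_trans _ _ ((1 + enorm x) `^ 1))//; last exact: ler_powR.
by rewrite powRr1 ?lerDr// (le_trans ler01).
Qed.

Lemma moment_le n (F : 'rV[R]_d -> R) : measurable_fun setT F ->
  (forall x, 0 <= F x <= (1 + enorm x) `^ q) ->
  (\int[Pr]_w (F (X n w))%:E <= M%:E)%E.
Proof.
move=> mF FM; apply: le_trans (mc_moment mc n).
apply: ge0_le_integral => //.
- by move=> w _; rewrite lee_fin; case/andP: (FM (X n w)).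
- by apply/measurable_EFinP; exact: measurableT_comp.
- by apply/measurable_EFinP; exact: measurableT_comp (measurable_enorm_powR q) (mX n).
- by move=> w _; rewrite lee_fin; case/andP: (FM (X n w)).
Qed.

(** The invariant law inherits the moment bound of the chain, tested on
    Lipschitz functions below the moment weight. *)
Lemma stationary_moment K g : 0 <= K -> lip_for K g ->
  (forall x, 0 <= g x <= (1 + enorm x) `^ q) -> \int[mu]_x g x <= M.
Proof.
move=> K0 gK gM; have [] := (mc_markov mc, mc_kappa mc).
move=> hX hk; apply: (stationary_le hX hD hk (mc_P1 mc) (mc_W1 mc) (mc_mu1 mc)
  (mc_mu mc) K0 gK).
- by move=> x; case/andP: (gM x).
- apply: (@le_lt_trans _ _ M%:E); last exact: ltry.
  apply: (moment_le 0 measurable_enorm) => x.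
  by rewrite enorm_ge0 enorm_le_powR// ltW.
- by move=> i; apply: moment_le => //; exact: lip_measurable gK.
Qed.

Lemma mu_enorm_le : \int[mu]_x enorm x <= M.
Proof.
apply: (@stationary_moment d%:R) => //; first exact: enorm_lip.
by move=> x; rewrite enorm_ge0 enorm_le_powR// ltW.
Qed.

Definition centered (g : 'rV[R]_d -> R) x := g x - \int[mu]_y g y.

Lemma mu_bounded (c : R) g : measurable_fun setT g -> (forall x, `|g x| <= c) ->
  `|\int[mu]_x g x| <= c.
Proof.
move=> mg gc; have m1 : mu setT = 1%E by case: (mc_mu1 mc).
have ig := bounded_integrable m1 mg gc.
apply: (le_trans (le_normr_Rintegral _ ig)) => //.
rewrite -[leRHS](Rintegral_cst1 c m1); apply: le_Rintegral => //.
- exact: integrable_norm.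
- exact: integrable_cst1.
Qed.

Lemma centered_bounded (c : R) g x : measurable_fun setT g ->
  (forall x, `|g x| <= c) -> `|centered g x| <= c + c.
Proof.
by move=> mg gc; rewrite (le_trans (ler_normB _ _))// lerD// mu_bounded.
Qed.

Lemma kmean_centered k (B K : R) g x : 0 <= K -> lip_for K g ->
  (forall x, `|g x| <= B) ->
  `|kmean P k (centered g) x| <=
    Num.min (2 * B) (K * (D * kappa ^+ k) * (d%:R * (enorm x + M))).
Proof.
move=> K0 gK gB; have mg := lip_measurable gK.
have B0 : 0 <= B by apply: le_trans (gB 0).
have m1 : mu setT = 1%E by case: (mc_mu1 mc).
rewrite le_min; apply/andP; split.
  apply: (@kmean_bounded _ _ P k (2 * B)).
    exact: measurable_funB.
  by move=> y; rewrite (_ : 2 * B = B + B) ?centered_bounded//; ring.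
rewrite /centered (kmean_shift P k (- \int[mu]_y g y) x mg gB).
pose f y := g y + B.
have f0 y : 0 <= f y by have := gB y; rewrite /f ler_norml; lra.
have fK : lip_for K f.
  by move=> y z; rewrite /f opprD addrACA subrr addr0.
have -> : kmean P k g x - \int[mu]_y g y = kmean P k f x - \int[mu]_y f y.
  rewrite (kmean_shift P k B x mg gB) RintegralD//.
  - by rewrite Rintegral_cst1//; ring.
  - exact: bounded_integrable m1 mg gB.
  - exact: integrable_cst1.
apply: (le_trans (kmean_ergodic hD k01 (mc_P1 mc) (mc_W1 mc) (mc_mu1 mc)
  (mc_mu mc) k x K0 fK f0)).
have D0 : 0 <= D by apply: le_trans hD.
have kk0 : 0 <= kappa ^+ k by rewrite exprn_ge0//; case/andP: k01 => /ltW.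
by rewrite ler_wpM2l ?mulr_ge0// ler_wpM2l// lerD2l mu_enorm_le.
Qed.

(** The moment of order [q] is shared between the spatial weights, of exponent
    [(1 + q) / 2], and the sums over the lags, of exponent [eta]. *)
Let eta := (q - 1) / 2.
Let eta01 : 0 < eta <= 1 / 2.
Proof. by rewrite /eta; case/andP: hq => *; apply/andP; split; lra. Qed.

Definition lag_bound (B : R) l (x : 'rV[R]_d) : R :=
  4 * B * (D * d%:R * (1 + M)) * (l.+1%:R / (eta * (1 - kappa))) *
  (1 + enorm x) `^ eta.

(** The conditional means at lag [k] are bounded by the power [eta / l.+1] of
    the Lipschitz estimate; this power turns the Lipschitz constant, of order
    [2 ^ l], into a bounded factor, at the price of a factor [l.+1] in the sum
    over the lags. *)
Lemma sum_kmean_centered n (B K : R) l g x : 0 <= B -> 0 <= K ->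
  lip_for K g -> (forall x, `|g x| <= B) -> K <= B * 2 ^+ l ->
  \sum_(k < n) `|kmean P k (centered g) x| <= lag_bound B l x.
Proof.
move=> B0 K0 gK gB KB.
have [e0 e1] : 0 < eta /\ eta <= 1 / 2 by apply/andP.
have [k0 k1] : 0 < kappa /\ kappa < 1 by apply/andP.
have D0 : 0 <= D by apply: le_trans hD.
have M0 : 0 <= M by apply: le_trans M1.
have d1 : 1 <= d%:R :> R by rewrite ler1n.
(* With this exponent, the power of [2 ^+ l] below is at most [2 `^ eta], while
   the geometric ratio stays away from one by a multiple of
   [(1 - kappa) / l.+1]. *)
pose t := eta / l.+1%:R.
have t0 : 0 < t by rewrite divr_gt0.
have tl : t <= eta by rewrite ler_pdivrMr// ler_peMr ?(ltW e0)// ler1n.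
have t01 : 0 < t <= 1 by rewrite t0/=; lra.
pose z := kappa `^ t.
have z0 : 0 <= z by exact: powR_ge0.
have zk := powR_le_chord k01 t01; rewrite -/z in zk.
have tk : 0 < t * (1 - kappa) by rewrite mulr_gt0// subr_gt0.
have xe0 := enorm_ge0 x.
pose A := D * d%:R * (1 + M).
have A1 : 1 <= A by rewrite /A !mulr_ege1// lerDl.
have A0 : 0 <= A by apply: le_trans A1.
pose p := (1 + enorm x) `^ eta.
have term k : `|kmean P k (centered g) x| <= 4 * B * A * p * z ^+ k.
  apply: (le_trans (kmean_centered k x K0 gK gB)).
  pose y := 2 ^+ l * A * kappa ^+ k * (1 + enorm x).
  have kk0 : 0 <= kappa ^+ k by rewrite exprn_ge0// ltW.
  have l0 : 0 <= 2 ^+ l :> R by rewrite exprn_ge0.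
  have y0 : 0 <= y by rewrite /y !mulr_ge0// addr_ge0.
  apply: (@le_trans _ _ (2 * B * Num.min 1 y)).
    have Uy : K * (D * kappa ^+ k) * (d%:R * (enorm x + M)) <= 2 * B * y.
      have a1 : D * kappa ^+ k * (d%:R * (enorm x + M)) <=
          A * kappa ^+ k * (1 + enorm x).
        rewrite /A (_ : D * _ * _ = D * d%:R * kappa ^+ k * (enorm x + M)); last by ring.
        rewrite (_ : D * d%:R * (1 + M) * _ * _ =
          D * d%:R * kappa ^+ k * ((1 + M) * (1 + enorm x))); last by ring.
        by rewrite ler_wpM2l ?mulr_ge0//; nra.
      have a0 : 0 <= D * kappa ^+ k * (d%:R * (enorm x + M)).
        by rewrite !mulr_ge0// addr_ge0.
      rewrite -mulrA (@le_trans _ _ (B * 2 ^+ l * (A * kappa ^+ k * (1 + enorm x))))//.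
        exact: ler_pM.
      rewrite (_ : B * _ * _ = B * y); last by rewrite /y; ring.
      rewrite -mulrA ler_peMl ?mulr_ge0//; lra.
    case: (leP 1 y) => _; first by rewrite mulr1 ge_min lexx.
    by rewrite ge_min Uy orbT.
  apply: (@le_trans _ _ (2 * B * y `^ t)).
    by rewrite ler_wpM2l ?mulr_ge0// min1_le_powR.
  have -> : y `^ t = (2 ^+ l) `^ t * A `^ t * z ^+ k * (1 + enorm x) `^ t.
    rewrite /y !powRM ?mulr_ge0 ?addr_ge0//; congr (_ * _ * _).
    by rewrite -powR_mulrn ?ltW// -powRrM mulrC powRrM powR_mulrn.
  have h1 : (2 ^+ l) `^ t <= 2 :> R.
    rewrite -powR_mulrn// -powRrM -[leRHS]powRr1// ler_powR ?ler1n//.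
    have lq1 : l%:R / l.+1%:R <= 1 :> R by rewrite ler_pdivrMr// mul1r ler_nat.
    by rewrite /t mulrCA; apply: (le_trans (ler_piMr (ltW e0) lq1)); lra.
  have h2 : A `^ t <= A.
    by rewrite -[leRHS]powRr1// ler_powR//; case/andP: t01.
  have h3 : (1 + enorm x) `^ t <= p by rewrite ler_powR// lerDl.
  have zk0 : 0 <= z ^+ k by rewrite exprn_ge0.
  have -> : 4 * B * A * p * z ^+ k = 2 * B * (2 * A * z ^+ k * p) by ring.
  rewrite ler_wpM2l ?mulr_ge0//.
  rewrite !ler_pM ?powR_ge0 ?mulr_ge0 ?powR_ge0//.
apply: (@le_trans _ _ (\sum_(k < n) 4 * B * A * p * z ^+ k)).
  by apply: ler_sum => k _.
rewrite -mulr_sumr /lag_bound -/p -/A.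
have sz : \sum_(k < n) z ^+ k <= l.+1%:R / (eta * (1 - kappa)).
  have z1 : z < 1 by apply: le_lt_trans zk _; rewrite ltrBlDr ltrDl.
  apply: (le_trans (sum_geometric_le _ _)); first by rewrite z0.
  have -> : l.+1%:R / (eta * (1 - kappa)) = (t * (1 - kappa))^-1.
    rewrite /t; field; rewrite addrC natr1 pnatr_eq0 /= subr_eq0 (gt_eqF e0).
    by rewrite gt_eqF.
  by rewrite lef_pV2 ?posrE ?subr_gt0//; lra.
rewrite [leRHS](_ : _ = 4 * B * A * p * (l.+1%:R / (eta * (1 - kappa)))).
  have p0 : 0 <= p by exact: powR_ge0.
  by apply: ler_wpM2l => //; do 3 (apply: mulr_ge0 => //).
by rewrite mulrAC.
Qed.

End level_estimate.

(** * Fluctuations at one scale *)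

(** With one interpolation node per coordinate the only basis polynomial is
    the constant one; thus products of hats inherit the Lipschitz bounds
    of the test functions. *)
Lemma prod_hat_testf {R : realType} d rad l (s : {ffun 'I_d -> tree l})
    (x : 'rV[R]_d) :
  \prod_i hat (local_coord rad s x i) = testf rad s [ffun=> @ord0 0] x.
Proof.
apply: eq_bigr => i _; rewrite /node_fun ffunE.
by have := @lag_sum1 R 1 (local_coord rad s x i) isT; rewrite big_ord1 => ->; rewrite mulr1.
Qed.

Lemma lip_for_sum {R : realType} d (I : Type) (s : seq I) (c K : I -> R)
    (g : I -> 'rV[R]_d -> R) : (forall i, 0 <= c i) ->
  (forall i, lip_for (K i) (g i)) ->
  lip_for (\sum_(i <- s) c i * K i) (fun x => \sum_(i <- s) c i * g i x).
Proof.
move=> c0 gK x y; rewrite -sumrB mulr_suml.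
apply: (le_trans (ler_norm_sum _ _ _)); apply: ler_sum => i _.
by rewrite -mulrBr normrM ger0_norm// -mulrA ler_wpM2l//; exact: gK.
Qed.

(** The term-by-term form of a weighted Cauchy-Schwarz inequality: when the
    sums of [w / v] and of [w * v * y ^+ 2] are at most [U] and [V],
    summation gives [Num.sqrt (U * V)]. Being pointwise and linear in
    [y ^+ 2], it can be integrated before summing. *)
Lemma sqrt_young {R : realType} (U V w v y : R) : 0 < U -> 0 < V -> 0 <= w -> 0 < v ->
  w * `|y| <= Num.sqrt (U * V) / 2 * ((w / v) / U + w * v * y ^+ 2 / V).
Proof.
move=> U0 V0 w0 v0.
set s := Num.sqrt (U * V).
have s0 : 0 < s by rewrite sqrtr_gt0 mulr_gt0.
have s2 : s ^+ 2 = U * V by rewrite sqr_sqrtr// ltW// mulr_gt0.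
have -> : s / 2 * (w / v / U + w * v * y ^+ 2 / V) =
    w / (2 * s) * (s ^+ 2 / U / v + v * (s ^+ 2 / V) * `|y| ^+ 2).
  rewrite real_normK ?num_real//; field.
  by rewrite !gt_eqF.
rewrite s2.
have -> : U * V / U / v + v * (U * V / V) * `|y| ^+ 2 = V / v + v * U * `|y| ^+ 2.
  by field; rewrite !gt_eqF.
have -> : w * `|y| = w / (2 * s) * (2 * s * `|y|) by field; rewrite gt_eqF.
rewrite ler_wpM2l ?divr_ge0 ?mulr_ge0 ?(ltW s0)//.
have : 0 <= (s / v - U * `|y|) ^+ 2 by exact: sqr_ge0.
have -> : (s / v - U * `|y|) ^+ 2 =
    U / v * (V / v + v * U * `|y| ^+ 2 - 2 * s * `|y|).
  by rewrite sqrrB expr_div_n s2; field; rewrite gt_eqF.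
by rewrite pmulr_rge0 ?divr_gt0// subr_ge0.
Qed.

Section level_deviation.
Context {R : realType} {d r : nat} {disp : measure_display}
  {Omega : measurableType disp} {Pr : probability Omega R}.
Variables (D kappa q M B CS : R) (P : R.-pker 'rV[R]_d ~> 'rV[R]_d)
  (X : nat -> {RV Pr >-> 'rV[R]_d}) (mu : probability 'rV[R]_d R) (i0 : 'I_d).
Hypotheses (mc : moment_chain D kappa q M P X mu) (hD : 1 <= D)
  (hq : 1 < q <= 2) (M1 : 1 <= M) (B1 : 1 <= B) (CS0 : 0 < CS).
Let a := (1 + q) / 2.
Hypothesis hB : forall rad l (s : {ffun 'I_d -> tree l}) (j : {ffun 'I_d -> 'I_r}) x,
    1 <= rad ->
    `|testf rad s j x| <= B * \prod_i hat (local_coord rad s x i) /\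
    forall y, `|testf rad s j x - testf rad s j y| <=
      B / mesh rad l * enorm (x - y).
Hypothesis hCS : forall rad l, 1 <= rad ->
    \sum_(s : {ffun 'I_d -> tree l}) prod_wt s / node_wt a rad (s i0) <=
    CS * (2 ^+ l) ^+ d.-1 * (1 + 2 ^+ l / rad).

Let mX n : measurable_fun setT (X n). Proof. exact: measurable_funPT. Qed.
Let d_gt0 : (0 < d)%N. Proof. exact: leq_ltn_trans (leq0n _) (ltn_ord i0). Qed.
Let B0 : 0 <= B. Proof. exact: le_trans B1. Qed.
Let M0 : 0 <= M. Proof. exact: le_trans M1. Qed.
Let q1 : 1 < q. Proof. by case/andP: hq. Qed.
Let NJ : R := #|{ffun 'I_d -> 'I_r}|%:R.

Variables (rad : R) (l : nat).
Hypothesis rad1 : 1 <= rad.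
Implicit Types (s : {ffun 'I_d -> tree l}) (j : {ffun 'I_d -> 'I_r}) (x : 'rV[R]_d).

Let v s := node_wt a rad (s i0).
Let v0 s : 0 < v s. Proof. exact: node_wt_gt0. Qed.

Lemma prod_wt_ge0 s : 0 <= prod_wt s :> R.
Proof. by apply: prodr_ge0 => i _; exact: wt_ge0. Qed.

Let wv0 s : 0 <= prod_wt s * v s.
Proof. by rewrite mulr_ge0 ?prod_wt_ge0// ltW. Qed.

Definition hat_prod s x : R := \prod_i hat (local_coord rad s x i).

Lemma hat_prod_ge0 s x : 0 <= hat_prod s x.
Proof. by apply: prodr_ge0 => i _; exact: hat_ge0. Qed.

Lemma testf_le_B s j x : `|testf rad s j x| <= B.
Proof.
have [h _] := hB s j x rad1; apply: (le_trans h).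
rewrite ler_piMr//; apply: prodr_ile1 => i _.
by rewrite hat_ge0 hat_le1.
Qed.

Lemma testf_lip s j : lip_for (B / mesh rad l) (testf rad s j).
Proof. by move=> x y; have [_] := hB s j x rad1; apply. Qed.

Let a_ge0 : 0 <= a. Proof. by have := q1; rewrite /a; lra. Qed.
Let a_le : a <= q. Proof. by have := q1; rewrite /a; lra. Qed.

(** A hat is nonzero only near its node, where its weight is at most
    [(1 + enorm x) `^ a], and the hats sum to at most one. *)
Lemma sum_weighted_hats x :
  \sum_s (prod_wt s * v s) * hat_prod s x <= (1 + enorm x) `^ a.
Proof.
apply: (@le_trans _ _ (\sum_(s : {ffun 'I_d -> tree l}) (\prod_i (wt (s i) * hat (local_coord rad s x i))) *
    (1 + enorm x) `^ a)).
  apply: ler_sum => s _; rewrite big_split/= -/(prod_wt s) -/(hat_prod s x).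
  rewrite -!mulrA ler_wpM2l ?prod_wt_ge0// mulrC.
  have [xs|] := leP `|local_coord rad s x i0| 1.
    by rewrite ler_wpM2l ?hat_prod_ge0// /v node_wt_le.
  move=> /ltW xs; rewrite (_ : hat_prod s x = 0) ?mul0r//.
  by rewrite /hat_prod (bigD1 i0)//= hat_eq0// mul0r.
by rewrite -mulr_suml sum_hats ler_piMl ?powR_ge0// cutoff_le1.
Qed.

(** The weighted sum of the hats is a Lipschitz function, so that the bound
    along the chain passes to the invariant law. *)
Lemma mu_sum_weighted_hats :
  \sum_s (prod_wt s * v s) * \int[mu]_x hat_prod s x <= M.
Proof.
have [B' B'1 hB'] := @testf_bounds R d 1.
have hl s : lip_for (B' / mesh rad l) (hat_prod s).
  by move=> x y; rewrite /hat_prod !prod_hat_testf; have [_] := hB' rad l s [ffun=> ord0] x rad1; apply.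
have B'0 : 0 <= B' / mesh rad l.
  by rewrite divr_ge0 ?(le_trans _ B'1)// ltW// mesh_gt0.
have ih s : mu.-integrable setT (EFin \o (fun x => (prod_wt s * v s) * hat_prod s x)).
  by apply: integrable_mulr; exact: lip_integrable (mc_mu1 mc) (hl s).
have -> : \sum_s (prod_wt s * v s) * \int[mu]_x hat_prod s x =
    \int[mu]_x \sum_s (prod_wt s * v s) * hat_prod s x.
  have [_ ->] := Rintegral_sum (index_enum {ffun 'I_d -> tree l}) ih.
  apply: eq_bigr => s _; rewrite RintegralZl//.
  exact: lip_integrable (mc_mu1 mc) (hl s).
apply: (stationary_moment mc hD hq (K := \sum_s (prod_wt s * v s) * (B' / mesh rad l))).
- by apply: sumr_ge0 => s _; exact: mulr_ge0.
- exact: lip_for_sum.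
- move=> x; apply/andP; split.
    by apply: sumr_ge0 => s _; rewrite mulr_ge0 ?hat_prod_ge0.
  apply: (le_trans (sum_weighted_hats x)); rewrite ler_powR// lerDl; exact: enorm_ge0.
Qed.

Lemma sum_weighted_tests x :
  \sum_(p : {ffun 'I_d -> tree l} * {ffun 'I_d -> 'I_r})
    (prod_wt p.1 * v p.1) * `|centered mu (testf rad p.1 p.2) x| <=
  NJ * (B * (1 + M)) * (1 + enorm x) `^ a.
Proof.
rewrite -(pair_bigA _ (fun s j => (prod_wt s * v s) *
   `|centered mu (testf rad s j) x|))/= exchange_big/=.
rewrite -mulrA mulr_natl /NJ -sumr_const; apply: ler_sum => j _.
have x1 : 1 <= (1 + enorm x) `^ a.
  by rewrite -[leLHS](powRr0 (1 + enorm x)) ler_powR// lerDl enorm_ge0.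
apply: (@le_trans _ _ (\sum_s (prod_wt s * v s) * (B * hat_prod s x +
   B * \int[mu]_y hat_prod s y))).
  apply: ler_sum => s _; rewrite ler_wpM2l// (le_trans (ler_normB _ _))// lerD//.
    by have [] := hB s j x rad1.
  have [B' B'1 hB'] := @testf_bounds R d 1.
  have hl : lip_for (B' / mesh rad l) (hat_prod s).
    by move=> y z; rewrite /hat_prod !prod_hat_testf; have [_] := hB' rad l s [ffun=> ord0] y rad1; apply.
  have ih := lip_integrable (mc_mu1 mc) hl.
  have it := lip_integrable (mc_mu1 mc) (testf_lip s j).
  apply: (le_trans (le_normr_Rintegral _ it)) => //.
  rewrite -RintegralZl//; apply: le_Rintegral => //.
  - exact: integrable_norm.
  - exact: integrable_mulr.
  - by move=> y _; have [] := hB s j y rad1.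
rewrite (eq_bigr (fun s => B * (prod_wt s * v s * hat_prod s x) +
  B * (prod_wt s * v s * \int[mu]_y hat_prod s y))); last by move=> s _; ring.
rewrite big_split/= -!mulr_sumr -mulrDr -mulrA ler_wpM2l//.
rewrite mulrDl mul1r lerD ?sum_weighted_hats// (le_trans mu_sum_weighted_hats)//.
by rewrite ler_peMr.
Qed.

Let T := ({ffun 'I_d -> tree l} * {ffun 'I_d -> 'I_r})%type.

Definition fluctuation n (p : T) (w : Omega) : R :=
  (n%:R)^-1 * \sum_(i < n) centered mu (testf rad p.1 p.2) (X i.+1 w).

Definition lag_const : R :=
  4 * B * (D * d%:R * (1 + M)) * (l.+1%:R / ((q - 1) / 2 * (1 - kappa))).

Let mtest (p : T) : measurable_fun setT (testf rad p.1 p.2 : 'rV[R]_d -> R).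
Proof. exact: lip_measurable (testf_lip p.1 p.2). Qed.

Let mcent (p : T) : measurable_fun setT (centered mu (testf rad p.1 p.2)).
Proof. exact: measurable_funB. Qed.

Let mY n p : measurable_fun setT (fluctuation n p).
Proof.
apply: measurable_funM => //; apply: measurable_sum => i.
exact: measurableT_comp (mcent p) (mX i.+1).
Qed.

Lemma lag_const_gt0 : 0 < lag_const.
Proof.
have [k0 k1] : 0 < kappa /\ kappa < 1 by apply/andP; exact: mc_kappa mc.
have q0 : 0 < (q - 1) / 2 by rewrite divr_gt0// subr_gt0.
have k10 : 0 < 1 - kappa by rewrite subr_gt0.
have D0 : 0 < D by apply: lt_le_trans hD.
have B00 : 0 < B by apply: lt_le_trans B1.
have d0 : 0 < d%:R :> R by rewrite ltr0n.
apply: mulr_gt0; last by rewrite divr_gt0// mulr_gt0.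
apply: mulr_gt0; first by rewrite mulr_gt0.
by apply: mulr_gt0; [exact: mulr_gt0|rewrite ltr_pwDl].
Qed.

Lemma lag_const_ge0 : 0 <= lag_const.
Proof. exact: ltW lag_const_gt0. Qed.

(** The weights are applied inside the expectation: for each time the weighted
    sum over the cells is controlled pointwise, because the cells overlap
    boundedly. *)
Lemma weighted_variance n : (0 < n)%N ->
  (\sum_(p : T) (prod_wt p.1 * v p.1)%:E *
     \int[Pr]_w ((fluctuation n p w) ^+ 2)%:E <=
   (2 / n%:R * (NJ * (B * (1 + M)) * lag_const * M))%:E)%E.
Proof.
move=> n0.
have nn0 : 0 < n%:R :> R by rewrite ltr0n.
pose b : 'rV[R]_d -> R := lag_bound D kappa q M B l.
have mb : measurable_fun setT b.
  by apply: measurable_funM => //; exact: measurable_enorm_powR.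
have b0 x : 0 <= b x by rewrite mulr_ge0 ?powR_ge0// -/lag_const lag_const_ge0.
pose G (p : T) i w := `|centered mu (testf rad p.1 p.2) (X i w)| * b (X i w).
have mG p i : measurable_fun setT (G p i).
  apply: measurable_funM; last exact: measurableT_comp.
  by apply: measurableT_comp => //; exact: measurableT_comp (mcent p) (mX i).
have G0 p i w : 0 <= G p i w by rewrite mulr_ge0.
have rad0 : 0 < rad by apply: lt_le_trans rad1.
have K0 : 0 <= B / mesh rad l by rewrite divr_ge0// ltW// mesh_gt0.
have KB : B / mesh rad l <= B * 2 ^+ l.
  rewrite ler_wpM2l// /mesh invfM invrK mulrC ler_piMr ?exprn_ge0//.
  by rewrite invf_le1.
have var p : (\int[Pr]_w ((fluctuation n p w) ^+ 2)%:E <=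
    (2 / n%:R ^+ 2)%:E * \sum_(i < n) \int[Pr]_w (G p i.+1 w)%:E)%E.
  have tB := testf_le_B p.1 p.2.
  apply: (@average_variance _ _ _ _ _ P X (mc_markov mc) n (B + B)
    (centered mu (testf rad p.1 p.2)) b) => //.
    by move=> x; apply: (centered_bounded mc) => //.
  by move=> x; exact: (sum_kmean_centered mc hD d_gt0 hq M1 n x B0 K0 (testf_lip p.1 p.2)).
apply: (@le_trans _ _ (\sum_(p : T) (prod_wt p.1 * v p.1)%:E *
   ((2 / n%:R ^+ 2)%:E * \sum_(i < n) \int[Pr]_w (G p i.+1 w)%:E))%E).
  by apply: lee_sum => p _; rewrite lee_wpmul2l ?lee_fin.
have IG0 p i : (0 <= \int[Pr]_w (G p i w)%:E)%E.
  by apply: integral_ge0 => w _; rewrite lee_fin.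
have -> : (\sum_(p : T) (prod_wt p.1 * v p.1)%:E *
   ((2 / n%:R ^+ 2)%:E * \sum_(i < n) \int[Pr]_w (G p i.+1 w)%:E) =
   (2 / n%:R ^+ 2)%:E * \sum_(i < n) \int[Pr]_w
     (\sum_(p : T) (prod_wt p.1 * v p.1) * G p i.+1 w)%:E)%E.
  under eq_bigr do rewrite muleCA ge0_sume_distrr//.
  rewrite -ge0_sume_distrr; last first.
    by move=> p _; apply: sume_ge0 => i _; rewrite mule_ge0// lee_fin.
  congr (_ * _)%E; rewrite exchange_big/=; apply: eq_bigr => i _.
  under [RHS]eq_integral do rewrite -sumEFin.
  rewrite ge0_integral_sum//.
  - apply: eq_bigr => p _; under [RHS]eq_integral do rewrite EFinM.
    by rewrite ge0_integralZl ?lee_fin//; [exact/measurable_EFinP|move=> w _; rewrite lee_fin].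
  - by move=> p; apply/measurable_EFinP; exact: measurable_funM.
  - by move=> p w _; rewrite lee_fin mulr_ge0.
have -> : 2 / n%:R * (NJ * (B * (1 + M)) * lag_const * M) =
    2 / n%:R ^+ 2 * \sum_(i < n) (NJ * (B * (1 + M)) * lag_const * M) :> R.
  by rewrite sumr_const card_ord -mulr_natl; field; rewrite gt_eqF.
rewrite [leRHS]EFinM lee_wpmul2l ?lee_fin ?divr_ge0 ?exprn_ge0// -sumEFin.
apply: lee_sum => i _.
set c := NJ * (B * (1 + M)) * lag_const.
have c0 : 0 <= c.
  apply: mulr_ge0; last exact: lag_const_ge0.
  by apply: mulr_ge0 => //; apply: mulr_ge0 => //; exact: addr_ge0.
apply: (@le_trans _ _ (\int[Pr]_w (c%:E * ((1 + enorm (X i.+1 w)) `^ q)%:E))%E).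
  apply: ge0_le_integral => //.
  - by move=> w _; rewrite lee_fin sumr_ge0// => p _; rewrite mulr_ge0.
  - apply/measurable_EFinP; apply: measurable_sum => p; exact: measurable_funM.
  - apply/measurable_EFinP; apply: measurable_funM => //.
    exact: measurableT_comp (measurable_enorm_powR q) (mX i.+1).
  - move=> w _; rewrite -EFinM lee_fin /G; set x := X i.+1 w.
    rewrite (eq_bigr (fun p : T => (prod_wt p.1 * v p.1) *
      `|centered mu (testf rad p.1 p.2) x| * b x)); last by move=> p _; rewrite mulrA.
    rewrite -mulr_suml.
    apply: (@le_trans _ _ (NJ * (B * (1 + M)) * (1 + enorm x) `^ a * b x)).
      by rewrite ler_wpM2r// sum_weighted_tests.
    have e1 : 1 + enorm x != 0 by rewrite gt_eqF// ltr_pwDl// enorm_ge0.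
    have qE : (1 + enorm x) `^ q = (1 + enorm x) `^ a * (1 + enorm x) `^ ((q - 1) / 2).
      by rewrite -powRD ?e1 ?implybT//; congr (_ `^ _); rewrite /a; field.
    rewrite qE /b /lag_bound -/lag_const /c le_eqVlt; apply/orP; left; apply/eqP.
    by ring.
rewrite ge0_integralZl//; last 2 first.
- apply/measurable_EFinP.
  exact: measurableT_comp (measurable_enorm_powR q) (mX i.+1).
- by move=> w _; rewrite lee_fin powR_ge0.
by rewrite [leRHS]EFinM lee_wpmul2l ?lee_fin//; exact: (mc_moment mc).
Qed.

Let U : R := NJ * (CS * (2 ^+ l) ^+ d.-1 * (1 + 2 ^+ l / rad)).

(** Cauchy-Schwarz over the cells. Thanks to the weights, [U] has order
    [2 ^+ (l * d.-1) * (1 + 2 ^+ l / rad)] instead of the number of cells,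
    of order [2 ^+ (l * d)]; when [d = 2 * r] the gain removes the square
    root of a logarithm from the final rate. *)
Lemma level_deviation n : (0 < n)%N -> (0 < r)%N ->
  (\int[Pr]_w (\sum_(p : T) prod_wt p.1 * `|fluctuation n p w|)%:E <=
   (Num.sqrt (U * (2 / n%:R * (NJ * (B * (1 + M)) * lag_const * M))))%:E)%E.
Proof.
move=> n0 r0; set V := 2 / n%:R * _.
have rad0 : 0 < rad by apply: lt_le_trans rad1.
have NJ0 : 0 < NJ by rewrite ltr0n card_ffun card_ord expn_gt0 r0.
have U0 : 0 < U.
  apply: mulr_gt0 => //; apply: mulr_gt0; first by rewrite mulr_gt0// !exprn_gt0.
  by rewrite ltr_pwDl// divr_ge0 ?exprn_ge0// ltW.
have V0 : 0 < V.
  apply: mulr_gt0; first by rewrite divr_gt0// ltr0n.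
  apply: mulr_gt0; last by apply: lt_le_trans M1.
  apply: mulr_gt0; last exact: lag_const_gt0.
  apply: mulr_gt0 => //; apply: mulr_gt0; first by apply: lt_le_trans B1.
  by rewrite ltr_pwDl.
set s := Num.sqrt (U * V).
have s0 : 0 <= s by exact: sqrtr_ge0.
have S1 : \sum_(p : T) prod_wt p.1 / v p.1 <= U.
  rewrite -(pair_bigA _ (fun s (j : {ffun 'I_d -> 'I_r}) => prod_wt s / v s))/=.
  under eq_bigr do rewrite sumr_const -[_ *+ _]mulr_natl.
  by rewrite -mulr_sumr -/NJ ler_wpM2l ?(ltW NJ0)// hCS.
pose c := s / 2 / V.
have c0 : 0 <= c by rewrite /c divr_ge0 ?divr_ge0// ltW.
pose F (p : T) w := (prod_wt p.1 * v p.1) * fluctuation n p w ^+ 2.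
have F0 p w : 0 <= F p w by rewrite mulr_ge0// sqr_ge0.
have mF p : measurable_fun setT (F p).
  by apply: measurable_funM => //; apply: measurable_funX; exact: mY.
apply: (@le_trans _ _ (\int[Pr]_w ((s / 2)%:E + c%:E * (\sum_(p : T) F p w)%:E))%E).
  apply: ge0_le_integral => //.
  - by move=> w _; rewrite lee_fin sumr_ge0// => p _; rewrite mulr_ge0// prod_wt_ge0.
  - apply/measurable_EFinP; apply: measurable_sum => p; apply: measurable_funM => //.
    by apply: measurableT_comp => //; exact: mY.
  - apply/measurable_EFinP; apply: measurable_funD => //.
    by apply: measurable_funM => //; exact: measurable_sum.
  - move=> w _; rewrite -EFinM -EFinD lee_fin.
    apply: (@le_trans _ _ (\sum_(p : T) s / 2 * (prod_wt p.1 / v p.1 / U +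
       prod_wt p.1 * v p.1 * fluctuation n p w ^+ 2 / V))).
      by apply: ler_sum => p _; apply: sqrt_young => //; exact: prod_wt_ge0.
    rewrite -mulr_sumr big_split/= -!mulr_suml mulrDr lerD//.
      by rewrite ler_piMr ?divr_ge0// ler_pdivrMr// mul1r.
    by rewrite /c le_eqVlt; apply/orP; left; apply/eqP; rewrite /F; ring.
have mS : measurable_fun setT (fun w => (\sum_(p : T) F p w)%:E).
  by apply/measurable_EFinP; exact: measurable_sum.
have S0 w : (0 <= (\sum_(p : T) F p w)%:E)%E by rewrite lee_fin sumr_ge0.
rewrite ge0_integralD//; last 3 first.
- by move=> w _; rewrite lee_fin divr_ge0.
- by move=> w _; rewrite mule_ge0// lee_fin.
- exact: measurable_funeM.
rewrite integral_cst//= probability_setT mule1 ge0_integralZl//.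
have -> : s%:E = ((s / 2)%:E + c%:E * V%:E)%E.
  by rewrite -EFinM -EFinD; congr EFin; rewrite /c; field; rewrite gt_eqF.
rewrite leeD// lee_wpmul2l ?lee_fin//; apply: le_trans (weighted_variance n0).
under eq_integral do rewrite -sumEFin.
rewrite ge0_integral_sum//; last 2 first.
- by move=> p; apply/measurable_EFinP; exact: mF.
- by move=> p w _; rewrite lee_fin; exact: F0.
apply: lee_sum => p _; under eq_integral do rewrite EFinM.
rewrite ge0_integralZl//.
- by apply/measurable_EFinP; apply: measurable_funX; exact: mY.
- by move=> w _; rewrite lee_fin sqr_ge0.
- by rewrite lee_fin.
Qed.

End level_deviation.

(** * Reduction to finitely many test functions *)

(** The integral of a nonnegative function is a supremum over the simple
    functions below it, hence monotone without measurability; this is what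
    allows integrating a supremum over an uncountable class. *)
Lemma le_integral_nonmeasurable {d} {T : measurableType d} {R : realType}
    (m : {measure set T -> \bar R}) (f g : T -> \bar R) :
  (forall x, 0 <= g x)%E -> (forall x, f x <= g x)%E ->
  (\int[m]_x f x <= \int[m]_x g x)%E.
Proof.
move=> g0 fg; rewrite integralE; apply: (@le_trans _ _ (\int[m]_x f^\+ x)%E).
  by rewrite geeDl// leeNl oppe0 integral_ge0// => x _; exact: funeneg_ge0.
rewrite !ge0_integralTE//.
apply: le_ereal_sup => _ [h hf <-]; exists h => // x.
by apply: (le_trans (hf x)); rewrite funeposE ge_max fg g0.
Qed.

Section empirical_measure.
Context {R : realType} {d : nat} {disp : measure_display}
  {Omega : measurableType disp} {Pr : probability Omega R}.
Implicit Types X : nat -> {RV Pr >-> 'rV[R]_d}.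

Definition average X n w (f : 'rV[R]_d -> R) : R :=
  (n%:R)^-1 * \sum_(i < n) f (X i.+1 w).

Lemma ge0_integral_empirical X n w (f : 'rV[R]_d -> \bar R) : nnmeas f ->
  (\int[empirical X n w]_x f x =
   (n%:R^-1)%:E * \sum_(i < n) f (X i.+1 w))%E.
Proof.
move=> [f0 mf]; rewrite ge0_integral_mscale//; congr (_ * _)%E.
rewrite ge0_integral_measure_sum//.
apply: eq_bigr => i _; rewrite integral_dirac//.
by rewrite diracT mul1e.
Qed.

Lemma integral_empirical X n w (f : 'rV[R]_d -> R) : measurable_fun setT f ->
  (\int[empirical X n w]_x (f x)%:E = (average X n w f)%:E)%E.
Proof.
move=> mf; rewrite integralE.
have mp : nnmeas (EFin \o f)^\+%E.
  by split; [move=> x; exact: funepos_ge0|exact/measurable_funepos/measurable_EFinP].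
have mn : nnmeas (EFin \o f)^\-%E.
  by split; [move=> x; exact: funeneg_ge0|exact/measurable_funeneg/measurable_EFinP].
rewrite (ge0_integral_empirical X n w mp) (ge0_integral_empirical X n w mn).
under eq_bigr do rewrite funeposE /= -EFin_max.
under [X in (_ - _ * X)%E]eq_bigr do rewrite funenegE /= -EFin_max.
rewrite !sumEFin -!EFinM -EFinB /average -mulrBr -sumrB; congr (_ * _)%:E.
apply: eq_bigr => i _; set a := f _.
by case: (leP a 0) => ?; case: (leP (- a) 0) => ?; lra.
Qed.

Lemma averageD X n w f g :
  average X n w (fun x => f x + g x) = average X n w f + average X n w g.
Proof. by rewrite /average big_split mulrDr. Qed.

Lemma averageZ X n w c f :
  average X n w (fun x => c * f x) = c * average X n w f.
Proof. by rewrite /average -mulr_sumr mulrCA. Qed.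

Lemma average_sum X n w (I : Type) (s : seq I) (f : I -> 'rV[R]_d -> R) :
  average X n w (fun x => \sum_(i <- s) f i x) = \sum_(i <- s) average X n w (f i).
Proof. by rewrite /average exchange_big mulr_sumr. Qed.

Lemma average_cst X n w c : (0 < n)%N -> average X n w (cst c) = c.
Proof.
move=> n0; rewrite /average/= sumr_const card_ord -[c *+ n]mulr_natl mulrA.
by rewrite mulVf ?mul1r// pnatr_eq0 -lt0n.
Qed.

End empirical_measure.

Section discrepancy.
Context {R : realType} {d : nat} {disp : measure_display}
  {Omega : measurableType disp} {Pr : probability Omega R}.
Variables (X : nat -> {RV Pr >-> 'rV[R]_d}) (mu : probability 'rV[R]_d R).
Hypothesis hmu1 : in_P1 mu.
Variables (n : nat) (n_gt0 : (0 < n)%N) (w : Omega).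
Implicit Types (f g : 'rV[R]_d -> R).

Definition discr f : R := \int[mu]_x f x - average X n w f.

Let m1 : mu setT = 1%E. Proof. by case: hmu1. Qed.

Lemma discrE f K : lip_for K f ->
  (\int[mu]_x (f x)%:E - \int[empirical X n w]_x (f x)%:E = (discr f)%:E)%E.
Proof.
move=> fK; rewrite integral_empirical; last exact: lip_measurable fK.
rewrite EFinB /Rintegral fineK//; apply: integrable_fin_num => //.
exact: lip_integrable hmu1 fK.
Qed.

Lemma discr_cst c : discr (cst c) = 0.
Proof. by rewrite /discr average_cst// Rintegral_cst1// subrr. Qed.

Lemma discrD f g : mu.-integrable setT (EFin \o f) ->
  mu.-integrable setT (EFin \o g) ->
  discr (fun x => f x + g x) = discr f + discr g.
Proof. by move=> fi gi; rewrite /discr RintegralD// averageD; ring. Qed.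

Lemma discr_sum (I : Type) (s : seq I) (c : I -> R) (f : I -> 'rV[R]_d -> R) :
  (forall i, mu.-integrable setT (EFin \o f i)) ->
  discr (fun x => \sum_(i <- s) c i * f i x) = \sum_(i <- s) c i * discr (f i).
Proof.
move=> fi; have cfi i : mu.-integrable setT (EFin \o (fun x => c i * f i x)).
  exact: integrable_mulr.
rewrite /discr (Rintegral_sum s cfi).2 average_sum -sumrB.
by apply: eq_bigr => i _; rewrite RintegralZl// averageZ mulrBr.
Qed.

Lemma discr_le f g : mu.-integrable setT (EFin \o f) ->
  mu.-integrable setT (EFin \o g) -> (forall x, `|f x| <= g x) ->
  `|discr f| <= \int[mu]_x g x + average X n w g.
Proof.
move=> fi gi fg; rewrite (le_trans (ler_normB _ _))// lerD//.
  apply: (le_trans (le_normr_Rintegral _ fi)) => //.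
  by apply: le_Rintegral => //; exact: integrable_norm.
rewrite /average normrM ger0_norm ?invr_ge0// ler_wpM2l ?invr_ge0//.
by rewrite (le_trans (ler_norm_sum _ _ _))//; apply: ler_sum.
Qed.

End discrepancy.

Section pathwise.
Context {R : realType} {d r : nat}.
Hypothesis r_gt0 : (0 < r)%N.

Definition tail (rad : R) (x : 'rV[R]_d) : R := Num.max 0 (enorm x - rad / 2).

Lemma tail_ge0 rad x : 0 <= tail rad x.
Proof. by rewrite /tail le_max lexx. Qed.

Lemma tail_lip rad : lip_for d%:R (tail rad).
Proof.
move=> x y; apply: (le_trans _ (enorm_lip x y)); rewrite /tail.
case: (leP 0 (enorm x - rad / 2)) => h1; case: (leP 0 (enorm y - rad / 2)) => h2;
  have := ler_norm (enorm x - enorm y); have := ler_norm (enorm y - enorm x);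
  rewrite (distrC (enorm y)) ler_norml => *; lra.
Qed.

(** The coefficients of the decomposition are bounded uniformly over the
    class, so taking absolute values term by term eliminates the supremum.
    The constant [f 0] does not contribute, both measures having total
    mass one. *)
Lemma pathwise_bound : exists2 C : R, 0 <= C &
  forall s rad L disp (Omega : measurableType disp) (Pr : probability Omega R)
    (X : nat -> {RV Pr >-> 'rV[R]_d}) (mu : probability 'rV[R]_d R) n w,
    (r <= s)%N -> 1 <= rad -> (0 < n)%N -> in_P1 mu ->
  (d_Cs1 s mu (empirical X n w) <=
   (C * (\sum_(l < L.+1) mesh rad l ^+ r *
      (\sum_(p : {ffun 'I_d -> tree l} * {ffun 'I_d -> 'I_r})
         prod_wt p.1 * `|fluctuation X mu rad n p w|) +
      (2 * mesh rad L ^+ r + \int[mu]_x tail rad x + average X n w (tail rad))))%:E)%E.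
Proof.
have [C C0 hC] := @multiscale_decomposition R d r r_gt0.
have [B B1 hB] := @testf_bounds R d r.
exists C => // s rad L disp Omega Pr X mu n w rs rad1 n0 hmu1.
apply: ge_ereal_sup => _ [f fs <-].
have [rs' s0] : (1 <= r <= s)%N /\ (0 < s)%N by rewrite r_gt0 rs (leq_trans r_gt0).
have fl := Cs1_lip s0 fs; have fa := Cs1_coord_approx fs rs'.
pose F x := f x - f 0.
have Fl : coord_lip F.
  by move=> x i t; rewrite /F opprD addrACA subrr addr0; exact: fl.
have Fa : coord_approx r F.
  move=> x i h h0; have [p sp hp] := fa x i h h0.
  exists (p - (f 0)%:P).
    rewrite (leq_trans (size_polyD _ _))// size_polyN geq_max sp size_polyC.
    by case: (f 0 != 0).
  move=> t th; rewrite hornerD hornerN hornerC /F opprB addrA subrK.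
  exact: hp.
have F0 : F 0 = 0 by rewrite /F subrr.
have [cb dec] := hC F rad Fa Fl F0 rad1.
have flip : lip_for d%:R f by move=> x y; exact: coord_lip_enorm.
have m1 : mu setT = 1%E by case: hmu1.
rewrite (discrE X hmu1 n w flip)/= lee_fin.
pose S l x := \sum_(p : {ffun 'I_d -> tree l} * {ffun 'I_d -> 'I_r})
  (prod_wt p.1 * coef rad F p.1 p.2) * testf rad p.1 p.2 x.
have SE l x : \sum_(s : {ffun 'I_d -> tree l}) prod_wt s *
   \sum_(j : {ffun 'I_d -> 'I_r}) coef rad F s j * testf rad s j x = S l x.
  rewrite /S -(pair_bigA _ (fun (s : {ffun 'I_d -> tree l}) (j : {ffun 'I_d -> 'I_r}) =>
    (prod_wt s * coef rad F s j) * testf rad s j x))/=.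
  by apply: eq_bigr => u _; rewrite mulr_sumr; apply: eq_bigr => j _; rewrite mulrA.
have ti l (u : {ffun 'I_d -> tree l}) (j : {ffun 'I_d -> 'I_r}) :
    mu.-integrable setT (EFin \o testf rad u j).
  apply: (@lip_integrable _ _ mu (B / mesh rad l)) => // x y.
  by have [_] := hB rad l u j x rad1; apply.
have Si l : mu.-integrable setT (EFin \o S l).
  by apply: (Rintegral_sum _ _).1 => p; apply: integrable_mulr.
pose E x := F x - \sum_(l < L.+1) 1 * S l x.
have Sum_i : mu.-integrable setT (EFin \o (fun x => \sum_(l < L.+1) 1 * S l x)).
  by apply: (Rintegral_sum _ _).1 => p; apply: integrable_mulr.
have fi : mu.-integrable setT (EFin \o f) := lip_integrable hmu1 flip.
have Fi : mu.-integrable setT (EFin \o F).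
  exact: (integrableB measurableT fi (integrable_cst1 (f 0) m1)).
have Ei : mu.-integrable setT (EFin \o E).
  exact: (integrableB measurableT Fi Sum_i).
have -> : discr X mu n w f = discr X mu n w E +
    \sum_(l < L.+1) 1 * discr X mu n w (S l).
  have fE : f = (fun x => (E x + \sum_(l < L.+1) 1 * S l x) + cst (f 0) x).
    by apply/funext => x; rewrite /E /F/= !subrK.
  rewrite {1}fE discrD//; last 2 first.
  - exact: (integrableD measurableT Ei Sum_i).
  - exact: integrable_cst1.
  by rewrite discr_cst// addr0 discrD// discr_sum.
have Eb x : `|E x| <= C * (mesh rad L ^+ r + tail rad x).
  apply: le_trans (dec L x); rewrite /E le_eqVlt; apply/orP; left; apply/eqP.
  by congr (`|_ - _|); apply: eq_bigr => l _; rewrite mul1r SE.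
have taili : mu.-integrable setT (EFin \o tail rad) := lip_integrable hmu1 (tail_lip rad).
have mti : mu.-integrable setT (EFin \o (fun x => mesh rad L ^+ r + tail rad x)).
  exact: (integrableD measurableT (integrable_cst1 (mesh rad L ^+ r) m1) taili).
rewrite (le_trans (ler_normD _ _))// addrC mulrDr lerD//.
  rewrite mulr_sumr (le_trans (ler_norm_sum _ _ _))//; apply: ler_sum => l _.
  rewrite mul1r /S discr_sum; last by move=> p; exact: ti.
  rewrite mulrA mulr_sumr (le_trans (ler_norm_sum _ _ _))//; apply: ler_sum => p _.
  have -> : discr X mu n w (testf rad p.1 p.2) = - fluctuation X mu rad n p w.
    rewrite /discr /average /fluctuation /centered sumrB sumr_const card_ord.
    rewrite mulrBr -[X in _ = - (_ - _ * X)]mulr_natl [X in _ = - (_ - X)]mulrA.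
    by rewrite mulVf ?mul1r ?opprB// pnatr_eq0 -lt0n.
  rewrite mulrN normrN !normrM (ger0_norm (prod_wt_ge0 _)) -mulrA mulrCA.
  by rewrite ler_wpM2r ?mulr_ge0 ?prod_wt_ge0.
apply: (le_trans (discr_le _ _ _ Ei (integrable_mulr C mti) Eb)).
rewrite RintegralZl// averageZ -mulrDr ler_wpM2l// RintegralD//; last exact: integrable_cst1.
rewrite averageD Rintegral_cst1//.
have := @average_cst _ _ _ _ _ X n w (mesh rad L ^+ r) n0.
rewrite /cst => ->; rewrite le_eqVlt; apply/orP; left; apply/eqP; ring.
Qed.

End pathwise.

(** * Expected discrepancy at a given radius and number of scales *)

Section core.
Context {R : realType} {d r : nat}.
Hypotheses (d_gt0 : (0 < d)%N) (r_gt0 : (0 < r)%N).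

(** Up to a constant, the expected contribution of one scale: the size of its
    coefficients times the square root of the effective number of cells,
    times the lag factor, over the effective sample size. *)
Definition level_rate (rad t : R) (l : nat) : R :=
  mesh rad l ^+ r *
  Num.sqrt ((2 ^+ l) ^+ d.-1 * (1 + 2 ^+ l / rad) * l.+1%:R / t).

(** The expectation of the pathwise bound. The tail under the invariant law is
    bounded by the tail along the chain. *)
Lemma expected_discrepancy (q M D : R) : 1 < q <= 2 -> 1 <= M -> 1 <= D ->
  exists2 C : R, 0 <= C &
  forall s kappa disp (Omega : measurableType disp) (Pr : probability Omega R)
    (P : R.-pker 'rV[R]_d ~> 'rV[R]_d) (X : nat -> {RV Pr >-> 'rV[R]_d})
    (mu : probability 'rV[R]_d R) rad L n tau,
    moment_chain D kappa q M P X mu -> (r <= s)%N -> 1 <= rad -> (0 < n)%N ->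
    (forall i, \int[Pr]_w (tail rad (X i w))%:E <= tau%:E)%E ->
  (\int[Pr]_w d_Cs1 s mu (empirical X n w) <=
   (C * (\sum_(l < L.+1) level_rate rad ((1 - kappa) * n%:R) l +
         mesh rad L ^+ r + tau))%:E)%E.
Proof.
move=> hq M1 hD; have [q1 q2] : 1 < q /\ q <= 2 by apply/andP.
have [C C0 hC] := @pathwise_bound R d r r_gt0.
have [B B1 hB] := @testf_bounds R d r.
have a1 : 1 < (1 + q) / 2 by rewrite ltr_pdivlMr//; lra.
pose i0 := Ordinal d_gt0.
have [CS' CS'0 hCS'] := sum_inv_wt i0 a1.
pose CS := CS' + 1.
have CS0 : 0 < CS by rewrite ltr_wpDl.
have hCS rad l : 1 <= rad ->
    \sum_(s : {ffun 'I_d -> tree l}) prod_wt s / node_wt ((1 + q) / 2) rad (s i0) <=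
    CS * (2 ^+ l) ^+ d.-1 * (1 + 2 ^+ l / rad).
  move=> rad1; apply: (le_trans (hCS' rad l rad1)).
  rewrite -!mulrA ler_wpM2r ?lerDl// mulr_ge0 ?exprn_ge0// addr_ge0//.
  by rewrite divr_ge0 ?exprn_ge0// (le_trans _ rad1).
pose NJ : R := #|{ffun 'I_d -> 'I_r}|%:R.
pose K := NJ * CS * (2 * (NJ * (B * (1 + M)) *
  (4 * B * (D * d%:R * (1 + M)) / ((q - 1) / 2)) * M)).
have K0 : 0 <= Num.sqrt K by exact: sqrtr_ge0.
exists (C * (Num.sqrt K + 2)); first by rewrite mulr_ge0 ?addr_ge0.
move=> s kappa disp Omega Pr P X mu rad L n tau mc rs rad1 n0 htau.
have [k0 k1] : 0 < kappa /\ kappa < 1 by apply/andP; exact: mc_kappa mc.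
have mX i : measurable_fun setT (X i) by exact: measurable_funPT.
have mesh0 l : 0 <= mesh rad l ^+ r by rewrite exprn_ge0// ltW// mesh_gt0.
have mtail : measurable_fun setT (tail rad : 'rV[R]_d -> R).
  exact: lip_measurable (tail_lip rad).
have tau0 : 0 <= tau.
  rewrite -lee_fin; apply: le_trans (htau 0%N); apply: integral_ge0 => w _.
  by rewrite lee_fin tail_ge0.
have Xfin : (\int[Pr]_w (enorm (X 0%N w))%:E < +oo)%E.
  apply: (@le_lt_trans _ _ M%:E); last exact: ltry.
  apply: (moment_le mc 0 measurable_enorm) => x.
  by rewrite enorm_ge0 enorm_le_powR// ltW.
have mutau : \int[mu]_x tail rad x <= tau.
  apply: (stationary_le (mc_markov mc) hD (mc_kappa mc) (mc_P1 mc) (mc_W1 mc)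
    (mc_mu1 mc) (mc_mu mc) (ler0n _ d) (tail_lip rad)) => //.
  exact: tail_ge0.
have mu0 : 0 <= \int[mu]_x tail rad x.
  by apply: Rintegral_ge0 => x _; exact: tail_ge0.
set t := (1 - kappa) * n%:R.
pose Z l w := \sum_(p : {ffun 'I_d -> tree l} * {ffun 'I_d -> 'I_r})
         prod_wt p.1 * `|fluctuation X mu rad n p w|.
have Z0 l w : 0 <= Z l w.
  by apply: sumr_ge0 => p _; rewrite mulr_ge0 ?prod_wt_ge0.
have mZ l : measurable_fun setT (Z l).
  apply: measurable_sum => p; apply: measurable_funM => //.
  apply: measurableT_comp => //.
  apply: measurable_funM => //; apply: measurable_sum => i.
  apply: (measurableT_comp _ (mX i.+1)); apply: measurable_funB => //.
  apply: (@lip_measurable _ _ (B / mesh rad l)) => x y.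
  by have [_] := hB rad l p.1 p.2 x rad1; apply.
have EZ l : (\int[Pr]_w (Z l w)%:E <=
    (Num.sqrt K * Num.sqrt ((2 ^+ l) ^+ d.-1 * (1 + 2 ^+ l / rad) * l.+1%:R / t))%:E)%E.
  apply: (le_trans (level_deviation mc hD hq M1 B1 CS0 hB hCS l rad1 n0 r_gt0)).
  have K00 : 0 <= K.
    have NJ0 : 0 <= NJ by [].
    have cs0 := ltW CS0; have b0 := le_trans ler01 B1; have m0 := le_trans ler01 M1.
    have dd0 := le_trans ler01 hD.
    have q10 : 0 <= q - 1 by rewrite subr_ge0 ltW.
    rewrite /K; move: (q - 1) q10 => q' q10.
    by do ?[apply: mulr_ge0|apply: addr_ge0|rewrite invr_ge0] => //.
  rewrite lee_fin -sqrtrM// le_eqVlt; apply/orP; left; apply/eqP; congr Num.sqrt.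
  rewrite /K -/NJ /lag_const /t; field.
  have rad0 : 0 < rad by apply: lt_le_trans rad1.
  by rewrite !subr_eq0 pnatr_eq0 -lt0n n0 !gt_eqF.
pose A w := average X n w (tail rad).
have A0 w : 0 <= A w.
  by rewrite mulr_ge0 ?invr_ge0// sumr_ge0// => i _; exact: tail_ge0.
have mA : measurable_fun setT A.
  apply: measurable_funM => //; apply: measurable_sum => i.
  exact: measurableT_comp.
have EA : (\int[Pr]_w (A w)%:E <= tau%:E)%E.
  have mti i : measurable_fun setT (fun w => (tail rad (X i w))%:E).
    by apply/measurable_EFinP; exact: measurableT_comp.
  have E : (\int[Pr]_w (A w)%:E = (n%:R^-1)%:E *
      \sum_(i < n) \int[Pr]_w (tail rad (X i.+1 w))%:E)%E.
    rewrite -ge0_integral_sum//; last by move=> i w _; rewrite lee_fin tail_ge0.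
    rewrite -ge0_integralZl//; last 2 first.
    - by apply: emeasurable_sum.
    - by move=> w _; apply: sume_ge0 => i _; rewrite lee_fin tail_ge0.
    by apply: eq_integral => w _; rewrite sumEFin -EFinM.
  have -> : tau%:E = ((n%:R^-1)%:E * \sum_(i < n) tau%:E)%E.
    rewrite sumEFin -EFinM sumr_const card_ord -(mulr_natl tau) mulrA.
    by rewrite mulVf ?mul1r// pnatr_eq0 -lt0n.
  rewrite E lee_wpmul2l ?lee_fin ?invr_ge0//.
  by apply: lee_sum => i _; exact: htau.
pose c0 := 2 * mesh rad L ^+ r + \int[mu]_x tail rad x.
have c00 : 0 <= c0 by rewrite /c0 addr_ge0// mulr_ge0.
pose G w := (\sum_(l < L.+1) (mesh rad l ^+ r)%:E * (Z l w)%:E)%E.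
have mG : measurable_fun setT G.
  by apply: emeasurable_sum => l; apply: measurable_funeM; exact/measurable_EFinP.
have G0 w : (0 <= G w)%E.
  by apply: sume_ge0 => l _; rewrite mule_ge0// lee_fin.
have mA' : measurable_fun setT (fun w => (c0%:E + (A w)%:E)%E).
  by apply/measurable_EFinP; exact: measurable_funD.
have A0' w : (0 <= c0%:E + (A w)%:E)%E by rewrite -EFinD lee_fin addr_ge0.
apply: (@le_trans _ _ (\int[Pr]_w (C%:E * (G w + (c0%:E + (A w)%:E)))%E)%E).
  apply: le_integral_nonmeasurable => w.
    by rewrite mule_ge0 ?lee_fin// adde_ge0.
  apply: (le_trans (hC s rad L _ _ _ X mu n w rs rad1 n0 (mc_mu1 mc))).
  have GE : G w = (\sum_(l < L.+1) mesh rad l ^+ r * Z l w)%:E by rewrite -sumEFin.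
  by rewrite EFinM lee_wpmul2l ?lee_fin// GE -!EFinD lee_fin.
rewrite ge0_integralZl//; last 2 first.
- exact: emeasurable_funD.
- by move=> w _; rewrite adde_ge0.
rewrite -mulrA EFinM lee_wpmul2l ?lee_fin//.
rewrite ge0_integralD// ge0_integralD//; last 2 first.
- by move=> w _; rewrite lee_fin.
- exact/measurable_EFinP.
rewrite integral_cst//= probability_setT mule1 ge0_integral_sum//; last 2 first.
- by move=> l; apply: measurable_funeM; exact/measurable_EFinP.
- by move=> l w _; rewrite mule_ge0// lee_fin.
apply: (@le_trans _ _ (\sum_(l < L.+1) (mesh rad l ^+ r)%:E * (Num.sqrt K *
    Num.sqrt ((2 ^+ l) ^+ d.-1 * (1 + 2 ^+ l / rad) * l.+1%:R / t))%:E +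
    (c0%:E + tau%:E))%E).
  apply: leeD; last exact: leeD.
  apply: lee_sum => l _; rewrite ge0_integralZl//.
  - by rewrite lee_wpmul2l ?lee_fin.
  - exact/measurable_EFinP.
  - by move=> w _; rewrite lee_fin.
  - by rewrite lee_fin.
rewrite (eq_bigr (fun l : 'I_L.+1 => (Num.sqrt K * level_rate rad t l)%:E)); last first.
  by move=> l _; rewrite -EFinM /level_rate mulrCA.
rewrite sumEFin -!EFinD lee_fin.
rewrite -mulr_sumr /c0.
have S0 : 0 <= \sum_(l < L.+1) level_rate rad t l.
  by apply: sumr_ge0 => l _; rewrite mulr_ge0 ?sqrtr_ge0.
have := mesh0 L; set S := \sum_(l < L.+1) _ in S0 *; set m := mesh rad L ^+ r => m0.
set k := Num.sqrt K in K0 *.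
have h1 : 0 <= k * (m + tau) by rewrite mulr_ge0// addr_ge0.
rewrite mulrDl !mulrDr; lra.
Qed.

End core.

Arguments level_rate {R} d r rad t l.

(** * Choice of the number of scales *)

Section asymptotics.
Context {R : realType}.

Lemma ln2_ge_half : 1 / 2 <= ln (2 : R).
Proof.
have := @le_ln1Dx R (- (1 / 2)); rewrite (_ : 1 + - (1 / 2) = 2^-1); last by field.
by rewrite lnV ?posrE// => h; have := h _; lra.
Qed.

(** The factor of the number of scales is absorbed by a geometric sequence of
    ratio less than one. *)
Lemma sqrt_scale_le l : Num.sqrt (2 * l.+1%:R / 2 ^+ l) <= 4 * (3 / 4) ^+ l :> R.
Proof.
have p0 : 0 <= 4 * (3 / 4) ^+ l :> R by rewrite mulr_ge0// exprn_ge0// divr_ge0.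
rewrite -[leRHS]ger0_norm// -sqrtr_sqr ler_wsqrtr//.
have h : l.+1%:R <= 8 * (9 / 8) ^+ l :> R.
  elim: l {p0} => [|l IH]; first by rewrite expr0; lra.
  rewrite exprS -natr1; have : 1 <= (9 / 8) ^+ l :> R by rewrite exprn_ege1//; lra.
  lra.
rewrite ler_pdivrMr ?exprn_gt0// exprMn -mulrA.
have -> : (3 / 4) ^+ l ^+ 2 * 2 ^+ l = (9 / 8) ^+ l :> R.
  by rewrite -exprM mulnC exprM -exprMn; congr (_ ^+ l); field.
by lra.
Qed.

Lemma sum_sqrt_scale_le L : \sum_(l < L) Num.sqrt (2 * l.+1%:R / 2 ^+ l) <= 16 :> R.
Proof.
apply: (@le_trans _ _ (\sum_(l < L) 4 * (3 / 4) ^+ l)).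
  by apply: ler_sum => l _; exact: sqrt_scale_le.
rewrite -mulr_sumr; have := @sum_geometric_le R (3 / 4) L.
have -> : (1 - 3 / 4)^-1 = 4 :> R by field.
by move=> /(_ _)/(ler_wpM2l (ler0n _ 4)) h; apply: (le_trans (h _)); lra.
Qed.

Lemma sum_sqrt_inv_scale_le L : \sum_(l < L.+1) Num.sqrt (1 / 2 ^+ (L - l)) <= 16 :> R.
Proof.
rewrite (reindex_inj rev_ord_inj)/=.
apply: le_trans (sum_sqrt_scale_le L.+1); apply: ler_sum => l _.
have lL : (l <= L)%N by rewrite -ltnS ltn_ord.
rewrite subSS subKn// ler_wsqrtr// ler_pM2r ?invr_gt0 ?exprn_gt0//.
have : 1 <= l.+1%:R :> R by rewrite ler1n.
by lra.
Qed.

Lemma level_rate_le d r (rad t : R) l : 1 <= rad -> 0 < t -> (0 < d)%N ->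
  level_rate d r rad t l <= rad ^+ r * (2 ^+ l) ^- r *
    Num.sqrt ((2 ^+ l) ^+ d * (2 * l.+1%:R) / t).
Proof.
move=> rad1 t0 d0; have rad0 : 0 < rad by apply: lt_le_trans rad1.
rewrite /level_rate /mesh expr_div_n ler_wpM2l ?divr_ge0 ?exprn_ge0 ?(ltW rad0)//.
rewrite ler_wsqrtr// ler_pM2r ?invr_gt0//.
have z1 : 1 <= 2 ^+ l :> R by rewrite exprn_ege1// ler1n.
have : 2 ^+ l / rad <= 2 ^+ l by rewrite ler_piMr ?invf_le1// (le_trans _ z1).
case: d d0 => // d' _ h /=; rewrite exprSr.
rewrite [leRHS](_ : _ = (2 ^+ l) ^+ d' * (2 * 2 ^+ l) * l.+1%:R); last by ring.
by rewrite ler_wpM2r// ler_wpM2l ?exprn_ge0//; lra.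
Qed.

Lemma sqrt_inv (t : R) : 0 < t -> Num.sqrt t^-1 = t `^ (- 2^-1).
Proof. by move=> t0; rewrite powRN powR12_sqrt ?ltW// sqrtrV// ltW. Qed.

Section rates.
Variables (d r : nat) (t rad : R).
Hypotheses (d_gt0 : (0 < d)%N) (r_gt0 : (0 < r)%N).
Hypotheses (t_ge : 1 <= ln t) (rad1 : 1 <= rad) (rad_ge : ln t <= rad).

Let t0 : 0 < t.
Proof. by rewrite ltNge; apply/negP => /ln0 h; move: t_ge; rewrite h; lra. Qed.

Let t1 : 1 <= t.
Proof.
by have := expR_ge1Dx (ln t); rewrite lnK ?posrE//; have := t_ge; lra.
Qed.

Let rad0 : 0 < rad. Proof. exact: lt_le_trans rad1. Qed.

Lemma Gamma_ge : t `^ (- 2^-1) <= Gamma d r t.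
Proof.
have p0 : 0 <= t `^ (- 2^-1) by exact: powR_ge0.
have r0 : 0 < r%:R :> R by rewrite ltr0n.
have d0 : 0 < d%:R :> R by rewrite ltr0n.
rewrite /Gamma; case: ifPn => [rd|_].
  have rdR : 2 * r%:R + 1 <= d%:R :> R by rewrite -natrM natr1 ler_nat.
  rewrite -[leLHS]mul1r ler_pM//.
    rewrite -[leLHS](powRr0 (ln t)) ler_powR//; have := divr_ge0 (ltW r0) (ltW d0); lra.
  rewrite ler_powR// lerN2 ler_pdivrMr//; lra.
case: ifPn => _; first by rewrite ler_peMl.
by rewrite ler_peMl// -[leLHS](powRr0 (ln t)) ler_powR// divr_ge0.
Qed.

Lemma exists_scale (y : R) : 1 <= y -> exists L : nat,
  2 ^+ L <= y /\ y < 2 ^+ L.+1 /\ L%:R <= 2 * ln y.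
Proof.
move=> y1; have y0 : 0 < y by apply: lt_le_trans y1.
pose m := Num.truncn y.
have my : m%:R <= y < m.+1%:R by apply: truncn_itv; exact: ltW.
have m0 : (0 < m)%N.
  by rewrite -ltnS -(ltr_nat R); case/andP: my => _; apply: le_lt_trans.
exists (trunc_log 2 m).
have /andP[h1 h2] := @trunc_log_bounds 2 m isT m0.
have e1 : 2 ^+ trunc_log 2 m <= y.
  by case/andP: my => my1 _; apply: le_trans my1; rewrite -natrX ler_nat.
split => //; split.
  by case/andP: my => _ my2; apply: (lt_le_trans my2); rewrite -natrX ler_nat.
have : ln (2 ^+ trunc_log 2 m) <= ln y by rewrite ler_ln ?posrE ?exprn_gt0.
rewrite lnXn// -(mulr_natl (ln 2)) => h; have := ln2_ge_half => h3.
have : (trunc_log 2 m)%:R * (1 / 2) <= (trunc_log 2 m)%:R * ln (2 : R).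
  by rewrite ler_wpM2l.
by lra.
Qed.

Lemma invX_sqrt (z x : R) k : 0 < z ->
  z ^- k * Num.sqrt x = Num.sqrt (x / z ^+ (2 * k)).
Proof.
move=> z0; have zk : 0 <= z ^- k by rewrite invr_ge0 exprn_ge0// ltW.
rewrite -{1}(ger0_norm zk) -sqrtr_sqr -sqrtrM ?sqr_ge0//; congr Num.sqrt.
by rewrite exprVn -exprM mulrC mulnC.
Qed.

Lemma sqrtD_le (x y : R) : 0 <= x -> 0 <= y ->
  Num.sqrt (x + y) <= Num.sqrt x + Num.sqrt y.
Proof.
move=> x0 y0; rewrite -[leRHS]ger0_norm ?addr_ge0 ?sqrtr_ge0// -sqrtr_sqr.
rewrite ler_wsqrtr// sqrrD !sqr_sqrtr//.
have : 0 <= Num.sqrt x * Num.sqrt y by rewrite mulr_ge0 ?sqrtr_ge0.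
by lra.
Qed.

Lemma mesh_small L : t < 2 ^+ L.+1 ->
  mesh rad L ^+ r <= 2 * (rad ^+ r * t `^ (- 2^-1)).
Proof.
move=> tL; have radr0 : 0 <= rad ^+ r by rewrite exprn_ge0// ltW.
rewrite /mesh expr_div_n mulrCA ler_wpM2l//.
have z1 : 1 <= 2 ^+ L :> R by rewrite exprn_ege1// ler1n.
have z0 : 0 < 2 ^+ L :> R by apply: lt_le_trans z1.
apply: (@le_trans _ _ ((2 ^+ L)^-1)).
  rewrite lef_pV2 ?posrE ?exprn_gt0//.
  by case: (r) r_gt0 => // r' _; rewrite exprS ler_peMr ?(ltW z0)// exprn_ege1.
apply: (@le_trans _ _ (2 * t^-1)).
  rewrite -[leRHS]invrK lef_pV2 ?posrE ?invr_gt0 ?mulr_gt0 ?invr_gt0//.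
  by rewrite invfM invrK mulrC ler_pdivrMr// mulrC -exprS ltW.
rewrite ler_wpM2l// -[leLHS]powR_inv1 ?(ltW t0)// ler_powR//; lra.
Qed.

(** Up to a constant, the sum over the scales is dominated by the coarsest one
    when [d < 2 * r], by the finest one when [d > 2 * r], and all scales
    contribute comparably when [d = 2 * r]. Accordingly [2 ^+ L] is of
    order [t `^ d%:R^-1] when [d > 2 * r], where the finest scale balances
    the truncation error, and of order [t] otherwise. *)
Lemma rate_bound : exists L : nat,
  \sum_(l < L.+1) level_rate d r rad t l + mesh rad L ^+ r <=
  (100 + 2 ^+ r) * (rad ^+ r * Gamma d r t).
Proof.
have radr0 : 0 <= rad ^+ r by rewrite exprn_ge0// ltW.
have G0 := Gamma_ge.
have G00 : 0 <= Gamma d r t by apply: le_trans G0; exact: powR_ge0.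
have two_r0 : 0 <= 2 ^+ r :> R by rewrite exprn_ge0.
have lt0 : 0 < ln t by have := t_ge; lra.
have z1 l : 1 <= 2 ^+ l :> R by rewrite exprn_ege1// ler1n.
have z0 l : 0 < 2 ^+ l :> R by apply: lt_le_trans (z1 l).
have ti0 : 0 <= t^-1 by rewrite invr_ge0 ltW.
have rG : rad ^+ r * t `^ (- 2^-1) <= rad ^+ r * Gamma d r t by rewrite ler_wpM2l.
have rG0 : 0 <= rad ^+ r * Gamma d r t by rewrite mulr_ge0.
have rG2 : 0 <= 2 ^+ r * (rad ^+ r * Gamma d r t) by rewrite mulr_ge0.
case: (ltngtP d (2 * r)%N) => hdr.
- have [L [_ [tL _]]] := exists_scale t1.
  exists L; have mL := mesh_small tL.
  have : \sum_(l < L.+1) level_rate d r rad t l <=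
      16 * (rad ^+ r * t `^ (- 2^-1)).
    apply: (@le_trans _ _ (\sum_(l < L.+1) Num.sqrt (2 * l.+1%:R / 2 ^+ l) *
        (rad ^+ r * t `^ (- 2^-1)))); last first.
      rewrite -mulr_suml ler_wpM2r ?mulr_ge0 ?powR_ge0//; exact: sum_sqrt_scale_le.
    apply: ler_sum => l _; apply: (le_trans (level_rate_le r l rad1 t0 d_gt0)).
    rewrite -mulrA [leRHS]mulrCA ler_wpM2l// invX_sqrt// -sqrt_inv// -sqrtrM; last first.
      by rewrite divr_ge0 ?mulr_ge0// ltW.
    rewrite ler_wsqrtr// mulrAC ler_wpM2r// ler_pdivrMr ?exprn_gt0//.
    rewrite [leLHS]mulrC -[leRHS]mulrA ler_wpM2l ?mulr_ge0// [leRHS]mulrC ler_pdivlMr//.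
    by rewrite -exprSr ler_weXn2l.
  lra.
- have dn0 : (0 < d)%N := d_gt0.
  have d0 : 0 < d%:R :> R by rewrite ltr0n.
  have d1 : 1 <= d%:R :> R by rewrite ler1n.
  pose y := t `^ d%:R^-1.
  have y1 : 1 <= y by rewrite -[leLHS](powRr0 t) ler_powR// invr_ge0.
  have lny : ln y <= ln t by rewrite ln_powR ler_piMl ?(ltW lt0)// invf_le1.
  have [L [Ly [yL Ln]]] := exists_scale y1.
  have y0 : 0 < y by apply: lt_le_trans y1.
  pose g := t `^ (- (r%:R / d%:R)).
  have g0 : 0 <= g by exact: powR_ge0.
  have gG : ln t * g <= Gamma d r t.
    rewrite /Gamma hdr ler_wpM2r// -[leLHS]powRr1 ?(ltW lt0)// ler_powR//.
    have rdR : 2 * r%:R + 1 <= d%:R :> R by rewrite -natrM natr1 ler_nat.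
    by have := divr_ge0 (ler0n R r) (ltW d0); lra.
  have gy : y ^- r = g.
    rewrite /g /y powRN -powR_mulrn ?powR_ge0// -powRrM mulrC //.
  have mL : mesh rad L ^+ r <= 2 ^+ r * (rad ^+ r * Gamma d r t).
    rewrite /mesh expr_div_n mulrCA ler_wpM2l//.
    apply: (@le_trans _ _ (2 ^+ r * g)).
      rewrite -gy ler_pdivlMr ?exprn_gt0// mulrC ler_pdivrMr ?exprn_gt0// -exprMn -exprS.
      by rewrite lerXn2r ?nnegrE ?(ltW y0) ?(ltW (z0 _)) ?(ltW yL).
    rewrite ler_wpM2l//; apply: le_trans gG; rewrite ler_peMl//; exact: t_ge.
  pose m := (d - 2 * r)%N.
  have m0 : (0 < m)%N by rewrite /m subn_gt0.
  have dm : d = (2 * r + m)%N by rewrite /m subnKC// ltnW.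
  pose Q := (2 ^+ L) ^+ m * (2 * L.+1%:R) / t.
  have Q0 : 0 <= Q by rewrite /Q !mulr_ge0 ?exprn_ge0.
  exists L.
  (* Going down from the finest scale, the squared contributions decrease at
     least geometrically. *)
  have S1 : \sum_(l < L.+1) level_rate d r rad t l <= 16 * (rad ^+ r * Num.sqrt Q).
    apply: (@le_trans _ _ (\sum_(l < L.+1) Num.sqrt (1 / 2 ^+ (L - l)) *
        (rad ^+ r * Num.sqrt Q))); last first.
      by rewrite -mulr_suml ler_wpM2r ?mulr_ge0 ?sqrtr_ge0// sum_sqrt_inv_scale_le.
    apply: ler_sum => l _; apply: (le_trans (level_rate_le r l rad1 t0 d_gt0)).
    have lL : (l <= L)%N by rewrite -ltnS.
    rewrite -mulrA [leRHS]mulrCA ler_wpM2l// invX_sqrt// -sqrtrM ?divr_ge0 ?exprn_ge0//.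
    rewrite ler_wsqrtr// {1}dm exprD -!mulrA mulrC -!mulrA mulVf ?mulr1 ?expf_neq0 ?gt_eqF//.
    have -> : 2 ^+ l ^+ m * (2 * (l.+1%:R / t)) = 2 ^+ l ^+ m * (2 * l.+1%:R / t) :> R.
      by rewrite -!mulrA.
    have -> : 1 * (2 ^- (L - l) * Q) = 2 ^- (L - l) * 2 ^+ L ^+ m * (2 * L.+1%:R / t) :> R.
      by rewrite mul1r /Q !mulrA.
    apply: ler_pM; rewrite ?exprn_ge0 ?mulr_ge0//; last first.
      by rewrite ler_wpM2r// ler_wpM2l// ler_nat.
    rewrite mulrC ler_pdivlMr// -[in leRHS](subnKC lL) exprD exprMn ler_wpM2l ?exprn_ge0//.
    by case: (m) m0 => // k _; rewrite exprS ler_peMr ?exprn_ege1 ?z1 ?(ltW (z0 _)) ?ler1n //.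
  have S2 : Num.sqrt Q <= 3 * (ln t * g).
    rewrite -[leRHS]ger0_norm ?mulr_ge0 ?(ltW lt0)// -sqrtr_sqr ler_wsqrtr//.
    have yg : y ^+ m / t = g ^+ 2.
      have yd : y ^+ d = t.
        by rewrite -powR_mulrn ?(ltW y0)// -powRrM mulVf ?gt_eqF// powRr1 ?(ltW t0).
      rewrite -yd dm exprD mulnC exprM -gy invfM mulrCA mulfV ?expf_neq0 ?gt_eqF//.
      by rewrite mulr1 exprVn.
    have Zy : 2 ^+ L ^+ m / t <= g ^+ 2.
      by rewrite -yg ler_wpM2r// lerXn2r ?nnegrE ?(ltW y0) ?(ltW (z0 L)).
    have -> : Q = 2 ^+ L ^+ m / t * (2 * L.+1%:R) by rewrite /Q; ring.
    have -> : (3 * (ln t * g)) ^+ 2 = g ^+ 2 * (9 * ln t ^+ 2) by ring.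
    apply: ler_pM => //; rewrite ?mulr_ge0 ?exprn_ge0//.
    have : ln t <= ln t ^+ 2 by rewrite expr2 ler_peMr// ltW.
    by rewrite -natr1; have := t_ge; lra.
  have S3 : rad ^+ r * Num.sqrt Q <= 3 * (rad ^+ r * Gamma d r t).
    rewrite mulrCA ler_wpM2l// (le_trans S2)// ler_wpM2l//.
  lra.
- have [L [_ [tL Ln]]] := exists_scale t1.
  exists L; have mL := mesh_small tL.
  have GE : Gamma d r t = ln t * t `^ (- 2^-1) by rewrite /Gamma hdr ltnn eqxx.
  pose c := rad ^+ r * t `^ (- 2^-1).
  have c0 : 0 <= c by rewrite mulr_ge0 ?powR_ge0.
  have cG : rad ^+ r * Gamma d r t = ln t * c by rewrite GE /c mulrCA.
  have : \sum_(l < L.+1) level_rate d r rad t l <= (16 + 2 * L.+1%:R) * c.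
    apply: (@le_trans _ _ (\sum_(l < L.+1) (Num.sqrt (2 * l.+1%:R / 2 ^+ l) + 2) * c)); last first.
      rewrite -mulr_suml ler_wpM2r// big_split/= lerD ?sum_sqrt_scale_le//.
      by rewrite sumr_const card_ord mulr_natr.
    apply: ler_sum => l _.
    have lL : l.+1%:R <= L.+1%:R :> R by rewrite ler_nat.
    have L3 : L.+1%:R <= 3 * rad :> R.
      by rewrite -natr1; have := t_ge; have := rad_ge; lra.
    rewrite /level_rate /mesh expr_div_n -[leLHS]mulrA /c [leRHS]mulrCA ler_wpM2l// invX_sqrt//.
    rewrite -sqrt_inv//.
    have -> : (2 ^+ l) ^+ d.-1 * (1 + 2 ^+ l / rad) * l.+1%:R / t / (2 ^+ l) ^+ (2 * r) =
        (l.+1%:R / 2 ^+ l + l.+1%:R / rad) * t^-1 :> R.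
      rewrite -hdr; case: (d) d_gt0 => // d' _ /=; rewrite [in LHS]exprS.
      field.
      by rewrite !expf_neq0 ?gt_eqF.
    rewrite sqrtrM ?addr_ge0 ?divr_ge0 ?(ltW rad0) ?(ltW (z0 l))//.
    rewrite ler_wpM2r ?sqrtr_ge0// (le_trans (sqrtD_le _ _)) ?divr_ge0 ?(ltW rad0) ?(ltW (z0 l))//.
    rewrite lerD//.
      rewrite ler_wsqrtr// ler_pM2r ?invr_gt0// ler_peMl//; lra.
    have -> : 2 = Num.sqrt (2 ^+ 2) :> R by rewrite sqrtr_sqr ger0_norm.
    rewrite ler_wsqrtr// ler_pdivrMr// [2 ^+ 2](_ : _ = 4); last by ring.
    have := rad0; lra.
  have : L.+1%:R * c <= 3 * (ln t * c).
    by rewrite mulrA ler_wpM2r// -natr1; have := t_ge; lra.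
  move=> h1 h2; rewrite cG; have h5 : (16 + 2 * L.+1%:R) * c = 16 * c + 2 * (L.+1%:R * c).
    by rewrite mulrDl mulrA.
  have h3 : c <= ln t * c by rewrite ler_peMl.
  have h4 : 0 <= 2 ^+ r * (ln t * c) by rewrite mulr_ge0// mulr_ge0// ltW.
  rewrite -/c in mL; rewrite mulrDl; lra.
Qed.

End rates.
End asymptotics.

(** * Asymptotics and moments *)

Section large_sample.
Context {R : realType}.

(** Powers of the logarithm are absorbed by writing [ln t] as
    [2 A / c] times the logarithm of [t `^ (c / (2 A))]. *)
Lemma ln_powR_le (A c : R) : 0 < A -> 0 < c ->
  exists T : R, forall t, T <= t -> ln t `^ A <= t `^ c.
Proof.
move=> A0 c0; pose K := (2 * A / c) `^ A; pose T := Num.max 1 (K `^ (2 / c)).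
have Ac0 : 0 < 2 * A / c by rewrite divr_gt0// mulr_gt0.
exists T => t; rewrite ge_max => /andP[t1 Kt].
have t0 : 0 < t by apply: lt_le_trans t1.
have lt0 : 0 <= ln t by rewrite ln_ge0.
have tc0 : 0 < t `^ (c / (2 * A)) by rewrite powR_gt0.
have h1 : ln t <= 2 * A / c * t `^ (c / (2 * A)).
  have := ltW (ln_sublinear tc0); rewrite ln_powR => /(ler_wpM2l (ltW Ac0)).
  apply: le_trans; rewrite le_eqVlt; apply/orP; left; apply/eqP; field.
  by rewrite !gt_eqF.
apply: (@le_trans _ _ ((2 * A / c * t `^ (c / (2 * A))) `^ A)).
  by rewrite ge0_ler_powR ?nnegrE ?(ltW A0)// mulr_ge0 ?powR_ge0 ?(ltW Ac0).
rewrite powRM ?(ltW Ac0) ?powR_ge0// -/K -powRrM.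
have -> : c / (2 * A) * A = c / 2 by field; rewrite gt_eqF.
have -> : t `^ c = t `^ (c / 2) * t `^ (c / 2).
  rewrite -powRD; last by rewrite (gt_eqF t0) implybT.
  by congr powR; field.
rewrite ler_wpM2r ?powR_ge0//.
have -> : K = (K `^ (2 / c)) `^ (c / 2).
  rewrite -powRrM (_ : 2 / c * (c / 2) = 1) ?powRr1 ?powR_ge0//.
  by field; rewrite gt_eqF.
by rewrite ge0_ler_powR ?nnegrE ?powR_ge0 ?(ltW t0)// divr_ge0// ltW.
Qed.

Lemma Gamma_form d r : (0 < d)%N -> (0 < r)%N -> exists A c : R,
  [/\ 0 < A, 0 < c & forall t, 1 <= ln t -> Gamma d r t = ln t `^ A * t `^ (- c)].
Proof.
move=> d_gt0 r_gt0.
have d0 : 0 < d%:R :> R by rewrite ltr0n.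
have r0 : 0 < r%:R :> R by rewrite ltr0n.
rewrite /Gamma; case: (boolP (2 * r < d)%N) => [rd|_].
  exists (d%:R - 2 * r%:R + r%:R / d%:R), (r%:R / d%:R); split => //; rewrite ?divr_gt0//.
  have rdR : 2 * r%:R + 1 <= d%:R :> R by rewrite -natrM natr1 ler_nat.
  by have := divr_gt0 r0 d0; lra.
case: (d == (2 * r)%N).
  exists 1, 2^-1; split => // t t1; rewrite powRr1//; lra.
by exists (d%:R / (2 * r%:R + 1)), 2^-1; split; rewrite ?divr_gt0// ?invr_gt0 ?addr_gt0 ?mulr_gt0.
Qed.

(** A power of [t] beats every power of its logarithm, so the radius
    [Gamma d r t `^ (- e^-1)] is at least [ln t] for large [t]. *)
Lemma Gamma_small d r (e : R) : (0 < d)%N -> (0 < r)%N -> 0 < e ->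
  exists T : R, forall t, T <= t -> 1 <= ln t /\ Gamma d r t <= ln t `^ (- e).
Proof.
move=> d0 r0 e0; have [A [c [A0 c0 GE]]] := Gamma_form d0 r0.
have [T hT] := @ln_powR_le (A + e) c (addr_gt0 A0 e0) c0.
exists (Num.max (expR 1) T) => t; rewrite ge_max => /andP[te Tt].
have t0 : 0 < t by apply: lt_le_trans te; exact: expR_gt0.
have l1 : 1 <= ln t by rewrite -[leLHS](expRK 1) ler_ln ?posrE ?expR_gt0.
split => //; rewrite GE// !powRN ler_pdivrMr ?powR_gt0// mulrC ler_pdivlMr ?powR_gt0//; last lra.
rewrite -powRD; first exact: hT.
by rewrite (_ : ln t == 0 = false) ?implybT// gt_eqF//; lra.
Qed.

End large_sample.

Section moments.
Context {R : realType} {disp : measure_display} {T : measurableType disp}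
  (Pr : probability T R).

Lemma integral_le_moment (Y h : T -> R) (a b : R) : 0 <= a -> 0 <= b ->
  measurable_fun setT Y -> (forall w, 0 <= Y w) -> (forall w, h w <= a + b * Y w) ->
  (\int[Pr]_w (Y w)%:E <= 1)%E -> (\int[Pr]_w (h w)%:E <= (a + b)%:E)%E.
Proof.
move=> a0 b0 mY Y0 hY Y1.
apply: (@le_trans _ _ (\int[Pr]_w (a%:E + b%:E * (Y w)%:E))%E).
  apply: le_integral_nonmeasurable => w.
    by rewrite adde_ge0// ?lee_fin// mulr_ge0.
  by rewrite -EFinM -EFinD lee_fin.
have mYE : measurable_fun setT (EFin \o Y) by exact/measurable_EFinP.
rewrite ge0_integralD//; last 2 first.
  by move=> w _; rewrite -EFinM lee_fin mulr_ge0.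
  by apply: (measurable_funeM b%:E mYE).
rewrite integral_cst//= probability_setT mule1 ge0_integralZl_EFin//.
  by rewrite EFinD leeD2l// -[leRHS]mule1 lee_wpmul2l.
by move=> w _; rewrite lee_fin.
Qed.

End moments.

(** * Pointwise moment inequalities *)

Section truncation.
Context {R : realType}.
Implicit Types (q beta x rho : R).

Lemma powR_moment_le q x : 1 < q -> 0 <= x ->
  (1 + x) `^ Num.min q 2 <= 4 + 4 * x `^ q.
Proof.
move=> q1 x0; set p := Num.min q 2.
have p0 : 0 <= p by rewrite /p le_min; lra.
have p2 : p <= 2 by rewrite /p ge_min lexx orbT.
have pq : p <= q by rewrite /p ge_min lexx.
have two_p : 2 `^ p <= 4 :> R.
  apply: (@le_trans _ _ (2 `^ 2)); first by rewrite ler_powR// ler1n.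
  by rewrite (powR_mulrn 2 (ler0n R 2)); lra.
have xq0 : 0 <= x `^ q by exact: powR_ge0.
case: (leP x 1) => x1.
  apply: (@le_trans _ _ (2 `^ p)); last lra.
  by rewrite ge0_ler_powR// ?nnegrE; lra.
apply: (@le_trans _ _ ((2 * x) `^ p)).
  by rewrite ge0_ler_powR// ?nnegrE; lra.
rewrite powRM//; have h : x `^ p <= x `^ q by rewrite ler_powR// ltW.
have : 2 `^ p * x `^ p <= 4 * x `^ q by rewrite ler_pM ?powR_ge0.
lra.
Qed.

(** Integrated, this and the exponential analogue are Markov's inequality for
    the truncated part. *)
Lemma excess_le_powR q rho x : 1 < q -> 0 < rho -> 0 <= x ->
  Num.max 0 (x - rho) <= rho `^ (1 - q) * x `^ q.
Proof.
move=> q1 r0 x0; have p0 : 0 <= rho `^ (1 - q) * x `^ q by rewrite mulr_ge0 ?powR_ge0.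
rewrite ge_max p0/=; case: (leP x rho) => xr; first by apply: le_trans p0; lra.
have x1 : 0 < x by lra.
apply: (@le_trans _ _ x); first lra.
have xE : x `^ (1 - q) * x `^ q = x.
  by rewrite -powRD ?(gt_eqF x1) ?implybT// subrK powRr1// ltW.
rewrite -[leLHS]xE.
rewrite ler_wpM2r ?powR_ge0//.
rewrite (_ : 1 - q = - (q - 1)); last by ring.
rewrite !powRN lef_pV2 ?posrE ?powR_gt0// ge0_ler_powR ?nnegrE; lra.
Qed.

Lemma expR_moment_le beta x : 0 < beta -> 0 <= x ->
  (1 + x) `^ 2 <= 2 + 4 / beta ^+ 2 * (expR (beta * x) - 1).
Proof.
move=> b0 x0; rewrite -[2 in X in X <= _]/(2%:R) powR_mulrn ?addr_ge0//.
have := @expR_ge1Dxn R (beta * x) 1 (mulr_ge0 (ltW b0) x0).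
rewrite (_ : 2`! = 2)%N// exprMn => h.
have bb : 0 < beta ^+ 2 by rewrite exprn_gt0.
have : x ^+ 2 <= 2 / beta ^+ 2 * (expR (beta * x) - 1).
  rewrite mulrAC ler_pdivlMr//; lra.
have : 0 <= (1 - x) ^+ 2 by exact: sqr_ge0.
lra.
Qed.

Lemma excess_le_expR beta rho x : 0 < beta -> 0 <= rho -> 0 <= x ->
  Num.max 0 (x - rho) <= beta^-1 * expR (- (beta * rho)) * (expR (beta * x) - 1).
Proof.
move=> b0 r0 x0.
have e0 : 0 <= expR (beta * x) - 1.
  by have := expR_ge1Dx (beta * x); have := mulr_ge0 (ltW b0) x0; lra.
rewrite ge_max mulr_ge0 ?mulr_ge0 ?invr_ge0 ?expR_ge0 ?(ltW b0)//=.
rewrite -mulrA ler_pdivlMl//.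
have := expR_ge1Dx (beta * (x - rho)); rewrite mulrBr expRD => h.
have h2 : expR (- (beta * rho)) <= 1 by rewrite -[leRHS]expR0 ler_expR oppr_le0 mulr_ge0// ltW.
rewrite mulrBr mulr1 [X in _ <= X - _]mulrC; lra.
Qed.

End truncation.

(** * Choice of the truncation radius *)

Section rates_of_convergence.
Context {R : realType} {d : nat}.

(** The radius remains to be chosen: the first term grows with it, the tail
    decreases. It has to be at least [ln t] for the bound over the scales. *)
Lemma tail_tradeoff r (d_gt0 : (0 < d)%N) (r_gt0 : (0 < r)%N) (q M D : R) :
  1 < q <= 2 -> 1 <= M -> 1 <= D -> exists2 C, 0 <= C &
  forall s kappa (disp : measure_display) (Omega : measurableType disp)
    (Pr : probability Omega R) P (X : nat -> {RV Pr >-> 'rV[R]_d}) mu rad n tau,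
  moment_chain D kappa q M P X mu -> (r <= s)%N -> 1 <= rad ->
  1 <= ln ((1 - kappa) * n%:R) -> ln ((1 - kappa) * n%:R) <= rad ->
  (forall i, \int[Pr]_w (tail rad (X i w))%:E <= tau%:E)%E ->
  (\int[Pr]_w d_Cs1 s mu (empirical X n w) <=
    (C * (rad ^+ r * Gamma d r ((1 - kappa) * n%:R) + tau))%:E)%E.
Proof.
move=> hq M1 D1; have [C C0 hC] := @expected_discrepancy R d r d_gt0 r_gt0 q M D hq M1 D1.
have K1 : 1 <= 100 + 2 ^+ r :> R.
  by have := exprn_ge0 r (ler0n R 2); lra.
exists (C * (100 + 2 ^+ r)); first by rewrite mulr_ge0//; lra.
move=> s kappa disp Omega Pr P X mu rad n tau mc rs rad1 t1 trad htau.
have n0 : (0 < n)%N by case: (n) t1 => //; rewrite mulr0 ln0//; lra.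
have [L hL] := rate_bound d_gt0 r_gt0 t1 rad1 trad.
apply: (le_trans (hC s kappa disp Omega Pr P X mu rad L n tau mc rs rad1 n0 htau)).
have tau0 : 0 <= tau.
  rewrite -lee_fin; apply: le_trans (htau 0%N).
  by apply: integral_ge0 => w _; rewrite lee_fin tail_ge0.
rewrite lee_fin -mulrA ler_wpM2l// mulrDr lerD// ler_peMl//.
Qed.

Lemma near_large_sample (kappa T : R) : 0 < kappa < 1 ->
  \forall n \near \oo, T <= (1 - kappa) * n%:R.
Proof.
move=> /andP[_ k1]; have k0 : 0 < 1 - kappa by rewrite subr_gt0.
near=> n; rewrite -ler_pdivrMl//; near: n; exact: nbhs_infty_ger.
Unshelve. all: by end_near. Qed.

(** The tail has order [rad `^ (1 - q)], which equals [rad ^+ r * Gamma d r t]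
    for [rad = Gamma d r t `^ (- (q + r%:R - 1)^-1)]. *)
Lemma power_rate r (d_gt0 : (0 < d)%N) (r_gt0 : (0 < r)%N) (q D : R) :
  1 < q -> 1 <= D -> exists2 C, 0 <= C &
  forall s kappa (disp : measure_display) (Omega : measurableType disp)
    (Pr : probability Omega R) P (X : nat -> {RV Pr >-> 'rV[R]_d}) mu,
  moment_chain D kappa (Num.min q 2) 8 P X mu -> (r <= s)%N ->
  (forall i, \int[Pr]_w (enorm (X i w) `^ q)%:E <= 1)%E ->
  \forall n \near \oo, (\int[Pr]_w d_Cs1 s mu (empirical X n w) <=
    (C * Gamma d r ((1 - kappa) * n%:R) `^ ((q - 1) / (q + r%:R - 1)))%:E)%E.
Proof.
move=> q1 D1; have r0 : 1 <= r%:R :> R by rewrite ler1n.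
have hq : 1 < Num.min q 2 <= 2 by rewrite lt_min ge_min lexx orbT; lra.
have [|C C0 hC] := tail_tradeoff d_gt0 r_gt0 hq _ D1 (M := 8); first lra.
pose e := q + r%:R - 1; have e0 : 0 < e by rewrite /e; lra.
exists (C * (1 + 2 `^ (q - 1))); first by rewrite mulr_ge0// addr_ge0// powR_ge0.
move=> s kappa disp Omega Pr P X mu mc rs hm.
have [T hT] := Gamma_small d_gt0 r_gt0 e0.
apply: filterS (near_large_sample T (mc_kappa mc)) => n /hT [t1 Gs].
set t := (1 - kappa) * n%:R in t1 Gs *; set G := Gamma d r t in Gs *.
have t0 : 0 < t by rewrite ltNge; apply/negP => /ln0 h; move: t1; rewrite h; lra.
have G0 : 0 < G by apply: lt_le_trans (Gamma_ge d_gt0 r_gt0 t1); rewrite powR_gt0.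
pose rad := G `^ (- e^-1).
have radt : ln t <= rad.
  have -> : ln t = (ln t `^ (- e)) `^ (- e^-1).
    by rewrite -powRrM mulrNN mulfV ?gt_eqF// powRr1//; lra.
  rewrite /rad ![_ `^ (- e^-1)]powRN lef_pV2 ?posrE ?powR_gt0//; last lra.
  by rewrite ge0_ler_powR ?nnegrE ?powR_ge0 ?invr_ge0 ?(ltW e0) ?(ltW G0).
have rad1 : 1 <= rad by apply: le_trans radt.
have rad0 : 0 < rad by apply: lt_le_trans rad1.
have radE : rad `^ (1 - q) = G `^ ((q - 1) / e).
  by rewrite /rad -powRrM; congr powR; rewrite mulNr -mulrN opprB mulrC.
have -> : C * (1 + 2 `^ (q - 1)) * G `^ ((q - 1) / (q + r%:R - 1)) =
    C * (rad ^+ r * G + (rad / 2) `^ (1 - q)).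
  rewrite -mulrA; congr (C * _); rewrite mulrDl mul1r -/e -radE; congr (_ + _).
    have -> : G = rad `^ (- e).
      by rewrite /rad -powRrM mulrNN mulVf ?gt_eqF// powRr1 ?ltW.
    rewrite -powR_mulrn ?(ltW rad0)// -powRD; last by rewrite (gt_eqF rad0) implybT.
    by congr powR; rewrite /e; ring.
  rewrite powRM ?(ltW rad0) ?invr_ge0// mulrC; congr (_ * _).
  by rewrite -powR_inv1// -powRrM; congr powR; ring.
apply: (hC s kappa disp Omega Pr P X mu rad n _ mc rs rad1 t1 radt) => i.
rewrite -[X in X%:E]add0r.
have mX : measurable_fun setT (X i) by exact: measurable_funPT.
apply: (integral_le_moment (Y := fun w => enorm (X i w) `^ q)) => //.
- by rewrite powR_ge0.
- apply: (measurableT_comp (measurable_powR q)).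
  by apply: measurableT_comp mX; exact: measurable_enorm.
- by move=> w; exact: powR_ge0.
- by move=> w; rewrite add0r; apply: excess_le_powR => //; rewrite ?divr_gt0 ?sqrtr_ge0.
Qed.

(** A radius proportional to [ln t], with a factor at least [beta^-1], makes
    the tail at most of order [t `^ (- 2^-1)], hence of order
    [Gamma d r t]. *)
Lemma exponential_rate r (d_gt0 : (0 < d)%N) (r_gt0 : (0 < r)%N) (beta D : R) :
  0 < beta -> 1 <= D -> exists2 C, 0 <= C &
  forall s kappa (disp : measure_display) (Omega : measurableType disp)
    (Pr : probability Omega R) P (X : nat -> {RV Pr >-> 'rV[R]_d}) mu,
  moment_chain D kappa 2 (2 + 4 / beta ^+ 2) P X mu -> (r <= s)%N ->
  (forall i, \int[Pr]_w (expR (beta * enorm (X i w)) - 1)%:E <= 1)%E ->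
  \forall n \near \oo, (\int[Pr]_w d_Cs1 s mu (empirical X n w) <=
    (C * ln ((1 - kappa) * n%:R) ^+ r * Gamma d r ((1 - kappa) * n%:R))%:E)%E.
Proof.
move=> b0 D1.
have hq : 1 < (2 : R) <= 2 by apply/andP; split; lra.
have M1 : 1 <= 2 + 4 / beta ^+ 2.
  by have : 0 <= 4 / beta ^+ 2; [rewrite divr_ge0// exprn_ge0// ltW | lra].
have [C C0 hC] := tail_tradeoff d_gt0 r_gt0 hq M1 D1.
pose b := Num.max 1 beta^-1.
have b1 : 1 <= b by rewrite /b le_max lexx.
have bb : 1 <= beta * b by rewrite -ler_pdivrMl// mulr1 /b le_max lexx orbT.
exists (C * (b ^+ r + beta^-1)).
  by rewrite mulr_ge0// addr_ge0 ?invr_ge0 ?(ltW b0)// exprn_ge0//; lra.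
move=> s kappa disp Omega Pr P X mu mc rs hm.
apply: filterS (near_large_sample (expR 1) (mc_kappa mc)) => n.
set t := (1 - kappa) * n%:R => te.
have t0 : 0 < t by apply: lt_le_trans te; exact: expR_gt0.
have t1 : 1 <= ln t by rewrite -[leLHS](expRK 1) ler_ln ?posrE ?expR_gt0.
set G := Gamma d r t; have G1 : t `^ (- 2^-1) <= G := Gamma_ge d_gt0 r_gt0 t1.
have lr1 : 1 <= ln t ^+ r by rewrite exprn_ege1.
have G0 : 0 <= G by apply: le_trans G1; exact: powR_ge0.
pose rad := b * ln t.
have radt : ln t <= rad by rewrite ler_peMl//; lra.
have rad1 : 1 <= rad by apply: le_trans radt.
have tauG : beta^-1 * expR (- (beta * (rad / 2))) <= beta^-1 * (ln t ^+ r * G).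
  rewrite ler_wpM2l ?invr_ge0 ?(ltW b0)//; apply: (@le_trans _ _ G); last by rewrite ler_peMl.
  apply: le_trans G1; rewrite /powR gt_eqF// ler_expR /rad.
  have : 1 * ln t <= beta * b * ln t by rewrite ler_wpM2r//; lra.
  lra.
apply: (@le_trans _ _ (C * (rad ^+ r * G + beta^-1 * expR (- (beta * (rad / 2)))))%:E).
  apply: (hC s kappa disp Omega Pr P X mu rad n _ mc rs rad1 t1 radt) => i.
  rewrite -[X in X%:E]add0r.
  have mX : measurable_fun setT (X i) by exact: measurable_funPT.
  have e0 w : 0 <= enorm (X i w) by exact: sqrtr_ge0.
  apply: (integral_le_moment (Y := fun w => expR (beta * enorm (X i w)) - 1)) => //.
  - by rewrite mulr_ge0 ?invr_ge0 ?expR_ge0 ?(ltW b0).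
  - apply: measurable_funB => //; apply: measurableT_comp => //.
    apply: measurable_funM => //.
    by apply: measurableT_comp mX; exact: measurable_enorm.
  - move=> w; have := expR_ge1Dx (beta * enorm (X i w)).
    by have := mulr_ge0 (ltW b0) (e0 w); lra.
  - move=> w; rewrite add0r; apply: excess_le_expR => //; rewrite divr_ge0//; lra.
rewrite lee_fin -2!mulrA ler_wpM2l// [leRHS]mulrDl; apply: lerD => //.
by rewrite /rad exprMn -mulrA.
Qed.

End rates_of_convergence.

(** * The two rates of convergence *)

Theorem corollary1p3 (R : realType) (d s : nat) (D : R) (Phi : R -> R)
    (hd : (0 < d)%N) (hs : (0 < s)%N) (hD : 1 <= D)
    (hPhi : (exists2 q : R, 1 < q & power_moment q Phi) \/
            (exists2 beta : R, 0 < beta & exp_moment beta Phi)) :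
  exists C : R,
  forall (r : nat) (hr : (1 <= r <= s)%N) (kappa : R) (hkappa : 0 < kappa < 1)
    (P : R.-pker 'rV[R]_d ~> 'rV[R]_d)
    (hP1 : forall n x, (0 < n)%N -> in_P1 (kiter P n x))
    (hW1 : forall n x y, (0 < n)%N ->
      (W1 (kiter P n x) (kiter P n y) <=
         (D * kappa ^+ n * enorm (x - y))%:E)%E)
    (disp : measure_display) (Omega : measurableType disp)
    (Pr : probability Omega R) (X : nat -> {RV Pr >-> 'rV[R]_d})
    (hX : markov_chain P X)
    (hmoment :
      (ereal_sup [set 'E_Pr[fun w => Phi (enorm (X n w))] | n in [set: nat]]
         <= 1)%E)
    (mu : probability 'rV[R]_d R) (hmu1 : in_P1 mu) (hmu : invariant_measure P mu),
    (forall q : R, 1 < q -> power_moment q Phi ->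
      \forall n \near \oo,
        (\int[Pr]_w d_Cs1 s mu (empirical X n w) <=
           (C * Gamma d r ((1 - kappa) * n%:R)
                  `^ ((q - 1) / (q + r%:R - 1)))%:E)%E) /\
    (forall beta : R, 0 < beta -> exp_moment beta Phi ->
      \forall n \near \oo,
        (\int[Pr]_w d_Cs1 s mu (empirical X n w) <=
           (C * ln ((1 - kappa) * n%:R) ^+ r
              * Gamma d r ((1 - kappa) * n%:R))%:E)%E).
Proof.
(* The constant is chosen before [q] and [beta], which is legitimate because
   [Phi] determines them. *)
have Phi_inj (q q' : R) : power_moment q Phi -> power_moment q' Phi -> q = q'.
  move=> h h'; have : (2 : R) `^ q = 2 `^ q' by rewrite -h// -h'.
  rewrite /powR gt_eqF// => /expR_inj; apply: mulIf; rewrite gt_eqF//.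
  by have := @ln2_ge_half R; lra.
have Phi_inj' (b b' : R) : exp_moment b Phi -> exp_moment b' Phi -> b = b'.
  move=> h h'; have : expR (b * 1) - 1 = expR (b' * 1) - 1 by rewrite -h// -h'.
  by rewrite !mulr1 => /addIr/expR_inj.
have power r : exists C : R, 0 <= C /\ ((0 < r)%N -> forall q, 1 < q -> power_moment q Phi ->
    forall s kappa (disp : measure_display) (Omega : measurableType disp)
      (Pr : probability Omega R) P (X : nat -> {RV Pr >-> 'rV[R]_d}) mu,
    moment_chain D kappa (Num.min q 2) 8 P X mu -> (r <= s)%N ->
    (forall i, \int[Pr]_w (enorm (X i w) `^ q)%:E <= 1)%E ->
    \forall n \near \oo, (\int[Pr]_w d_Cs1 s mu (empirical X n w) <=
      (C * Gamma d r ((1 - kappa) * n%:R) `^ ((q - 1) / (q + r%:R - 1)))%:E)%E).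
  case: (posnP r) => [->|r0]; first by exists 0.
  have [[q [q1 hq]]|no] := pselect (exists q : R, 1 < q /\ power_moment q Phi); last first.
    by exists 0; split => // _ q q1 hq; case: no; exists q.
  have [C C0 hC] := @power_rate R d r hd r0 q D q1 hD.
  by exists C; split => // _ q' _ /Phi_inj/(_ hq) ->.
have exponential r : exists C : R, 0 <= C /\ ((0 < r)%N -> forall b, 0 < b -> exp_moment b Phi ->
    forall s kappa (disp : measure_display) (Omega : measurableType disp)
      (Pr : probability Omega R) P (X : nat -> {RV Pr >-> 'rV[R]_d}) mu,
    moment_chain D kappa 2 (2 + 4 / b ^+ 2) P X mu -> (r <= s)%N ->
    (forall i, \int[Pr]_w (expR (b * enorm (X i w)) - 1)%:E <= 1)%E ->
    \forall n \near \oo, (\int[Pr]_w d_Cs1 s mu (empirical X n w) <=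
      (C * ln ((1 - kappa) * n%:R) ^+ r * Gamma d r ((1 - kappa) * n%:R))%:E)%E).
  case: (posnP r) => [->|r0]; first by exists 0.
  have [[b [b0 hb]]|no] := pselect (exists b : R, 0 < b /\ exp_moment b Phi); last first.
    by exists 0; split => // _ b b0 hb; case: no; exists b.
  have [C C0 hC] := @exponential_rate R d r hd r0 b D b0 hD.
  by exists C; split => // _ b' _ /Phi_inj'/(_ hb) ->.
have [Cp hCp] := choice power; have [Ce hCe] := choice exponential.
(* A sum of nonnegative constants dominates the one of every [r]. *)
exists (\sum_(1 <= r < s.+1) (Cp r + Ce r)).
move=> r hr kappa hkappa P hP1 hW1 disp Omega Pr X hX hmoment mu hmu1 hmu.
case/andP: hr => r0 rs; set C := \sum_(_ <= _ < _) _.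
have [Cp0 hp] := hCp r; have [Ce0 he] := hCe r.
have Cr : Cp r + Ce r <= C.
  rewrite /C (bigD1_seq r) ?mem_index_iota ?iota_uniq ?r0//= lerDl sumr_ge0// => i _.
  by rewrite addr_ge0//; [case: (hCp i) | case: (hCe i)].
have mX n : measurable_fun setT (X n) by exact: measurable_funPT.
have e0 n w : 0 <= enorm (X n w) by exact: sqrtr_ge0.
have moment n : (\int[Pr]_w (Phi (enorm (X n w)))%:E <= 1)%E.
  apply: le_trans hmoment; apply: ereal_sup_ubound; exists n => //.
  by rewrite unlock.
split=> [q q1 hq | beta b0 hb].
- have m n : (\int[Pr]_w (enorm (X n w) `^ q)%:E <= 1)%E.
    by apply: le_trans (moment n); under [leRHS]eq_integral do rewrite hq//.
  have mc : moment_chain D kappa (Num.min q 2) 8 P X mu.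
    split => // n; rewrite (_ : 8 = 4 + 4); last by ring.
    apply: (integral_le_moment (Y := fun w => enorm (X n w) `^ q)) => //.
    + apply: (measurableT_comp (measurable_powR q)).
      by apply: measurableT_comp (mX n); exact: measurable_enorm.
    + by move=> w; exact: powR_ge0.
    + by move=> w; exact: powR_moment_le.
  apply: filterS (hp r0 q q1 hq s kappa _ _ _ P X mu mc rs m) => n /le_trans; apply.
  by rewrite lee_fin ler_wpM2r ?powR_ge0//; lra.
- have m n : (\int[Pr]_w (expR (beta * enorm (X n w)) - 1)%:E <= 1)%E.
    by apply: le_trans (moment n); under [leRHS]eq_integral do rewrite hb//.
  have mc : moment_chain D kappa 2 (2 + 4 / beta ^+ 2) P X mu.
    split => // n.
    apply: (integral_le_moment (Y := fun w => expR (beta * enorm (X n w)) - 1)) => //.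
    + by rewrite divr_ge0// exprn_ge0// ltW.
    + apply: measurable_funB => //; apply: measurableT_comp => //.
      apply: measurable_funM => //.
      by apply: measurableT_comp (mX n); exact: measurable_enorm.
    + move=> w; have := expR_ge1Dx (beta * enorm (X n w)).
      by have := mulr_ge0 (ltW b0) (e0 n w); lra.
    + by move=> w; exact: expR_moment_le.
  have big := near_large_sample (expR 1) hkappa.
  have res := he r0 beta b0 hb s kappa _ _ _ P X mu mc rs m.
  apply: filterS (filterI res big) => n [h te]; apply: (le_trans h).
  have t0 := lt_le_trans (expR_gt0 1) te.
  have t1 : 1 <= ln ((1 - kappa) * n%:R) by rewrite -[leLHS](expRK 1) ler_ln ?posrE ?expR_gt0.
  have G0 : 0 <= Gamma d r ((1 - kappa) * n%:R).
    by apply: le_trans (Gamma_ge hd r0 t1); exact: powR_ge0.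
  rewrite lee_fin -!mulrA ler_wpM2r//; last lra.
  by rewrite mulr_ge0// exprn_ge0//; lra.
Qed.
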